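(* Suppose the model assumptions (i)–(vi) of the context hold, that $\frac1n\hat{\Sigma}\to Q_0$ in probability as $n\to\infty$, where $Q_0$ is a nonrandom positive definite $p\times p$ matrix, and that $R_1BR_2=\theta$. Then, as $n\to\infty$, $$\begin{pmatrix} n^{1/2}(\hat B_1-B)\\ n^{1/2}(\tilde B(\hat\Sigma)-B)\end{pmatrix}\xrightarrow{d}\begin{pmatrix}\eta_1\\ \zeta^*\end{pmatrix}\sim\mathcal N_{2p\times q}\left(\begin{pmatrix}0\\0\end{pmatrix},\begin{pmatrix}\Sigma_{11}&\Sigma_{12}(Q_0)\\ \Sigma_{21}(Q_0)&\Sigma_{22}(Q_0)\end{pmatrix}\right),$$ where $\Sigma_{11}=A_1\Lambda A_1'$, $\Sigma_{12}(Q_0)=A_1\Lambda A_2(Q_0)'$, $\Sigma_{21}(Q_0)=\Sigma_{12}(Q_0)'$, $\Sigma_{22}(Q_0)=A_2(Q_0)\Lambda A_2(Q_0)'$, with $A_1=(\Sigma K)^{-1}\otimes I_q$ and $$A_2(Q_0)=A_1-\Big(Q_0^{-1}R_1'(R_1Q_0^{-1}R_1')^{-1}R_1(\Sigma K)^{-1}\Big)\otimes\Big(R_2(R_2'R_2)^{-1}R_2'\Big).$$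
   Context: Conventions: $'$ is transpose, $\otimes$ the Kronecker product, $I_m$ the identity matrix. For a matrix $A$, $\operatorname{vec}(A)$ denotes the column vector obtained by stacking the rows of $A$ (so $\operatorname{vec}(AYC)=(A\otimes C')\operatorname{vec}(Y)$). A random $a\times b$ matrix $Y$ is $\mathcal N_{a\times b}(\mu,\Omega)$ if $\operatorname{vec}(Y)$ is (possibly degenerate) $ab$-variate normal with mean $\operatorname{vec}(\mu)$ and covariance matrix $\Omega$. Model: for each sample size $n$, $Z=DB+E$, $X=D+\Delta$, $D=M+\Psi$, where $Z,E$ are $n\times q$, $D,X,\Delta,M,\Psi$ are $n\times p$, $B$ is the $p\times q$ matrix of regression coefficients, $M$ is nonrandom, and $E=(\epsilon_{ij})$, $\Delta=(\delta_{ij})$, $\Psi=(\psi_{ij})$ are random; $Z,X$ are observed. As $n$ grows, rows are appended. $R_1$ ($r_1\times p$), $R_2$ ($q\times r_2$), $\theta$ ($r_1\times r_2$) are known matrices. Assumptions: (i) the $\epsilon_{ij}$ are independent with mean $0$, variance $\sigma_\epsilon^2$, third moment $\gamma_{1\epsilon}\sigma_\epsilon^3$, fourth moment $(\gamma_{2\epsilon}+3)\sigma_\epsilon^4$; (ii) the $\delta_{ij}$ are i.i.d. with mean $0$, variance $\sigma_\delta^2$, third moment $\gamma_{1\delta}\sigma_\delta^3$, fourth moment $(\gamma_{2\delta}+3)\sigma_\delta^4$; (iii) the $\psi_{ij}$ are i.i.d. with mean $0$, variance $\sigma_\psi^2$, third moment $\gamma_{1\psi}\sigma_\psi^3$, fourth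 moment $(\gamma_{2\psi}+3)\sigma_\psi^4$; (iv) $\Delta,\Psi,E$ are mutually independent; (v) the $n$-th row of $M$, written as a column vector $M_{(n)}\in\mathbb R^p$, converges to a finite vector $\sigma_M\in\mathbb R^p$ as $n\to\infty$; (vi) $\operatorname{rank}X=p$, $\operatorname{rank}R_1=r_1$, $\operatorname{rank}R_2=r_2$. All inverses written below are assumed to exist. Notation: $\Sigma_X=n^{-1}M'M+\sigma_\psi^2I_p+\sigma_\delta^2I_p$, $\Sigma_D=n^{-1}M'M+\sigma_\psi^2I_p$, $K_X=\Sigma_X^{-1}\Sigma_D$, $\Sigma=\sigma_M\sigma_M'+\sigma_\psi^2I_p+\sigma_\delta^2I_p$, $K=\Sigma^{-1}(\Sigma-\sigma_\delta^2I_p)$. Further $\bar K_X=(\Sigma_X-\Sigma_D)\Sigma_X^{-1}$, $H=n^{-1/2}X'X-n^{1/2}\Sigma_X$, $h=n^{-1/2}X'(E-\Delta B)+n^{1/2}\sigma_\delta^2B$, and $\Lambda=\lim_{n\to\infty}\mathrm E[u_nu_n']$ (a $pq\times pq$ matrix; the limit exists), where $u_n\in\mathbb R^{pq}$ is obtained by stacking the columns of the $q\times p$ matrix $h'+B'\bar K_XH$. Estimators: the unrestricted estimator is $\hat B_1=K_X^{-1}(X'X)^{-1}X'Z$. For an observable symmetric positive definite $p\times p$ matrix $\hat\Sigma$ (possibly random and depending on $n$), the restricted estimator is $$\tilde B(\hat\Sigma)=\hat B_1-\hat\Sigma^{-1}R_1'\big[R_1\hat\Sigma^{-1}R_1'\big]^{-1}(R_1\hat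 B_1R_2-\theta)(R_2'R_2)^{-1}R_2'.$$ *)

(* Defs.v *)
From HB Require Import structures.
From mathcomp Require Import all_boot all_order all_algebra.
From mathcomp Require Import all_classical all_reals all_analysis.
From mathcomp Require Export mxtens.
Set Implicit Arguments.
Unset Strict Implicit.
Unset Printing Implicit Defensive.
Import Order.TTheory GRing.Theory Num.Theory.
Import numFieldNormedType.Exports.
Local Open Scope classical_set_scope.
Local Open Scope ring_scope.

Section LinearAlgebra.
Variable R : realType.

(* [mxvec] lists the entries row by row: this is the row-stacking vec. *)
Definition vec (m n : nat) (A : 'M[R]_(m, n)) : 'cV[R]_(m * n) := (mxvec A)^T.

Lemma mxvec_index_mxtens (m n : nat) (i : 'I_m) (j : 'I_n) :
  mxvec_index i j = mxtens_index (i, j).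
Proof.
have index_allpairs (s t : seq nat) (x y : nat) : x \in s -> y \in t ->
    index (x, y) [seq (a, b) | a <- s, b <- t]
    = (index x s * size t + index y t)%N.
  move=> + yt; elim: s => // a s IHs; rewrite inE /= index_cat size_map.
  have [->|xa /= xs] := eqVneq x a.
    by rewrite map_f// mul0n add0n index_map// => u v [].
  rewrite mulSn -addnA -IHs//; case: ifP => // /mapP[b _ [xa']].
  by rewrite xa' eqxx in xa.
apply: val_inj; rewrite /=.
have -> : nat_of_ord (enum_rank (i, j))
    = index (i, j) (enum {: 'I_m * 'I_n}).
  by rewrite -[in RHS](nth_enum_rank (i, j) (i, j)) index_uniq ?enum_uniq// -cardE.
have -> : enum {: 'I_m * 'I_n}
    = [seq (a, b) | a <- enum 'I_m, b <- enum 'I_n].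
  by rewrite [LHS]enumT unlock.
pose v (c : 'I_m * 'I_n) := (val c.1, val c.2).
have vI : injective v by move=> [a b] [c e] [] /val_inj-> /val_inj->.
have -> : index (i, j) [seq (a, b) | a <- enum 'I_m, b <- enum 'I_n]
    = index (val i, val j) [seq (a, b) | a <- iota 0 m, b <- iota 0 n].
  by rewrite -!val_enum_ord allpairs_mapl allpairs_mapr -(index_map vI) map_allpairs.
by rewrite index_allpairs ?mem_iota ?ltn_ord// size_iota -[RHS]/(i * n + j)%N
  -!val_enum_ord !(index_map val_inj) !index_enum_ord.
Qed.

Lemma vec_mulmx (m n k l : nat) (A : 'M[R]_(m, n)) (Y : 'M[R]_(n, k))
    (C : 'M[R]_(k, l)) :
  vec (A *m Y *m C) = (A *t C^T) *m vec Y.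
Proof.
apply/colP => a; case: (mxtens_indexP a) => i j.
rewrite [LHS]mxE -mxvec_index_mxtens mxvecE mxE.
rewrite [RHS]mxE (reindex _ (curry_mxvec_bij _ _)) /=.
under eq_bigr do rewrite mxE big_distrl /=.
rewrite exchange_big pair_bigA; apply: eq_bigr => -[b c] _ /=.
by rewrite [vec _ _ _]mxE mxvecE !mxvec_index_mxtens tensmxE mxE mulrAC.
Qed.

Definition posdefmx (n : nat) (A : 'M[R]_n) : Prop :=
  A^T = A /\ forall x : 'cV[R]_n, x != 0 -> 0 < (x^T *m A *m x) 0 0.

End LinearAlgebra.

Section Probability.
Context {R : realType} {d : measure_display} {T : measurableType d}.
Variable P : probability T R.

Definition mutually_independent (I : eqType) (F : I -> set (set T)) : Prop :=
  forall (s : seq I) (A : I -> set T), uniq s ->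
    (forall i, i \in s -> F i (A i)) ->
    P (\big[setI/setT]_(i <- s) A i) = (\prod_(i <- s) P (A i))%E.

(* The events that only depend on the real-valued map X. *)
Definition events_of (X : T -> R) : set (set T) :=
  preimage_set_system setT X measurable.

Definition independent_RVs (I : eqType) (X : I -> T -> R) : Prop :=
  mutually_independent (fun i => events_of (X i)).

Definition sigma_of (I : Type) (X : I -> T -> R) : set (set T) :=
  <<s \bigcup_(i in [set: I]) events_of (X i) >>.

Definition same_law (X Y : {RV P >-> R}) : Prop :=
  forall A : set R, measurable A -> distribution P X A = distribution P Y A.

(* For a centred X these are also its central moments. *)
Definition moments4 (X : T -> R) (sigma gamma1 gamma2 : R) : Prop :=
  [/\ 'E_P[X]%E = 0%E,
      'V_P[X]%E = (sigma ^+ 2)%:E,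
      'E_P[fun w => (X w ^+ 3)%R]%E = (gamma1 * sigma ^+ 3)%:E &
      'E_P[fun w => (X w ^+ 4)%R]%E = ((gamma2 + 3) * sigma ^+ 4)%:E].

(* The first n rows of an infinite array, as a random n x k matrix. *)
Definition first_rows (k : nat) (a : nat -> 'I_k -> {RV P >-> R}) (n : nat)
    (w : T) : 'M[R]_(n, k) :=
  \matrix_(i < n, j < k) a i j w.

Definition entry (m n : nat) (Y : T -> 'M[R]_(m, n)) (ij : 'I_m * 'I_n)
    (w : T) : R := Y w ij.1 ij.2.

(* S is a (measurable) function of the observed matrices Z and X. *)
Definition observable (m n m1 n1 m2 n2 : nat) (Z : T -> 'M[R]_(m1, n1))
    (X : T -> 'M[R]_(m2, n2)) (S : T -> 'M[R]_(m, n)) : Prop :=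
  forall ij, events_of (entry S ij) `<=`
    sigma_of (fun k : ('I_m1 * 'I_n1) + ('I_m2 * 'I_n2) =>
      match k with inl ab => entry Z ab | inr ab => entry X ab end).

Definition cvg_in_probability (m n : nat) (Y : nat -> T -> 'M[R]_(m, n))
    (L : 'M[R]_(m, n)) : Prop :=
  forall e : R, 0 < e -> P [set w | e <= `|Y k w - L|] @[k --> \oo] --> 0%E.

(* s = 0 is the degenerate case; [normal_prob m 0] is not the Dirac mass. *)
Definition normal_RV (X : T -> R) : Prop :=
  exists m s : R, 0 <= s /\ forall A : set R, measurable A ->
    P (X @^-1` A) = if s == 0 then \d_m A else normal_prob m s A.

Definition normal_mx (a b : nat) (Y : T -> 'M[R]_(a, b)) (mu : 'M[R]_(a, b))
    (Omega : 'M[R]_(a * b)) : Prop :=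
  [/\ forall ij, measurable_fun setT (entry Y ij),
      forall t : 'cV[R]_(a * b), normal_RV (fun w => (t^T *m vec (Y w)) 0 0),
      forall k, 'E_P[fun w => vec (Y w) k 0%R]%E = (vec mu k 0)%:E &
      forall k l, covariance P (fun w => vec (Y w) k 0)
                    (fun w => vec (Y w) l 0) = (Omega k l)%:E].

End Probability.

Definition cvg_in_distribution {R : realType} {d d' : measure_display}
    {T : measurableType d} {T' : measurableType d'}
    (P : probability T R) (P' : probability T' R) (m n : nat)
    (Y : nat -> T -> 'M[R]_(m, n)) (W : T' -> 'M[R]_(m, n)) : Prop :=
  forall f : 'M[R]_(m, n) -> R, continuous f ->
    (exists C : R, forall x, `|f x| <= C) ->
    'E_P[f \o Y k]%E @[k --> \oo] --> 'E_P'[f \o W]%E.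

Section Model.
Context {R : realType}.
Variables (p q : nat) (spsi sdelta : R).

Definition SigmaD (n : nat) (M : 'M[R]_(n, p)) : 'M[R]_p :=
  n%:R^-1 *: (M^T *m M) + (spsi ^+ 2)%:M.

Definition SigmaX (n : nat) (M : 'M[R]_(n, p)) : 'M[R]_p :=
  n%:R^-1 *: (M^T *m M) + (spsi ^+ 2)%:M + (sdelta ^+ 2)%:M.

Definition KX (n : nat) (M : 'M[R]_(n, p)) : 'M[R]_p :=
  invmx (SigmaX M) *m SigmaD M.

Definition KbarX (n : nat) (M : 'M[R]_(n, p)) : 'M[R]_p :=
  (SigmaX M - SigmaD M) *m invmx (SigmaX M).

Definition Sigma_lim (sM : 'cV[R]_p) : 'M[R]_p :=
  sM *m sM^T + (spsi ^+ 2)%:M + (sdelta ^+ 2)%:M.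

Definition K_lim (sM : 'cV[R]_p) : 'M[R]_p :=
  invmx (Sigma_lim sM) *m (Sigma_lim sM - (sdelta ^+ 2)%:M).

Definition Hmx (n : nat) (M X : 'M[R]_(n, p)) : 'M[R]_p :=
  (Num.sqrt n%:R)^-1 *: (X^T *m X) - Num.sqrt n%:R *: SigmaX M.

Definition hmx (n : nat) (X Delta : 'M[R]_(n, p)) (E : 'M[R]_(n, q))
    (B : 'M[R]_(p, q)) : 'M[R]_(p, q) :=
  (Num.sqrt n%:R)^-1 *: (X^T *m (E - Delta *m B))
  + (Num.sqrt n%:R * sdelta ^+ 2) *: B.

(* Stacking the columns of a matrix is stacking the rows of its transpose. *)
Definition uvec (n : nat) (M X Delta : 'M[R]_(n, p)) (E : 'M[R]_(n, q))
    (B : 'M[R]_(p, q)) : 'cV[R]_(p * q) :=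
  vec ((hmx X Delta E B)^T + B^T *m KbarX M *m Hmx M X)^T.

Definition Bhat1 (n : nat) (M X : 'M[R]_(n, p)) (Z : 'M[R]_(n, q)) :
    'M[R]_(p, q) :=
  invmx (KX M) *m invmx (X^T *m X) *m X^T *m Z.

Definition Btilde (r1 r2 : nat) (R1 : 'M[R]_(r1, p)) (R2 : 'M[R]_(q, r2))
    (theta : 'M[R]_(r1, r2)) (n : nat) (M X : 'M[R]_(n, p))
    (Z : 'M[R]_(n, q)) (S : 'M[R]_p) : 'M[R]_(p, q) :=
  Bhat1 M X Z
  - invmx S *m R1^T *m invmx (R1 *m invmx S *m R1^T)
    *m (R1 *m Bhat1 M X Z *m R2 - theta) *m invmx (R2^T *m R2) *m R2^T.

Definition A1mx (sM : 'cV[R]_p) : 'M[R]_(p * q) :=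
  invmx (Sigma_lim sM *m K_lim sM) *t (1%:M : 'M[R]_q).

Definition A2mx (r1 r2 : nat) (R1 : 'M[R]_(r1, p)) (R2 : 'M[R]_(q, r2))
    (sM : 'cV[R]_p) (Q : 'M[R]_p) : 'M[R]_(p * q) :=
  A1mx sM
  - (invmx Q *m R1^T *m invmx (R1 *m invmx Q *m R1^T) *m R1
       *m invmx (Sigma_lim sM *m K_lim sM))
    *t (R2 *m invmx (R2^T *m R2) *m R2^T).

End Model.

Definition second_moment {R : realType} {d : measure_display}
    {T : measurableType d} (P : probability T R) (k : nat)
    (u : T -> 'cV[R]_k) : 'M[R]_k :=
  \matrix_(i, j) fine 'E_P[fun w => (u w *m (u w)^T)%R i j]%E.

(* [mulnDl] identifies the index set of the vec of a stacked (p + p) x q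
   matrix with that of the two stacked vecs. *)
Definition joint_cov {R : realType} (p q : nat)
    (S11 S12 S21 S22 : 'M[R]_(p * q)) : 'M[R]_((p + p) * q) :=
  castmx (esym (mulnDl p p q), esym (mulnDl p p q))
    (block_mx S11 S12 S21 S22).

(* Main.v *)
(** Put V_n = (h' + B' Kbar_X H)', so that u_n = vec V_n.  Since K_X = I - Kbar_X,
    one has exactly n^(1/2) (Bhat_1 - B) = G with G = K_X^-1 (X'X / n)^-1 V_n and,
    when R_1 B R_2 = theta,
    n^(1/2) (Btilde - B) = G - C G R_2 (R_2' R_2)^-1 R_2', where C depends on
    Sigmahat only up to scale, hence only on Sigmahat / n.  As X'X / n, K_X and
    Sigmahat / n converge in probability, it remains to see that V_n is
    asymptotically normal (Slutsky).

    Up to a term vanishing in mean square, V_n is n^(-1/2) times the sum over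
    the rows of one fixed centred quadratic polynomial of the noises of the row.
    The squares of the delta and psi it contains have a law independent of the
    row, the eps only occur linearly or multiplied by an independent noise, so
    that their fourth moments suffice: Lindeberg's condition holds in every
    direction, and replacing the summands one at a time gives the limit of
    E cos (t . V_n + b).  Tightness and uniform approximation on cubes by
    trigonometric polynomials (in the manner of the lattice form of the
    Stone-Weierstrass theorem) turn the limits of these cosines into convergence
    in distribution. *)
From HB Require Import structures.
Require Import Defs.
From mathcomp Require Import all_boot all_order all_algebra.
From mathcomp Require Import all_classical all_reals all_analysis.
From mathcomp Require Import measurable_realfun.
From mathcomp Require finmap.
From mathcomp Require Import ring lra.
Set Implicit Arguments.
Unset Strict Implicit.
Unset Printing Implicit Defensive.
Import Order.TTheory GRing.Theory Num.Theory.
Import numFieldNormedType.Exports.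
Local Open Scope classical_set_scope.
Local Open Scope ring_scope.

(** * Means and square integrability *)

(** Only four moments are available. The squares of the deltas and psis thus have a second moment
    and nothing higher to control them, while the eps have controlled moments but no common law.
    Means of row polynomials of degree at most four depend on these moments alone, hence not on the
    row; the identity of laws enters only through Lindeberg's condition. Closeness of V_n to its row
    sum is kept in mean square rather than in probability, because Lambda is a limit of second
    moments and has to be recognised as the covariance of the polynomial of one row. The rest
    happens along one filter, that of the events of probability tending to 1. Limits in probability
    become ordinary limits along a filter, matrix inversion is continuous there at an invertible
    limit, and the exact error formulas, which require invertible matrices, hold eventually along
    it. The limit variable lives on a space built for it: a linear image of independent standard
    normal variables on a product of normal laws. *)

Section Mean.
Context {R : realType} {d : measure_display} {T : measurableType d}.
Variable P : probability T R.
Implicit Types f g : T -> R.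

Definition integ f : Prop := P.-integrable setT (EFin \o f).
(** Real-valued: an infinite integral is read as 0, which is why linearity and monotonicity are
    stated under integrability. *)
Definition mean f : R := \int[P]_w f w.

Lemma integ_measurable f : integ f -> measurable_fun setT f.
Proof. by move=> /measurable_int /measurable_EFinP. Qed.

Lemma expectation_mean f : integ f -> 'E_P[f]%E = (mean f)%:E.
Proof. by move=> fi; rewrite unlock /mean /Rintegral fineK// integrable_fin_num. Qed.

Lemma integ_cst c : integ (cst c).
Proof. by apply: finite_measure_integrable_cst. Qed.

Lemma integ_le f g : measurable_fun setT f -> (forall w, `|f w| <= g w) ->
  integ g -> integ f.
Proof.
move=> mf fg; apply: le_integrable => //; first exact/measurable_EFinP.
by move=> w _ /=; rewrite lee_fin (le_trans (fg w))// ler_norm.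
Qed.

Lemma integ_bounded f c : measurable_fun setT f -> (forall w, `|f w| <= c) ->
  integ f.
Proof. by move=> mf fc; apply: integ_le mf fc (integ_cst c). Qed.

Lemma integD f g : integ f -> integ g -> integ (fun w => f w + g w).
Proof. by move=> fi gi; exact: (integrableD measurableT fi gi). Qed.

Lemma integZ c f : integ f -> integ (fun w => c * f w).
Proof. by move=> fi; exact: (integrableZl measurableT c fi). Qed.

Lemma integN f : integ f -> integ (fun w => - f w).
Proof. by move=> fi; exact: (integrableN fi). Qed.

Lemma integB f g : integ f -> integ g -> integ (fun w => f w - g w).
Proof. by move=> fi gi; apply: integD => //; exact: integN. Qed.

Lemma integ_norm f : integ f -> integ (fun w => `|f w|).
Proof. by move=> fi; exact: (integrable_abse fi). Qed.

Lemma integ_sum (I : Type) (s : seq I) (f : I -> T -> R) :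
  (forall i, integ (f i)) -> integ (fun w => \sum_(i <- s) f i w).
Proof.
move=> fi; elim: s => [|i s IHs].
  by under [X in integ X]eq_fun do rewrite big_nil; exact: integ_cst.
by under [X in integ X]eq_fun do rewrite big_cons; exact: integD.
Qed.

Lemma eq_mean f g : f =1 g -> mean f = mean g.
Proof. by move=> /funext ->. Qed.

Lemma mean_cst c : mean (cst c) = c.
Proof.
by rewrite /mean Rintegral_cst//= probability_setT mulr1.
Qed.

Lemma meanD f g : integ f -> integ g ->
  mean (fun w => f w + g w) = mean f + mean g.
Proof. by move=> fi gi; exact: RintegralD. Qed.

Lemma meanZ c f : integ f -> mean (fun w => c * f w) = c * mean f.
Proof. by move=> fi; exact: RintegralZl. Qed.

Lemma meanN f : integ f -> mean (fun w => - f w) = - mean f.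
Proof.
move=> fi; under eq_mean do rewrite -mulN1r.
by rewrite meanZ// mulN1r.
Qed.

Lemma meanB f g : integ f -> integ g ->
  mean (fun w => f w - g w) = mean f - mean g.
Proof. by move=> fi gi; exact: RintegralB. Qed.

Lemma mean_sum (I : Type) (s : seq I) (f : I -> T -> R) :
  (forall i, integ (f i)) ->
  mean (fun w => \sum_(i <- s) f i w) = \sum_(i <- s) mean (f i).
Proof.
move=> fi; elim: s => [|i s IHs].
  by under eq_mean do rewrite big_nil; rewrite big_nil mean_cst.
under eq_mean do rewrite big_cons.
by rewrite big_cons meanD// ?IHs//; exact: integ_sum.
Qed.

Lemma mean_le f g : integ f -> integ g -> (forall w, f w <= g w) ->
  mean f <= mean g.
Proof. by move=> fi gi fg; exact: le_Rintegral. Qed.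

Lemma mean_ge0 f : (forall w, 0 <= f w) -> 0 <= mean f.
Proof. by move=> f0; apply: Rintegral_ge0. Qed.

Lemma mean_norm f : integ f -> `|mean f| <= mean (fun w => `|f w|).
Proof. by move=> fi; exact: le_normr_Rintegral. Qed.

Lemma mean_norm_le f g : integ f -> integ g -> (forall w, `|f w| <= g w) ->
  `|mean f| <= mean g.
Proof.
move=> fi gi fg; apply: le_trans (mean_norm fi) _.
by apply: mean_le => //; exact: integ_norm.
Qed.

Lemma mean_dist f g h : integ f -> integ g -> integ h ->
  (forall w, `|f w - g w| <= h w) -> `|mean f - mean g| <= mean h.
Proof.
by move=> fi gi hi fgh; rewrite -meanB//; apply: mean_norm_le => //; exact: integB.
Qed.

(** Measurability is recorded separately because it does not follow from that of the square. *)
Definition sqint f : Prop := measurable_fun setT f /\ integ (fun w => f w ^+ 2).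

Lemma sqint_measurable f : sqint f -> measurable_fun setT f. Proof. by case. Qed.

Lemma sqint_integ f : sqint f -> integ f.
Proof.
move=> [mf fi]; apply: (@integ_le _ (fun w => 1 + f w ^+ 2)) => //; last first.
  by apply: integD => //; exact: integ_cst.
by move=> w; rewrite -[f w ^+ 2]real_normK ?num_real//; nra.
Qed.

Lemma sqint_mul f g : sqint f -> sqint g -> integ (fun w => f w * g w).
Proof.
move=> [mf fi] [mg gi].
apply: (@integ_le _ (fun w => f w ^+ 2 + g w ^+ 2)); last exact: integD.
  exact: measurable_funM.
move=> w; rewrite -[f w ^+ 2]real_normK ?num_real//.
by rewrite -[g w ^+ 2]real_normK ?num_real// normrM; nra.
Qed.

Lemma sqint_cst c : sqint (cst c).
Proof. by split=> //; exact: (integ_cst (c ^+ 2)). Qed.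

Lemma sqintZ c f : sqint f -> sqint (fun w => c * f w).
Proof.
move=> [mf fi]; split; first exact: measurable_funM.
by under [X in integ X]eq_fun do rewrite exprMn; exact: integZ.
Qed.

Lemma sqintD f g : sqint f -> sqint g -> sqint (fun w => f w + g w).
Proof.
move=> sf sg; split; first by apply: measurable_funD; [case: sf|case: sg].
under [X in integ X]eq_fun do rewrite sqrrD -mulr_natl.
have fg := sqint_mul sf sg; case: sf sg => [mf fi] [mg gi].
by apply: integD => //; apply: integD => //; exact: integZ.
Qed.

Lemma sqintB f g : sqint f -> sqint g -> sqint (fun w => f w - g w).
Proof.
move=> sf sg; under [X in sqint X]eq_fun do rewrite -mulN1r.
by apply: sqintD => //; exact: sqintZ.
Qed.

Lemma sqint_sum (I : Type) (s : seq I) (f : I -> T -> R) :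
  (forall i, sqint (f i)) -> sqint (fun w => \sum_(i <- s) f i w).
Proof.
move=> fi; elim: s => [|i s IHs].
  by under [X in sqint X]eq_fun do rewrite big_nil; exact: sqint_cst.
by under [X in sqint X]eq_fun do rewrite big_cons; exact: sqintD.
Qed.

Lemma mean_sqrD_le f g : sqint f -> sqint g ->
  mean (fun w => (f w + g w) ^+ 2) <=
  2 * (mean (fun w => f w ^+ 2) + mean (fun w => g w ^+ 2)).
Proof.
move=> sf sg; have [_ fgi] := sqintD sf sg; case: sf sg => [mf fi] [mg gi].
rewrite -meanD// -meanZ; last exact: integD.
apply: mean_le => //; first by apply: integZ; exact: integD.
move=> w; have := sqr_ge0 (f w - g w).
by rewrite sqrrB sqrrD; lra.
Qed.

(** Expand c (|f| - |g| / c)^2 >= 0. The free weight c lets a vanishing second moment absorb one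
    that is merely bounded. *)
Lemma mean_mul_le f g c : 0 < c -> sqint f -> sqint g ->
  `|mean (fun w => f w * g w)| <=
  c * mean (fun w => f w ^+ 2) + c^-1 * mean (fun w => g w ^+ 2).
Proof.
move=> c0 sf sg; have fg := sqint_mul sf sg; case: sf sg => [mf fi] [mg gi].
rewrite -!meanZ// -meanD; [|exact: integZ|exact: integZ].
apply: mean_norm_le => //; first by apply: integD; exact: integZ.
move=> w; rewrite normrM -[f w ^+ 2]real_normK ?num_real//.
rewrite -[g w ^+ 2]real_normK ?num_real//.
move: `|f w| `|g w| (normr_ge0 (f w)) (normr_ge0 (g w)) => a b a0 b0.
have ci0 : 0 < c^-1 by rewrite invr_gt0.
have cc : c * c^-1 = 1 by rewrite divff// gt_eqF.
have : 0 <= c * (a - c^-1 * b) ^+ 2 by rewrite mulr_ge0 ?sqr_ge0// ltW.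
have -> : c * (a - c^-1 * b) ^+ 2 =
  c * a ^+ 2 - 2 * (c * c^-1) * a * b + (c * c^-1) * (c^-1 * b ^+ 2) by ring.
by rewrite cc; nra.
Qed.

Lemma markov_sqr f e : 0 < e -> sqint f ->
  (P [set w | (e <= `|f w|)%R] <= (e ^- 2 * mean (fun w => f w ^+ 2))%:E)%E.
Proof.
move=> e0 [mf fi].
have mA : measurable [set w | (e <= `|f w|)%R].
  rewrite -[X in measurable X]setTI.
  by apply: (measurable_fun_le (f:=cst e)) => //; exact: measurableT_comp.
rewrite -meanZ// /mean /Rintegral fineK; last first.
  by apply: integrable_fin_num => //; exact: integZ.
rewrite -[X in P X](setIT) -integral_indic//.
apply: ge0_le_integral => //.
- exact/measurable_EFinP/measurable_indic.
- by apply/measurable_EFinP; exact: (integ_measurable (integZ _ fi)).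
move=> w _; rewrite lee_fin indicE; case: (boolP (_ \in _)) => [|_]; last first.
  by rewrite mulr_ge0 ?sqr_ge0// invr_ge0 sqr_ge0.
rewrite inE /= => ef; rewrite mulrC ler_pdivlMr ?exprn_gt0// mul1r.
by rewrite -[f w ^+ 2]real_normK ?num_real// ler_sqr ?nnegrE// ltW.
Qed.

End Mean.

(** * Taylor bounds for sine, cosine and the exponential *)

Section TrigBounds.
Context {R : realType}.
Implicit Types x : R.

(** The four bounds below form a chain: both sides of each agree at 0, and the derivative of their
    difference is the difference treated just before. *)
Let nondec (F f : R -> R) (x : R) : 0 <= x -> (forall y, is_derive y (1 : R) F (f y)) ->
  (forall y : R, 0 <= y -> 0 <= f y) -> F 0 <= F x.
Proof.
move=> x0 dF f0; apply: (@ger0_derive1_le _ F 0 (x + 1) _ _ true true).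
- by move=> y _; have := dF y => -[].
- move=> y; rewrite in_itv/= => /andP[y0 _].
  by rewrite derive1E (@derive_val _ _ _ _ _ _ _ (dF y)) f0// ltW.
- apply: continuous_subspaceT => y.
  by apply: differentiable_continuous; apply/derivable1_diffP; have := dF y => -[].
- by rewrite in_itv/= lexx/= ltr_wpDl.
- by rewrite in_itv/= x0/= ltrDl.
- by [].
Qed.

Lemma sin_le_id x : 0 <= x -> sin x <= x.
Proof.
move=> x0; rewrite -subr_ge0.
have := @nondec (fun y => y - sin y) (fun y => 1 - cos y) x x0 _ _.
by rewrite sin0 subr0; apply=> y _; rewrite subr_ge0 cos_le1.
Qed.

Lemma cos_ge_1Bsqr x : 1 - x ^+ 2 / 2 <= cos x.
Proof.
wlog x0 : x / 0 <= x.
  move=> H; have [/H//|/ltW x0] := leP 0 x.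
  by rewrite -cosN -sqrrN; apply: H; rewrite oppr_ge0.
rewrite -subr_ge0.
have := @nondec (fun y => cos y - (1 - y ^+ 2 / 2)) (fun y => y - sin y) x x0 _ _.
rewrite cos0 expr0n/= mul0r subr0 subrr; apply.
  by move=> y; apply: is_derive_eq; rewrite /GRing.scale/=; lra.
by move=> y y0; rewrite subr_ge0 sin_le_id.
Qed.

Lemma sin_ge_cube x : 0 <= x -> x - x ^+ 3 / 6 <= sin x.
Proof.
move=> x0; rewrite -subr_ge0.
have := @nondec (fun y => sin y - (y - y ^+ 3 / 6))
  (fun y => cos y - (1 - y ^+ 2 / 2)) x x0 _ _.
rewrite sin0 expr0n/= mul0r subr0 subrr; apply.
  by move=> y; apply: is_derive_eq; rewrite /GRing.scale/=; lra.
by move=> y y0; rewrite subr_ge0 cos_ge_1Bsqr.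
Qed.

Lemma cos_le_quart x : cos x <= 1 - x ^+ 2 / 2 + x ^+ 4 / 24.
Proof.
wlog x0 : x / 0 <= x.
  move=> H; have [/H//|/ltW x0] := leP 0 x.
  rewrite -cosN -[x ^+ 2]sqrrN; have -> : x ^+ 4 = (- x) ^+ 4 by ring.
  by apply: H; rewrite oppr_ge0.
rewrite -subr_ge0.
have := @nondec (fun y => (1 - y ^+ 2 / 2 + y ^+ 4 / 24) - cos y)
  (fun y => sin y - (y - y ^+ 3 / 6)) x x0 _ _.
rewrite cos0 !expr0n/= !mul0r subr0 addr0 subrr; apply.
  by move=> y; apply: is_derive_eq; rewrite /GRing.scale/=; lra.
by move=> y y0; rewrite subr_ge0 sin_ge_cube.
Qed.

(* The Lindeberg gauge: [gauge 1 x = min(x^2, |x|^3)]. *)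
Definition gauge h x : R := x ^+ 2 * Num.min 1 (h * `|x|).

Lemma gauge_le_sqr h x : gauge h x <= x ^+ 2.
Proof. by rewrite /gauge ler_piMr ?sqr_ge0// ge_min lexx. Qed.

Lemma gauge_ge0 h x : 0 <= h -> 0 <= gauge h x.
Proof. by move=> h0; rewrite mulr_ge0 ?sqr_ge0// le_min ler01 mulr_ge0. Qed.

Lemma gauge_le_cube h x : gauge h x <= h * `|x| ^+ 3.
Proof.
rewrite /gauge -[x ^+ 2]real_normK ?num_real// [`|x| ^+ 3]exprSr mulrCA.
by rewrite ler_wpM2l ?sqr_ge0// ge_min lexx orbT.
Qed.

Lemma norm_sinB x : `|sin x - x| <= gauge 1 x.
Proof.
rewrite /gauge mul1r.
wlog x0 : x / 0 <= x.
  move=> H; have [/H//|/ltW x0] := leP 0 x.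
  rewrite -normrN opprD -sinN.
  rewrite -sqrrN -[`|x|]normrN; apply: H; rewrite oppr_ge0//.
rewrite distrC ger0_norm ?subr_ge0 ?sin_le_id// (ger0_norm x0).
have [x1|x1] := leP 1 x.
  rewrite mulr1; have [x2|x2] := leP x 2; last by have := sin_geN1 x; nra.
  by have := sin_ge_cube x0; rewrite exprS; have := sqr_ge0 x; nra.
by have := sin_ge_cube x0; rewrite exprS; have := sqr_ge0 x; nra.
Qed.

Lemma norm_cosB x : `|cos x - (1 - x ^+ 2 / 2)| <= gauge 1 x.
Proof.
rewrite /gauge mul1r.
wlog x0 : x / 0 <= x.
  move=> H; have [/H//|/ltW x0] := leP 0 x.
  by rewrite -cosN -sqrrN -[`|x|]normrN; apply: H; rewrite oppr_ge0.
rewrite ger0_norm ?subr_ge0 ?cos_ge_1Bsqr// (ger0_norm x0).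
have [x1|x1] := leP 1 x.
  by rewrite mulr1; have := cos_le1 x; nra.
have := cos_le_quart x; have : 0 <= x ^+ 2 by exact: sqr_ge0.
have -> : x ^+ 4 = x ^+ 2 * (x * x) by ring.
nra.
Qed.

(** From 1 - x <= exp(-x) <= 1 / (1 + x): the two ends differ by x^2 / (1 + x). *)
Lemma norm_expRNB x : 0 <= x -> `|expR (- x) - (1 - x)| <= x ^+ 2.
Proof.
move=> x0; have := expR_ge1Dx (- x) => h.
rewrite ger0_norm ?subr_ge0//.
have h1 := expR_ge1Dx x; have p : 0 < 1 + x by lra.
have : expR (- x) <= (1 + x)^-1 by rewrite expRN lef_pV2 ?posrE ?expR_gt0.
have : (1 + x)^-1 * (1 + x) = 1 by rewrite mulVf// gt_eqF.
by move: (_^-1) => y; nra.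
Qed.

End TrigBounds.

(** * Independence *)

Section IndependentSystems.
Context {R : realType} {d : measure_display} {T : measurableType d}.
Variable P : probability T R.

Definition indep_systems (G H : set (set T)) : Prop :=
  forall A B, G A -> H B -> P (A `&` B) = (P A * P B)%E.

Lemma indep_systemsC G H : indep_systems G H -> indep_systems H G.
Proof. by move=> GH A B HA GB; rewrite setIC GH// muleC. Qed.

Lemma g_sigma_measurable (G : set (set T)) :
  G `<=` measurable -> <<s G >> `<=` measurable.
Proof.
by move=> Gm; apply: smallest_sub => //; exact: sigma_algebra_measurable.
Qed.

(** For fixed B in H, the finite measures A -> P(A and B) and A -> P(B) P(A) agree on the pi-system
    G, hence on the sigma-algebra it generates. *)
Lemma indep_systems_sigmal G H : setI_closed G -> G setT ->
  G `<=` measurable -> H `<=` measurable ->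
  indep_systems G H -> indep_systems <<s G >> H.
Proof.
move=> GI GT Gm Hm GH A B sA HB.
have mB := Hm _ HB.
have fB : 0 <= fine (P B) by rewrite fine_ge0.
pose m1 : {measure set T -> \bar R} := mrestr P mB.
pose m2 : {measure set T -> \bar R} := mscale (NngNum fB) P.
have E1 C : m1 C = P (C `&` B) by [].
have E2 C : m2 C = (P B * P C)%E.
  by rewrite -[in RHS](fineK (fin_num_measure P _ mB)).
rewrite -E1 muleC -E2.
apply: (g_sigma_algebra_measure_unique G Gm (fun=> setT) (fun=> GT)) => //.
- by rewrite bigcup_const//; exists 0%N.
- by move=> C GC; rewrite E1 E2 GH// muleC.
- move=> _; rewrite E1; apply: le_lt_trans (ltry 1).
  by apply: probability_le1; exact: measurableI.
Qed.

Lemma indep_systems_sigma G H : setI_closed G -> G setT -> G `<=` measurable ->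
  setI_closed H -> H setT -> H `<=` measurable ->
  indep_systems G H -> indep_systems <<s G >> <<s H >>.
Proof.
move=> GI GT Gm HI HT Hm GH; apply: indep_systems_sigmal => //.
  exact: g_sigma_measurable.
by apply/indep_systemsC/indep_systems_sigmal => //; exact: indep_systemsC.
Qed.

(** Independence makes the law of the pair (f, g) the product of the two laws, since both agree on
    rectangles; Fubini's theorem for (x, y) -> x y under the product then gives integrability and
    the factorisation. *)
Lemma indep_mean_mul (f g : T -> R) : integ P f -> integ P g ->
  indep_systems (events_of f) (events_of g) ->
  integ P (fun w => f w * g w) /\
  mean P (fun w => f w * g w) = mean P f * mean P g.
Proof.
move=> fi gi fg; have mf := integ_measurable fi; have mg := integ_measurable gi.
pose F : {mfun T >-> R} := HB.pack f (isMeasurableFun.Build _ _ _ _ f mf).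
pose G : {mfun T >-> R} := HB.pack g (isMeasurableFun.Build _ _ _ _ g mg).
pose m1 : probability R R := distribution P F.
pose m2 : probability R R := distribution P G.
have mfg : measurable_fun setT (fun w => (f w, g w)) by exact: measurable_fun_pair.
pose FG : {mfun T >-> (R * R)%type} :=
  HB.pack (fun w => (f w, g w)) (isMeasurableFun.Build _ _ _ _ (fun w => (f w, g w)) mfg).
pose m : probability (R * R)%type R := distribution P FG.
have mE (X : set (R * R)) : measurable X -> (m1 \x m2)%E X = m X.
  apply: product_measure_unique => A B mA mB.
  rewrite /m1 /m2 /m /distribution /pushforward/= -fg; last 2 first.
  - by exists A => //; rewrite setTI.
  - by exists B => //; rewrite setTI.
  by [].
pose mu := fun x : R * R => x.1 * x.2.
have mmu : measurable_fun setT mu by apply: measurable_funM.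
have emmu : measurable_fun setT (EFin \o mu) by exact/measurable_EFinP.
have int1 : m1.-integrable setT (EFin : R -> \bar R).
  apply/integrableP; split; first exact/measurable_EFinP.
  rewrite /m1 ge0_integral_pushforward//=.
  - by case/integrableP: fi.
  - by apply/measurable_EFinP.
have int2 : m2.-integrable setT (EFin : R -> \bar R).
  apply/integrableP; split; first exact/measurable_EFinP.
  rewrite /m2 ge0_integral_pushforward//=.
  - by case/integrableP: gi.
  - by apply/measurable_EFinP.
have int12 : (m1 \x m2)%E.-integrable setT (EFin \o mu).
  apply/integrable12ltyP => //.
  have inner x : (\int[m2]_y `|(EFin \o mu) (x, y)| =
      `|x|%:E * \int[m2]_y `|y|%:E)%E.
    rewrite -ge0_integralZl//; last exact/measurable_EFinP.
    by apply: eq_integral => y _; rewrite /mu/= normrM EFinM.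
  under eq_integral do rewrite inner.
  have [_ lty2] := integrableP _ _ _ int2.
  have [_ lty1] := integrableP _ _ _ int1.
  have -> : (\int[m2]_y `|y|%:E)%E = (fine (\int[m2]_y `|y|%:E))%:E.
    by rewrite fineK// ge0_fin_numE// integral_ge0.
  rewrite ge0_integralZr//; last 2 first.
  - exact/measurable_EFinP.
  - by rewrite lee_fin fine_ge0// integral_ge0.
  apply: lte_mul_pinfty; [exact: integral_ge0| |exact: ltry].
  by rewrite ge0_fin_numE// integral_ge0.
have intm : m.-integrable setT (EFin \o mu).
  apply/integrableP; split => //; have [_] := integrableP _ _ _ int12.
  congr (_ < _)%E; apply: eq_measure_integral => A mA _; exact: mE.
have intfg : integ P (fun w => f w * g w).
  apply/integrableP; split.
    by apply/measurable_EFinP; exact: measurable_funM.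
  have [_] := integrableP _ _ _ intm.
  rewrite /m ge0_integral_pushforward//.
  by apply: measurableT_comp.
split=> //; rewrite /mean /Rintegral.
rewrite -fineM ?integrable_fin_num//; congr fine.
transitivity (\int[m]_x (EFin \o mu) x)%E.
  by rewrite /m integral_pushforward.
transitivity (\int[m1 \x m2]_x (EFin \o mu) x)%E.
  by apply: eq_measure_integral => A mA _; rewrite [RHS]mE.
have inner x : (fubini_F m2 (EFin \o mu) x = x%:E * \int[m2]_y y%:E)%E.
  by rewrite -integralZl.
transitivity (\int[m1]_x (x%:E * \int[m2]_y y%:E))%E.
  by rewrite -integral12_prod_meas1//; apply: eq_integral => x _; exact: inner.
have -> : (\int[P]_x (g x)%:E)%E = (\int[m2]_y y%:E)%E.
  by rewrite /m2 integral_pushforward//=.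
have -> : (\int[P]_x (f x)%:E)%E = (\int[m1]_y y%:E)%E.
  by rewrite /m1 integral_pushforward//=.
by rewrite -(fineK (integrable_fin_num measurableT int2)) integralZr.
Qed.

End IndependentSystems.

Section IndependentFamily.
Context {R : realType} {d : measure_display} {T : measurableType d}.
Variable P : probability T R.
Variables (I : choiceType) (X : I -> T -> R).
Hypothesis mX : forall i, measurable_fun setT (X i).
Hypothesis indX : independent_RVs P X.

(** A pi-system generating the sigma-algebra of the variables indexed by J: finite intersections
    allow independence to be used directly, before passing to the generated sigma-algebra. *)
Definition cylinders (J : set I) : set (set T) :=
  [set A | exists s (B : I -> set T), [/\ uniq s, forall i, i \in s -> J i,
     forall i, i \in s -> events_of (X i) (B i) &
     A = \big[setI/setT]_(i <- s) B i]].

Definition sigma_on (J : set I) : set (set T) := <<s cylinders J >>.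

Lemma events_of_measurable (f : T -> R) :
  measurable_fun setT f -> events_of f `<=` measurable.
Proof. by move=> mf _ [A mA <-]; exact: mf. Qed.

Lemma in_bigsetI (s : seq I) (B : I -> set T) w :
  (\big[setI/setT]_(i <- s) B i) w <-> forall i, i \in s -> B i w.
Proof.
elim: s => [|i s IHs]; first by rewrite big_nil; split.
rewrite big_cons; split=> [[Bi /IHs Bs] j|H].
  by rewrite inE => /predU1P[->//|/Bs].
split; first by apply: H; rewrite inE eqxx.
by apply/IHs => j js; apply: H; rewrite inE js orbT.
Qed.

Lemma cylinders_measurable J : cylinders J `<=` measurable.
Proof.
move=> _ [s [B [_ _ sB ->]]]; elim: s sB => [|i s IHs] sB.
  by rewrite big_nil.
rewrite big_cons; apply: measurableI.
  by apply: (events_of_measurable (mX i)); apply: sB; rewrite inE eqxx.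
by apply: IHs => j js; apply: sB; rewrite inE js orbT.
Qed.

Lemma cylindersT J : cylinders J setT.
Proof. by exists [::], (fun=> setT); split=> //; rewrite big_nil. Qed.

Lemma events_ofT (f : T -> R) : events_of f setT.
Proof. by exists setT; rewrite ?setTI ?preimage_setT. Qed.

Lemma events_ofI (f : T -> R) : setI_closed (events_of f).
Proof.
move=> _ _ [A mA <-] [B mB <-]; exists (A `&` B); first exact: measurableI.
by rewrite !setTI preimage_setI.
Qed.

Lemma cylindersI J : setI_closed (cylinders J).
Proof.
move=> _ _ [s [B [us sJ sB ->]]] [s' [B' [us' sJ' sB' ->]]].
exists (undup (s ++ s')), (fun i => (if i \in s then B i else setT) `&`
  (if i \in s' then B' i else setT)); split.
- exact: undup_uniq.
- by move=> i; rewrite mem_undup mem_cat => /orP[/sJ|/sJ'].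
- move=> i _; apply: events_ofI.
    by case: ifPn => [/sB//|_]; exact: events_ofT.
  by case: ifPn => [/sB'//|_]; exact: events_ofT.
apply/seteqP; split=> w.
  move=> [/in_bigsetI Bs /in_bigsetI Bs']; apply/in_bigsetI => i _; split.
    by case: ifPn => // /Bs.
  by case: ifPn => // /Bs'.
move=> /in_bigsetI H; split; apply/in_bigsetI => i si.
  by have := H i; rewrite mem_undup mem_cat si => /(_ isT) [].
by have := H i; rewrite mem_undup mem_cat si orbT => /(_ isT) [].
Qed.

Lemma cylinders_indep J J' : J `&` J' = set0 ->
  indep_systems P (cylinders J) (cylinders J').
Proof.
move=> JJ' _ _ [s [B [us sJ sB ->]]] [s' [B' [us' sJ' sB' ->]]].
(* The index lists are disjoint, so both families of events merge into one, and independence applies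
   to the concatenated list as well as to each part. *)
pose C i := if i \in s then B i else B' i.
have ss' i : i \in s' -> i \notin s.
  move=> /sJ' J'i; apply/negP => /sJ Ji.
  by have : (J `&` J') i by []; rewrite JJ'.
have -> : \big[setI/setT]_(i <- s) B i = \big[setI/setT]_(i <- s) C i.
  by apply: eq_big_seq => i si; rewrite /C si.
have -> : \big[setI/setT]_(i <- s') B' i = \big[setI/setT]_(i <- s') C i.
  by apply: eq_big_seq => i /ss' si; rewrite /C (negbTE si).
have evC i : i \in s ++ s' -> events_of (X i) (C i).
  rewrite mem_cat /C; case: ifPn => [/sB//|_ /= /sB' //].
have uss' : uniq (s ++ s').
  by rewrite cat_uniq us us' andbT/=; apply/hasPn => i /ss'.
rewrite -big_cat (indX uss' evC).
rewrite big_cat/= !indX// => i si; apply: evC; rewrite mem_cat si//.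
by rewrite orbT.
Qed.

Lemma sigma_on_indep J J' : J `&` J' = set0 ->
  indep_systems P (sigma_on J) (sigma_on J').
Proof.
move=> JJ'; apply: indep_systems_sigma; try exact: cylindersI;
  try exact: cylindersT; try exact: cylinders_measurable.
exact: cylinders_indep.
Qed.

Lemma sigma_on_subset J J' : J `<=` J' -> sigma_on J `<=` sigma_on J'.
Proof.
move=> JJ'; apply: sub_sigma_algebra2 => _ [s [B [us sJ sB ->]]].
by exists s, B; split=> // i /sJ /JJ'.
Qed.

Lemma sigma_on_events J i : J i -> events_of (X i) `<=` sigma_on J.
Proof.
move=> Ji A XA; apply: sub_sigma_algebra.
exists [:: i], (fun=> A); split=> //; last by rewrite big_seq1.
- by move=> j; rewrite inE => /eqP ->.
- by move=> j; rewrite inE => /eqP ->.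
Qed.

(** Measurability for the smaller sigma-algebra [sigma_on J], obtained by changing the structure of
    the domain, so that the usual closure properties of measurable functions apply unchanged. *)
Definition measurable_on J (f : T -> R) : Prop :=
  measurable_fun [set: g_sigma_algebraType (cylinders J)] f.

Lemma measurable_on_events J f : measurable_on J f -> events_of f `<=` sigma_on J.
Proof. by move=> mf _ [A mA <-]; exact: mf. Qed.

Lemma measurable_onX J i : J i -> measurable_on J (X i).
Proof. by move=> Ji _ A mA; apply: (sigma_on_events Ji); exists A. Qed.

Lemma measurable_on_subset J J' f : J `<=` J' -> measurable_on J f ->
  measurable_on J' f.
Proof. by move=> JJ' mf _ A mA; apply: (sigma_on_subset JJ'); exact: mf. Qed.

Lemma measurable_on_measurable J f : measurable_on J f -> measurable_fun setT f.
Proof.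
move=> mf _ A mA; apply: (g_sigma_measurable (@cylinders_measurable J)).
exact: mf.
Qed.

Lemma mean_mul_disjoint J J' f g : J `&` J' = set0 ->
  measurable_on J f -> measurable_on J' g -> integ P f -> integ P g ->
  integ P (fun w => f w * g w) /\
  mean P (fun w => f w * g w) = mean P f * mean P g.
Proof.
move=> JJ' mf mg fi gi; apply: indep_mean_mul => // A B Af Bg.
by apply: (sigma_on_indep JJ'); [exact: (measurable_on_events mf)|
  exact: (measurable_on_events mg)].
Qed.

Lemma measurable_on_prod J (s : seq I) (f : I -> R -> R) :
  (forall i, i \in s -> J i) -> (forall i, measurable_fun setT (f i)) ->
  measurable_on J (fun w => \prod_(i <- s) f i (X i w)).
Proof.
move=> sJ mf; elim: s sJ => [|i s IHs] sJ.
  under [X in measurable_on _ X]eq_fun do rewrite big_nil.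
  exact: measurable_cst.
under [X in measurable_on _ X]eq_fun do rewrite big_cons.
apply: measurable_funM; last by apply: IHs => j js; apply: sJ; rewrite inE js orbT.
apply: (measurableT_comp (mf i)); apply: measurable_onX.
by apply: sJ; rewrite inE eqxx.
Qed.

Lemma mean_prod (s : seq I) (f : I -> R -> R) : uniq s ->
  (forall i, measurable_fun setT (f i)) ->
  (forall i, i \in s -> integ P (fun w => f i (X i w))) ->
  integ P (fun w => \prod_(i <- s) f i (X i w)) /\
  mean P (fun w => \prod_(i <- s) f i (X i w)) =
  \prod_(i <- s) mean P (fun w => f i (X i w)).
Proof.
move=> + mf; elim: s => [_ _|i s IHs /= /andP[is_ us] fi].
  split; first by under [X in integ _ X]eq_fun do rewrite big_nil; exact: integ_cst.
  by under eq_mean do rewrite big_nil; rewrite big_nil mean_cst.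
have [|si sE] := IHs us; first by move=> j js; apply: fi; rewrite inE js orbT.
rewrite big_cons -sE.
under eq_mean do rewrite big_cons.
under [X in integ _ X]eq_fun do rewrite big_cons.
apply: (@mean_mul_disjoint [set i] [set` s]) => //.
- apply/seteqP; split=> // j [/= -> si']; by rewrite si' in is_.
- by apply: (measurableT_comp (mf i)); exact: measurable_onX.
- exact: measurable_on_prod.
- by apply: fi; rewrite inE eqxx.
Qed.

End IndependentFamily.

(** * The central limit theorem for cosines *)

Section Lindeberg.
Context {R : realType} {d : measure_display} {T : measurableType d}.
Variable P : probability T R.

Lemma measurable_gauge h : measurable_fun setT (@gauge R h).
Proof.
apply: measurable_funM; first exact: exprn_measurable.
apply: measurable_minr => //; apply: measurable_funM => //.
Qed.

Lemma integ_gauge h (f : T -> R) : 0 <= h -> sqint P f ->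
  integ P (fun w => gauge h (f w)).
Proof.
move=> h0 [mf fi]; apply: integ_le fi.
  exact: (measurableT_comp (measurable_gauge h)).
by move=> w; rewrite ger0_norm ?gauge_ge0// gauge_le_sqr.
Qed.

Lemma measurable_cosR : measurable_fun setT (@cos R).
Proof. by apply: continuous_measurable_fun; exact: continuous_cos. Qed.

Lemma measurable_sinR : measurable_fun setT (@sin R).
Proof. by apply: continuous_measurable_fun; exact: continuous_sin. Qed.

Lemma norm_cos_le1 (x : R) : `|cos x| <= 1.
Proof. by rewrite ler_norml cos_geN1 cos_le1. Qed.

Lemma norm_sin_le1 (x : R) : `|sin x| <= 1.
Proof. by rewrite ler_norml sin_geN1 sin_le1. Qed.

Lemma integ_cos (f : T -> R) : measurable_fun setT f -> integ P (fun w => cos (f w)).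
Proof.
move=> mf; apply: (@integ_bounded _ _ _ _ _ 1).
  exact: (measurableT_comp measurable_cosR).
by move=> w; exact: norm_cos_le1.
Qed.

Lemma integ_sin (f : T -> R) : measurable_fun setT f -> integ P (fun w => sin (f w)).
Proof.
move=> mf; apply: (@integ_bounded _ _ _ _ _ 1).
  exact: (measurableT_comp measurable_sinR).
by move=> w; exact: norm_sin_le1.
Qed.

Lemma norm_mean_le1 (f : T -> R) : integ P f -> (forall w, `|f w| <= 1) ->
  `|mean P f| <= 1.
Proof.
move=> fi f1; rewrite -[leRHS](mean_cst P 1).
by apply: mean_norm_le => //; exact: integ_cst.
Qed.

Variables (K : choiceType) (X : nat * K -> T -> R).
Hypothesis mX : forall i, measurable_fun setT (X i).
Hypothesis indX : independent_RVs P X.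
Variable Z : nat -> T -> R.
Hypothesis mZ : forall i : nat, measurable_on X [set ij | ij.1 = i] (Z i).
Hypothesis sZ : forall i, sqint P (Z i).
Hypothesis Z0 : forall i, mean P (Z i) = 0.

(** Induction on n. The angle addition formula and independence split off the last summand: its mean
    cosine is exp(-v/2) up to gauge + v^2, and its mean sine is at most the gauge since its mean is
    0. The factor of that sine is only bounded by 1, so the induction never needs an estimate of the
    sines of the partial sums. *)
Lemma lindeberg_cos n (a : R) :
  `|mean P (fun w => cos (\sum_(i < n) Z i w + a)) -
    expR (- (\sum_(i < n) mean P (fun w => Z i w ^+ 2)) / 2) * cos a| <=
  \sum_(i < n) (2 * mean P (fun w => gauge 1 (Z i w)) +
                mean P (fun w => Z i w ^+ 2) ^+ 2).
Proof.
elim: n a => [|n IHn] a.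
  rewrite !big_ord0 oppr0 mul0r expR0 mul1r.
  by under eq_mean do rewrite big_ord0 add0r; rewrite mean_cst subrr normr0.
rewrite !big_ord_recr/=.
set v := mean P (fun w => Z n w ^+ 2); set s := \sum_(i < n) mean _ _.
set b := mean P (fun w => gauge _ _).
have mZn i : measurable_fun setT (Z i) by case: (sZ i).
pose S w := \sum_(i < n) Z i w + a.
have mS : measurable_on X [set ij | (ij.1 < n)%N] S.
  have mZi (i : 'I_n) : measurable_on X [set ij | (ij.1 < n)%N] (Z i).
    by move: (@mZ i); apply: measurable_on_subset => ij /= ->.
  by apply: measurable_funD => //; apply: measurable_sum.
have mST : measurable_fun setT S by exact: (measurable_on_measurable mX mS).
have disj : [set ij : nat * K | (ij.1 < n)%N] `&` [set ij | ij.1 = n] = set0.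
  by apply/seteqP; split=> // ij [/= + jn]; rewrite jn ltnn.
have [ccI ccE] := mean_mul_disjoint mX indX disj
  (measurableT_comp measurable_cosR mS) (measurableT_comp measurable_cosR (@mZ n))
  (integ_cos mST) (integ_cos (mZn n)).
have [ssI ssE] := mean_mul_disjoint mX indX disj
  (measurableT_comp measurable_sinR mS) (measurableT_comp measurable_sinR (@mZ n))
  (integ_sin mST) (integ_sin (mZn n)).
have -> : mean P (fun w => cos (\sum_(i < n.+1) Z i w + a)) =
    mean P (fun w => cos (S w)) * mean P (fun w => cos (Z n w)) -
    mean P (fun w => sin (S w)) * mean P (fun w => sin (Z n w)).
  rewrite -[X in X - _]ccE -[X in _ - X]ssE -meanB//; apply: eq_mean => w.
  by rewrite big_ord_recr/= addrAC -cosD.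
have := IHn a; rewrite -/s -/S; set c := mean P (fun w => cos (S w)) => IH.
have c1 : `|c| <= 1.
  by apply: norm_mean_le1; [exact: integ_cos|move=> w; exact: norm_cos_le1].
have s1 : `|mean P (fun w => sin (S w))| <= 1.
  by apply: norm_mean_le1; [exact: integ_sin|move=> w; exact: norm_sin_le1].
have gi : integ P (fun w => gauge 1 (Z n w)) by exact: integ_gauge.
have b0 : 0 <= b by apply: mean_ge0 => w; exact: gauge_ge0.
have v0 : 0 <= v by apply: mean_ge0 => w; exact: sqr_ge0.
have sb : `|mean P (fun w => sin (Z n w))| <= b.
  rewrite -[X in `|X|]subr0 -(Z0 n); apply: mean_dist => //.
  - exact: integ_sin.
  - exact: sqint_integ.
  - by move=> w; exact: norm_sinB.
have cb : `|mean P (fun w => cos (Z n w)) - expR (- (v / 2))| <= b + v ^+ 2.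
  rewrite (le_trans (ler_distD (1 - v / 2) _ _))// lerD//.
    have -> : 1 - v / 2 = mean P (fun w => 1 - 2^-1 * Z n w ^+ 2).
      have [_ zi] := sZ n.
      rewrite meanB ?meanZ ?mean_cst//; [by rewrite -/v; ring|exact: integ_cst|].
      exact: integZ.
    apply: mean_dist => //.
    - exact: integ_cos.
    - apply: integB; first exact: integ_cst.
      by apply: integZ; case: (sZ n).
    - by move=> w; rewrite [2^-1 * _]mulrC; exact: norm_cosB.
  rewrite distrC (le_trans (norm_expRNB _))//; first by rewrite divr_ge0.
  by rewrite expr_div_n; have := sqr_ge0 v; lra.
set e := expR (- (s + v) / 2).
have -> : e = expR (- s / 2) * expR (- (v / 2)).
  by rewrite -expRD; congr expR; ring.
set ev := expR (- (v / 2)) in cb *.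
have ev1 : ev <= 1 by rewrite -expR0 ler_expR oppr_le0 divr_ge0.
have ev0 : 0 <= ev by exact: expR_ge0.
set cz := mean P (fun w => cos (Z n w)) in cb *.
set sz := mean P (fun w => sin (Z n w)) in sb *.
set sS := mean P _ in s1 *.
set es := expR _ in IH *.
have -> : c * cz - sS * sz - es * ev * cos a =
  ev * (c - es * cos a) + (c * (cz - ev) - sS * sz) by ring.
rewrite (le_trans (ler_normD _ _))// lerD//.
  rewrite normrM (ger0_norm ev0) (le_trans _ IH)//.
  by rewrite ler_piMl.
rewrite (le_trans (ler_normB _ _))// !normrM.
have : `|c| * `|cz - ev| <= 1 * (b + v ^+ 2) by apply: ler_pM.
have : `|sS| * `|sz| <= 1 * b by apply: ler_pM.
by lra.
Qed.

End Lindeberg.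

Section CentralLimit.
Context {R : realType} {d : measure_display} {T : measurableType d}.
Variable P : probability T R.

(* Uniform form of Lindeberg's condition for the array [Z i / sqrt n]. *)
Definition lindeberg (Z : nat -> T -> R) : Prop := forall e : R, 0 < e ->
  \forall n \near \oo, forall i,
    mean P (fun w => gauge (Num.sqrt n%:R)^-1 (Z i w)) <= e.

Variables (K : choiceType) (X : nat * K -> T -> R).
Hypothesis mX : forall i, measurable_fun setT (X i).
Hypothesis indX : independent_RVs P X.

(** With h = n^(-1/2), [gauge 1 (h * x)] is h^2 times [gauge h x], so n summands contribute at most
    twice the uniform Lindeberg bound. The squared variances (v / n)^2 add up to v^2 / n. *)
Lemma clt_cos (Z : nat -> T -> R) (v a : R) :
  (forall i : nat, measurable_on X [set ij | ij.1 = i] (Z i)) ->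
  (forall i, sqint P (Z i)) -> (forall i, mean P (Z i) = 0) ->
  (forall i, mean P (fun w => Z i w ^+ 2) = v) -> lindeberg Z ->
  mean P (fun w => cos ((Num.sqrt n%:R)^-1 * (\sum_(i < n) Z i w) + a))
    @[n --> \oo] --> expR (- v / 2) * cos a.
Proof.
move=> mZ sZ Z0 Zv LZ; apply/cvgrPdist_le => e e0.
(* The error is twice the gauge bound plus v^2 / n, that is at most 2 (e / 4) + e / 2. *)
have e4 : 0 < e / 4 by rewrite divr_gt0.
have : \forall n \near \oo, (v ^+ 2 * n%:R^-1 <= e / 2 :> R).
  have /cvgrPdist_le/(_ (e / 2)) : (v ^+ 2 * n%:R^-1) @[n --> \oo] --> (0 : R).
    rewrite -[0](mulr0 (v ^+ 2)); apply: cvgM; first exact: cvg_cst.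
    by apply/gtr0_cvgV0; [near=> n; rewrite ltr0n; near: n; exists 1%N|
      exact: cvgr_idn].
  rewrite divr_gt0// => /(_ isT); apply: filterS => n.
  by rewrite sub0r normrN; exact: le_trans (ler_norm _).
move: (LZ _ e4) (nbhs_infty_gt 0); apply: filterS3 => n vn Hn n_gt0.
have sumc (c : R) : \sum_(i < n) c = n%:R * c.
  by rewrite sumr_const card_ord mulr_natl.
have sn0 : (0 : R) < Num.sqrt n%:R by rewrite sqrtr_gt0 ltr0n.
set h := (Num.sqrt n%:R)^-1 in Hn *.
have h0 : 0 <= h by rewrite invr_ge0 ltW.
have hh : h ^+ 2 = n%:R^-1 by rewrite exprVn sqr_sqrtr.
have nn : n%:R * n%:R^-1 = 1 :> R by rewrite divff// pnatr_eq0 -lt0n.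
have := @lindeberg_cos _ _ _ P _ X mX indX (fun i w => h * Z i w) _ _ _ n a.
have -> : mean P (fun w => cos (h * (\sum_(i < n) Z i w) + a)) =
    mean P (fun w => cos (\sum_(i < n) (h * Z i w) + a)).
  by apply: eq_mean => w; rewrite mulr_sumr.
have hv i : mean P (fun w => (h * Z i w) ^+ 2) = n%:R^-1 * v.
  under eq_mean do rewrite exprMn hh.
  by rewrite meanZ ?Zv//; case: (sZ i).
have -> : \sum_(i < n) mean P (fun w => (h * Z i w) ^+ 2) = v.
  under eq_bigr do rewrite hv.
  by rewrite sumc mulrA nn mul1r.
have hg i : mean P (fun w => gauge 1 (h * Z i w)) <= n%:R^-1 * (e / 4).
  have -> : mean P (fun w => gauge 1 (h * Z i w)) =
      n%:R^-1 * mean P (fun w => gauge h (Z i w)).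
    rewrite -meanZ; last exact: integ_gauge.
    by apply: eq_mean => w; rewrite /gauge exprMn hh mul1r normrM (ger0_norm h0) mulrA.
  by rewrite ler_wpM2l ?invr_ge0.
rewrite distrC => H; apply: le_trans (H _ _ _) _.
- by move=> i; apply: measurable_funM => //; exact: (@mZ i).
- by move=> i; exact: sqintZ.
- by move=> i; rewrite meanZ ?Z0 ?mulr0//; exact: sqint_integ.
apply: (@le_trans _ _ (\sum_(i < n) (2 * (n%:R^-1 * (e / 4)) + (n%:R^-1 * v) ^+ 2))).
  by apply: ler_sum => i _; rewrite hv lerD2r ler_wpM2l.
rewrite sumc mulrDr exprMn.
have -> : n%:R * (2 * (n%:R^-1 * (e / 4))) = (n%:R * n%:R^-1) * (e / 2) :> R.
  by set y := n%:R^-1; move: y => y; field.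
have -> : n%:R * (n%:R^-1 ^+ 2 * v ^+ 2) = (n%:R * n%:R^-1) * (v ^+ 2 * n%:R^-1) :> R.
  by ring.
by rewrite nn !mul1r; lra.
Unshelve. all: by end_near.
Qed.

End CentralLimit.

(** * Weak convergence from cosines *)

Section FilterSums.
Context {R : realType} {T : Type} (F : set_system T) {FF : Filter F}.

Lemma cvg_sumr (I : Type) (s : seq I) (Q : pred I) (f : I -> T -> R) (l : I -> R) :
  (forall i, f i x @[x --> F] --> l i) ->
  \sum_(i <- s | Q i) f i x @[x --> F] --> \sum_(i <- s | Q i) l i.
Proof.
move=> fl; elim: s => [|i s IHs].
  by under eq_fun do rewrite big_nil; rewrite big_nil; exact: cvg_cst.
under eq_fun do rewrite big_cons; rewrite big_cons.
by case: ifP => // _; exact: cvgD.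
Qed.

Lemma cvg_prodr (I : Type) (s : seq I) (Q : pred I) (f : I -> T -> R) (l : I -> R) :
  (forall i, f i x @[x --> F] --> l i) ->
  \prod_(i <- s | Q i) f i x @[x --> F] --> \prod_(i <- s | Q i) l i.
Proof.
move=> fl; elim: s => [|i s IHs].
  by under eq_fun do rewrite big_nil; rewrite big_nil; exact: cvg_cst.
under eq_fun do rewrite big_cons; rewrite big_cons.
by case: ifP => // _; exact: cvgM.
Qed.

End FilterSums.

(** * Trigonometric polynomials and their uniform limits *)

Section TrigApproximation.
Context {R : realType}.
Variable N : nat.
Implicit Types (t x y : 'rV[R]_N) (g h : 'rV[R]_N -> R).

Definition dot t x : R := \sum_(i < N) t 0 i * x 0 i.

Lemma dotDl t t' x : dot (t + t') x = dot t x + dot t' x.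
Proof. by rewrite -big_split/=; apply: eq_bigr => i _; rewrite mxE mulrDl. Qed.

Lemma dotNl t x : dot (- t) x = - dot t x.
Proof. by rewrite -sumrN; apply: eq_bigr => i _; rewrite mxE mulNr. Qed.

Lemma dotZl c t x : dot (c *: t) x = c * dot t x.
Proof. by rewrite mulr_sumr; apply: eq_bigr => i _; rewrite mxE mulrA. Qed.

Lemma dot_delta i x : dot (delta_mx 0 i) x = x 0 i.
Proof.
rewrite /dot (bigD1 i)//= mxE !eqxx mul1r big1 ?addr0// => j ji.
by rewrite mxE (negbTE ji) andbF mul0r.
Qed.

Definition trigpoly g : Prop := exists s : seq (R * R * 'rV[R]_N),
  g = fun x => \sum_(c <- s) c.1.1 * cos (dot c.2 x + c.1.2).

Lemma trigpoly_cos t a : trigpoly (fun x => cos (dot t x + a)).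
Proof. by exists [:: (1, a, t)]; apply/funext => x; rewrite big_seq1/= mul1r. Qed.

Lemma trigpolyD g h : trigpoly g -> trigpoly h -> trigpoly (fun x => g x + h x).
Proof. by move=> [s ->] [s' ->]; exists (s ++ s'); apply/funext => x; rewrite big_cat. Qed.

Lemma trigpolyZ c g : trigpoly g -> trigpoly (fun x => c * g x).
Proof.
move=> [s ->]; exists [seq (c * k.1.1, k.1.2, k.2) | k <- s].
by apply/funext => x; rewrite big_map mulr_sumr; apply: eq_bigr => k _; rewrite mulrA.
Qed.

Lemma trigpoly_cst c : trigpoly (fun=> c).
Proof.
rewrite (_ : (fun=> c) = fun x => c * cos (dot 0 x + 0)).
  exact/trigpolyZ/trigpoly_cos.
apply/funext => x; rewrite (_ : dot 0 x = 0) ?add0r ?cos0 ?mulr1//.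
by rewrite /dot big1// => i _; rewrite mxE mul0r.
Qed.

Lemma trigpoly_sum (J : Type) (s : seq J) (g : J -> 'rV[R]_N -> R) :
  (forall j, trigpoly (g j)) -> trigpoly (fun x => \sum_(j <- s) g j x).
Proof.
move=> Hg; elim: s => [|j s IHs].
  by under eq_fun do rewrite big_nil; exact: trigpoly_cst.
by under eq_fun do rewrite big_cons; exact: trigpolyD.
Qed.

Lemma trigpolyM g h : trigpoly g -> trigpoly h -> trigpoly (fun x => g x * h x).
Proof.
move=> [s ->] [s' ->].
rewrite (_ : (fun x => _) = fun x => \sum_(c <- s) \sum_(k <- s')
    (c.1.1 * k.1.1 / 2) * (cos (dot (c.2 + k.2) x + (c.1.2 + k.1.2)) +
                     cos (dot (c.2 - k.2) x + (c.1.2 - k.1.2)))).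
  apply: trigpoly_sum => c; apply: trigpoly_sum => k; apply: trigpolyZ.
  by apply: trigpolyD; exact: trigpoly_cos.
apply/funext => x; rewrite mulr_suml; apply: eq_bigr => c _.
rewrite mulr_sumr; apply: eq_bigr => k _.
rewrite !dotDl dotNl.
move: (dot c.2 x) (dot k.2 x) c.1.2 k.1.2 => a b a' b'.
have -> : a + b + (a' + b') = (a + a') + (b + b') by ring.
have -> : a - b + (a' - b') = (a + a') - (b + b') by ring.
by rewrite (cosD (a + a')) (cosB (a + a')); field.
Qed.

Lemma trigpoly_bounded g : trigpoly g -> exists C, 0 <= C /\ forall x, `|g x| <= C.
Proof.
move=> [s ->]; exists (\sum_(c <- s) `|c.1.1|); split; first exact: sumr_ge0.
move=> x; rewrite (le_trans (ler_norm_sum _ _ _))//; apply: ler_sum => c _.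
by rewrite normrM ler_piMr// ler_norml cos_geN1 cos_le1.
Qed.

Definition trig_limit g : Prop := forall e : R, 0 < e ->
  exists2 h, trigpoly h & forall x, `|g x - h x| <= e.

Lemma trigpoly_trig_limit g : trigpoly g -> trig_limit g.
Proof. by move=> tg e e0; exists g => // x; rewrite subrr normr0 ltW. Qed.

Lemma trig_limit_bounded g : trig_limit g -> exists C, 0 < C /\ forall x, `|g x| <= C.
Proof.
move=> /(_ 1 ltr01)[h /trigpoly_bounded[C [C0 hC]] gh].
exists (1 + C); split; first by rewrite ltr_pwDl.
move=> x; rewrite -[g x](subrK (h x)) (le_trans (ler_normD _ _))//.
by rewrite lerD.
Qed.

Lemma trig_limit_closed g : (forall e : R, 0 < e ->
  exists2 h, trig_limit h & forall x, `|g x - h x| <= e) -> trig_limit g.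
Proof.
move=> H e e0; have e2 : 0 < e / 2 by rewrite divr_gt0.
have [h /(_ _ e2)[k tk hk] gh] := H _ e2; exists k => // x.
by rewrite [e]splitr (le_trans (ler_distD (h x) _ _))// lerD.
Qed.

Lemma trig_limitD g h : trig_limit g -> trig_limit h ->
  trig_limit (fun x => g x + h x).
Proof.
move=> lg lh e e0; have e2 : 0 < e / 2 by rewrite divr_gt0.
have [g' tg gg'] := lg _ e2; have [h' th hh'] := lh _ e2.
exists (fun x => g' x + h' x); first exact: trigpolyD.
by move=> x; rewrite [e]splitr opprD addrACA (le_trans (ler_normD _ _))// lerD.
Qed.

Lemma trig_limitZ c g : trig_limit g -> trig_limit (fun x => c * g x).
Proof.
move=> lg e e0; have c0 : 0 < `|c| + 1 by rewrite ltr_wpDl.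
have [h th gh] := lg _ (divr_gt0 e0 c0).
exists (fun x => c * h x); first exact: trigpolyZ.
move=> x; rewrite -mulrBr normrM (@le_trans _ _ ((`|c| + 1) * (e / (`|c| + 1))))//.
  by rewrite ler_pM// lerDl.
by rewrite mulrC divfK// gt_eqF.
Qed.

Lemma trig_limitM g h : trig_limit g -> trig_limit h ->
  trig_limit (fun x => g x * h x).
Proof.
move=> lg lh e e0.
have [C [C0 gC]] := trig_limit_bounded lg.
have e2 : 0 < e / 2 by rewrite divr_gt0.
have [h' th hh'] := lh _ (divr_gt0 e2 C0).
have [C' [C'0 hC']] := trigpoly_bounded th.
have C'1 : 0 < C' + 1 by rewrite ltr_wpDl.
have [g' tg gg'] := lg _ (divr_gt0 e2 C'1).
exists (fun x => g' x * h' x); first exact: trigpolyM.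
move=> x; have -> : g x * h x - g' x * h' x =
  g x * (h x - h' x) + (g x - g' x) * h' x by ring.
rewrite [e]splitr (le_trans (ler_normD _ _))// !normrM lerD//.
  rewrite -[leRHS](divfK (lt0r_neq0 C0)) mulrC ler_pM//.
rewrite -[leRHS](divfK (lt0r_neq0 C'1)) ler_pM//.
by rewrite (le_trans (hC' x))// lerDl.
Qed.

Lemma trig_limit_cst c : trig_limit (fun=> c).
Proof. exact/trigpoly_trig_limit/trigpoly_cst. Qed.

(* Polynomials in x^2 increasing to |x| on [-1, 1]. *)
Fixpoint abs_iter (k : nat) (x : R) : R :=
  if k is k'.+1 then abs_iter k' x + (x ^+ 2 - abs_iter k' x ^+ 2) / 2 else 0.

(** Writing s = |x|, one step multiplies the gap s - p by 1 - (s + p) / 2 <= 1 - s / 2, and (1 - s /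
    2)(2 + (k + 1) s) <= 2 + k s. The third bound says, free of division, that the gap is at most 2
    s / (2 + k s), hence at most 2 / k uniformly in x. *)
Lemma abs_iter_bounds k (x : R) : `|x| <= 1 ->
  [/\ 0 <= abs_iter k x, abs_iter k x <= `|x| &
      (`|x| - abs_iter k x) * (2 + k%:R * `|x|) <= 2 * `|x|].
Proof.
move=> x1; rewrite -[x]/x; elim: k => [|k [IH0 IHx IHk]] /=.
  by split=> //; rewrite subr0 mul0r addr0 mulrC.
rewrite -[x ^+ 2]real_normK ?num_real//.
move: (abs_iter k x) IH0 IHx IHk => p p0 px.
move: `|x| (normr_ge0 x) x1 px => s s0 s1 ps.
rewrite -[k.+1%:R]natr1; have : 0 <= k%:R :> R by [].
move: k%:R => K K0 H.
have E : s - (p + (s ^+ 2 - p ^+ 2) / 2) = (s - p) * (1 - (s + p) / 2) by field.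
split; first by nra.
  by rewrite -subr_ge0 E mulr_ge0 ?subr_ge0//; lra.
rewrite E; apply: le_trans H; rewrite -mulrA ler_wpM2l ?subr_ge0//.
have h1 : 0 <= p * (2 + (K + 1) * s) by rewrite mulr_ge0// addr_ge0// mulr_ge0// addr_ge0.
have h2 : 0 <= K * s ^+ 2 by rewrite mulr_ge0 ?sqr_ge0.
have h3 := sqr_ge0 s.
have -> : (1 - (s + p) / 2) * (2 + (K + 1) * s) =
  2 + K * s - (p * (2 + (K + 1) * s)) / 2 - K * s ^+ 2 / 2 - s ^+ 2 / 2 by field.
by lra.
Qed.

Lemma abs_iter_close k (x e : R) : 0 < e -> `|x| <= 1 -> 2 / e < k%:R ->
  `| `|x| - abs_iter k x| <= e.
Proof.
move=> e0 x1 ke; have [p0 px H] := abs_iter_bounds k x1.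
rewrite ger0_norm ?subr_ge0//.
have [s0|sn0] := eqVneq `|x| 0.
  by rewrite s0 in px *; rewrite sub0r (le_trans _ (ltW e0))// oppr_le0.
have s_gt0 : 0 < `|x| by rewrite lt0r sn0/=.
have k0 : 0 < k%:R :> R by apply: lt_trans ke; rewrite divr_gt0.
have : (`|x| - abs_iter k x) * (k%:R * `|x|) <= 2 * `|x|.
  by apply: le_trans H; rewrite ler_wpM2l ?subr_ge0// lerDr.
rewrite mulrA ler_pM2r// => H2.
rewrite -(ler_pM2r k0) (le_trans H2)// ltW//.
by rewrite mulrC -ltr_pdivrMr.
Qed.

Lemma trig_limit_abs1 g : trig_limit g -> (forall x, `|g x| <= 1) ->
  trig_limit (fun x => `|g x|).
Proof.
move=> lg g1; apply: trig_limit_closed => e e0.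
pose k := (Num.truncn (2 / e)).+1.
have ke : 2 / e < k%:R by rewrite /k truncnS_gt.
exists (fun x => abs_iter k (g x)).
  elim: k {ke} => [|k IHk] /=; first exact: trig_limit_cst.
  apply: trig_limitD => //.
  rewrite (_ : (fun x => _) = fun x => 2^-1 * (g x * g x + (-1) * (abs_iter k (g x) * abs_iter k (g x)))).
    apply: trig_limitZ; apply: trig_limitD; first exact: trig_limitM.
    by apply: trig_limitZ; exact: trig_limitM.
  by apply/funext => x; field.
by move=> x; exact: abs_iter_close.
Qed.

Lemma trig_limit_abs g : trig_limit g -> trig_limit (fun x => `|g x|).
Proof.
move=> lg; have [C [C0 gC]] := trig_limit_bounded lg.
rewrite (_ : (fun x => _) = fun x => C * `|C^-1 * g x|).
  apply/trig_limitZ/trig_limit_abs1; first exact: trig_limitZ.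
  by move=> x; rewrite normrM gtr0_norm ?invr_gt0// mulrC ler_pdivrMr// mul1r.
apply/funext => x; rewrite normrM gtr0_norm ?invr_gt0// mulrA divff ?mul1r//.
by rewrite gt_eqF.
Qed.

Lemma trig_limit_min g h : trig_limit g -> trig_limit h ->
  trig_limit (fun x => Num.min (g x) (h x)).
Proof.
move=> lg lh; rewrite (_ : (fun x => Num.min (g x) (h x)) = fun x =>
    2^-1 * (g x + h x + (-1) * `|g x + (-1) * h x|)).
  apply: trig_limitZ; apply: trig_limitD; first exact: trig_limitD.
  apply/trig_limitZ/trig_limit_abs/trig_limitD => //; exact: trig_limitZ.
by apply/funext => x; rewrite minr_absE !mulN1r mulrC.
Qed.

Definition cube (L : R) : set 'rV[R]_N := [set x | forall i, x ord0 i \in `[- L, L]].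

Lemma compact_cube L : compact (cube L).
Proof.
exact: (@rV_compact _ _ (fun=> [set` `[- L, L]])) (fun=> @segment_compact _ _ _).
Qed.

Lemma cubeP L x : cube L x <-> forall i, `|x 0 i| <= L.
Proof.
by split=> H i; have := H i; rewrite ?in_itv/= ler_norml.
Qed.

Lemma cube_unif_continuous (f : 'rV[R]_N -> R) L e : continuous f -> 0 < e ->
  exists2 r : R, 0 < r & forall x y, cube L x ->
    (forall i, `|x 0 i - y 0 i| < r) -> `|f x - f y| < e.
Proof.
move=> cf e0; have e2 : 0 < e / 2 by rewrite divr_gt0.
have /compact_near_coveringP ncov := @compact_cube L.
pose Q (r : R) (x : 'rV[R]_N) := forall y, ball x r y -> `|f x - f y| < e.
have := ncov R 0^'+ Q _ _.
have H : forall x, cube L x -> \forall x' \near x & r \near 0^'+, Q r x'.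
  move=> x0 _; have /cvgrPdist_lt/(_ _ e2) := cf x0.
  move=> /nbhs_ballP[r /= r0 Hr].
  have r2 : 0 < r / 2 by rewrite divr_gt0.
  exists (ball x0 (r / 2), [set r' | r' < r / 2]).
    split=> /=; first exact: nbhsx_ballx.
    exact: nbhs_right_lt.
  move=> [x r'] /= [x0x r'r] y xy.
  have fx : `|f x0 - f x| < e / 2 by apply: Hr; apply: le_ball x0x; rewrite ler_pdivrMr// ler_pMr// ler1n.
  have fy : `|f x0 - f y| < e / 2.
    by apply: Hr; rewrite [r]splitr; apply: ball_triangle x0x _; apply: le_ball xy; exact: ltW.
  rewrite [e]splitr (le_lt_trans (ler_distD (f x0) _ _))// ltrD//.
  by rewrite distrC.
move=> /(_ _ H)/=; rewrite near_withinE => -[r /= r0 Hr].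
exists (r / 2); first by rewrite divr_gt0.
move=> x y Kx xy; have /= := Hr (r / 2) _ _ _ Kx y; apply.
- by rewrite /= sub0r normrN ger0_norm ?divr_ge0 ?ltW// ltr_pdivrMr// ltr_pMr// ltr1n.
- by rewrite divr_gt0.
split; first by rewrite divr_gt0.
by move=> i j; rewrite ord1; exact: xy.
Qed.

End TrigApproximation.

Section TrigDensity.
Context {R : realType}.
Variable N : nat.
Implicit Types (f g : 'rV[R]_N -> R) (x y c : 'rV[R]_N).

(** When a^2 <= 4, the quartic term a^4 / 24 is at most a^2 / 6. The range 2 is what occurs for two
    points of a cube of half-side L, once differences are divided by L. *)
Lemma cos_le_third (a : R) : `|a| <= 2 -> a ^+ 2 / 3 <= 1 - cos a.
Proof.
rewrite ler_norml => /andP[a1 a2].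
have := cos_le_quart a; have : a ^+ 2 <= 4 by nra.
have -> : a ^+ 4 = a ^+ 2 * a ^+ 2 by ring.
have := sqr_ge0 a; nra.
Qed.

Definition tent (f : 'rV[R]_N -> R) (A L : R) c x : R :=
  f c + A * \sum_(i < N) (1 - cos ((x 0 i - c 0 i) / L)).

Lemma trigpoly_tent f A L c : trigpoly (tent f A L c).
Proof.
apply: trigpolyD; first exact: trigpoly_cst.
apply: trigpolyZ; apply: trigpoly_sum => i.
rewrite (_ : (fun x => _) = fun x =>
  1 + (-1) * cos (dot (L^-1 *: delta_mx 0 i) x + - (c 0 i / L))).
  by apply: trigpolyD; [exact: trigpoly_cst|apply/trigpolyZ/trigpoly_cos].
by apply/funext => x; rewrite dotZl dot_delta mulN1r mulrBl [_^-1 * _]mulrC.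
Qed.

Lemma continuous_tent f A L c : continuous (tent f A L c).
Proof.
move=> x; pose F := nbhs x; have FF : Filter F by exact: nbhs_filter.
suff : tent f A L c y @[y --> F] --> tent f A L c x by [].
apply: cvgD; first exact: cvg_cst.
apply: cvgM; first exact: cvg_cst.
apply: cvg_sumr => i; apply: cvgB; first exact: cvg_cst.
apply: (@cvg_comp _ _ _ (fun y : 'rV[R]_N => (y 0 i - c 0 i) / L) cos F
  (nbhs ((x 0 i - c 0 i) / L))); last exact: continuous_cos.
apply: cvgM; last exact: cvg_cst.
by apply: cvgB; [exact: coord_continuous|exact: cvg_cst].
Qed.

(* A minimum of finitely many tents, i.e. an inf-convolution of f with the
   trigonometric cost A sum (1 - cos), approximates f on the cube. *)
Lemma trig_limit_dense f C L e : continuous f -> (forall x, `|f x| <= C) ->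
  0 < L -> 0 < e ->
  exists g, [/\ trig_limit g, forall x, `|g x| <= C &
    forall x, cube L x -> `|f x - g x| <= e].
Proof.
move=> cf fC L0 e0.
have C0 : 0 <= C by apply: le_trans (fC 0).
have [r r0 Hr] := cube_unif_continuous L cf e0.
(* Chosen so that A (r / L)^2 / 3 = 2 C: as soon as one coordinate of x is at distance r from that
   of c, the tent is at least f c + 2 C >= C >= f x. *)
pose A := 6 * C * L ^+ 2 / r ^+ 2.
have A0 : 0 <= A by rewrite /A divr_ge0 ?sqr_ge0// mulr_ge0 ?sqr_ge0// mulr_ge0.
pose h := tent f A L.
have tent_ge c x : f c <= h c x.
  rewrite /h /tent lerDl; apply: mulr_ge0 => //; apply: sumr_ge0 => i _.
  by rewrite subr_ge0 cos_le1.
have tent_lb c x : cube L c -> cube L x -> f x - e <= h c x.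
  move=> Kc Kx; case: (pselect (forall i, `|c 0 i - x 0 i| < r)) => [cx|].
    have /ltW := Hr c x Kc cx; rewrite ler_distlC => /andP[_].
    by have := tent_ge c x; lra.
  move=> /existsNP[i /negP]; rewrite -leNgt => rcx.
  have : `|(x 0 i - c 0 i) / L| <= 2.
    rewrite normrM (gtr0_norm (x:=L^-1)) ?invr_gt0// ler_pdivrMr//.
    move/cubeP : Kc => /(_ i) ci; move/cubeP : Kx => /(_ i) xi.
    by rewrite (le_trans (ler_normB _ _))// mulr_natl mulr2n lerD.
  move=> /cos_le_third.
  have : r ^+ 2 / L ^+ 2 <= ((x 0 i - c 0 i) / L) ^+ 2.
    rewrite expr_div_n ler_pM2r ?invr_gt0 ?exprn_gt0//.
    rewrite -[X in _ <= X]real_normK ?num_real// distrC.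
    by rewrite ler_sqr ?nnegrE ?(le_trans (ltW r0))//  ltW.
  have AE : A * (r ^+ 2 / L ^+ 2) = 6 * C.
    by rewrite /A; field; rewrite !gt_eqF.
  move=> h1 h2; have : A * (r ^+ 2 / L ^+ 2 / 3) <= A * (1 - cos ((x 0 i - c 0 i) / L)).
    by rewrite ler_wpM2l//; lra.
  rewrite mulrA AE => h3.
  have : f c + A * (1 - cos ((x 0 i - c 0 i) / L)) <= h c x.
    rewrite /h /tent lerD2l ler_wpM2l// (bigD1 i)//= lerDl; apply: sumr_ge0 => j _.
    by rewrite subr_ge0 cos_le1.
  by have := fC c; have := fC x; rewrite !ler_norml => /andP[a b] /andP[a' b']; lra.
(* The tent at c touches f at c, so it stays within e of f near c; compactness of the cube then
   leaves finitely many centres. *)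
have Kcov : cube L `<=` cover (cube L) (fun c => [set x | h c x - f x < e]).
  move=> x Kx; exists x => //=; rewrite /h /tent [X in A * X]big1 => [|i _].
    by rewrite mulr0 addr0 subrr.
  by rewrite subrr mul0r cos0 subrr.
have := @compact_cube R N L; rewrite compact_cover => cK.
have [|D DK Dcov] := cK _ (cube L) (fun c => [set x | h c x - f x < e]) _ Kcov.
  move=> c _; rewrite (_ : [set x | _] = (fun x => h c x - f x) @^-1` [set z | z < e])//.
  apply: open_comp; last exact: open_lt.
  move=> x _; pose F := nbhs x; have FF : Filter F by exact: nbhs_filter.
  suff : h c y - f y @[y --> F] --> h c x - f x by [].
  by apply: cvgB; [exact: continuous_tent|exact: cf].
(* The minimum starts from the constant C, which keeps the bound C on the whole space, off the cube
   as well. *)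
pose g (s : seq 'rV[R]_N) x := foldr (fun c m => Num.min (h c x) m) C s.
have g_ub s x : g s x <= C.
  by elim: s => //= c s IHs; rewrite ge_min IHs orbT.
have g_le s c x : c \in s -> g s x <= h c x.
  elim: s => //= c' s IHs; rewrite inE => /predU1P[->|/IHs H].
    by rewrite ge_min lexx.
  by rewrite ge_min H orbT.
have g_ge s x z : z <= C -> (forall c, c \in s -> z <= h c x) -> z <= g s x.
  move=> zC; elim: s => //= c s IHs H; rewrite le_min H ?inE ?eqxx//=.
  by apply: IHs => c' c's; apply: H; rewrite inE c's orbT.
exists (g (finmap.enum_fset D)); split.
- elim: (finmap.enum_fset D) => [|c s IHs] /=; first exact: trig_limit_cst.
  apply: trig_limit_min => //; exact/trigpoly_trig_limit/trigpoly_tent.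
- move=> x; rewrite ler_norml g_ub andbT; apply: g_ge => [|c _].
    by rewrite (le_trans _ C0)// oppr_le0.
  by apply: le_trans (tent_ge c x); have := fC c; rewrite ler_norml => /andP[].
- move=> x Kx; rewrite ler_distl; apply/andP; split.
    have [c /= cD /ltW hx] := Dcov x Kx.
    have := g_le _ _ x cD; lra.
  rewrite -lerBlDr; apply: g_ge => [|c cD].
    by have := fC x; rewrite ler_norml => /andP[_]; lra.
  by apply: tent_lb => //; have := DK c cD; rewrite inE.
Qed.

End TrigDensity.

Section WeakConvergence.
Context {R : realType}.
Variable N : nat.
Implicit Types f g : 'rV[R]_N -> R.

Section Measurability.
Context {d : measure_display} {T : measurableType d}.
Variable Y : T -> 'rV[R]_N.
Hypothesis mY : forall i, measurable_fun setT (fun w => Y w 0 i).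

Lemma measurable_dot t : measurable_fun setT (fun w => dot t (Y w)).
Proof. by apply: measurable_sum => i; exact: measurable_funM. Qed.

Lemma measurable_trigpoly g : trigpoly g -> measurable_fun setT (g \o Y).
Proof.
move=> [s ->]; apply: measurable_sum => c; apply: measurable_funM => //.
apply: (measurableT_comp (f := @cos R)).
  by apply: continuous_measurable_fun; exact: continuous_cos.
by apply: measurable_funD => //; exact: measurable_dot.
Qed.

Lemma measurable_trig_limit g : trig_limit g -> measurable_fun setT (g \o Y).
Proof.
move=> lg.
have /choice[h Hh] (n : nat) : exists h : 'rV[R]_N -> R,
    trigpoly h /\ forall x, `|g x - h x| <= n.+1%:R^-1.
  by have [h th gh] := lg n.+1%:R^-1 (harmonic_gt0 n); exists h.
apply: (measurable_fun_cvg (h := fun n => h n \o Y)) => [n|w _].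
  by apply: measurable_trigpoly; case: (Hh n).
apply/cvgrPdist_le => e e0.
have := near_infty_natSinv_lt (PosNum e0); apply: filterS => n /= ne.
by rewrite (le_trans _ (ltW ne))//; case: (Hh n).
Qed.

(** Only the coordinates of Y are assumed measurable. Composites with trigonometric polynomials are
    then measurable, and [f \o Y] is a pointwise limit of composites with approximants accurate to 1
    / (n + 1) on the cube of half-side n + 1, which eventually contains each [Y w]. *)
Lemma measurable_continuous f C : continuous f -> (forall x, `|f x| <= C) ->
  measurable_fun setT (f \o Y).
Proof.
move=> cf fC.
have /choice[g Hg] (n : nat) : exists g : 'rV[R]_N -> R, trig_limit g /\
    forall x, cube n.+1%:R x -> `|f x - g x| <= n.+1%:R^-1.
  have [g [tg _ fg]] := trig_limit_dense cf fC (ltr0Sn R n) (harmonic_gt0 n).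
  by exists g.
apply: (measurable_fun_cvg (h := fun n => g n \o Y)) => [n|w _].
  by apply: measurable_trig_limit; case: (Hg n).
apply/cvgrPdist_le => e e0.
pose m := (Num.truncn (\sum_i `|Y w 0 i|)).+1.
have Ym i : `|Y w 0 i| <= m%:R.
  rewrite (le_trans _ (ltW (truncnS_gt _)))// (bigD1 i)//= lerDl.
  exact: sumr_ge0.
have := near_infty_natSinv_lt (PosNum e0).
move: (nbhs_infty_ge m); apply: filterS2 => n /= mn ne.
rewrite (le_trans _ (ltW ne))//; case: (Hg n) => _; apply.
apply/cubeP => i; rewrite (le_trans (Ym i))// ler_nat.
exact: leq_trans mn _.
Qed.

End Measurability.

Definition tight_seq {d} {T : measurableType d} (P : probability T R)
    (Y : nat -> T -> 'rV[R]_N) : Prop :=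
  forall e : R, 0 < e -> exists2 L : R, 0 < L & \forall n \near \oo,
    exists A, [/\ measurable A, (P A <= e%:E)%E &
      forall w, ~ A w -> cube L (Y n w)].

Lemma mean_indic {d} {T : measurableType d} (P : probability T R) A :
  measurable A -> integ P (\1_A : T -> R) /\ (mean P \1_A)%:E = P A.
Proof.
move=> mA; split; first exact: integrable_indic.
rewrite /mean /Rintegral integral_indic// setIT fineK//.
exact: fin_num_measure.
Qed.

Lemma mean_approx {d} {T : measurableType d} (P : probability T R)
    (Y : T -> 'rV[R]_N) f g C L e A :
  integ P (f \o Y) -> integ P (g \o Y) ->
  0 <= e -> (forall x, `|f x| <= C) -> (forall x, `|g x| <= C) ->
  (forall x, cube L x -> `|f x - g x| <= e) ->
  measurable A -> (P A <= e%:E)%E -> (forall w, ~ A w -> cube L (Y w)) ->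
  `|mean P (f \o Y) - mean P (g \o Y)| <= e + 2 * C * e.
Proof.
move=> fi gi e0 fC gC fg mA PA HA.
have C0 : 0 <= C by apply: le_trans (fC 0).
have [iA mAE] := mean_indic P mA.
have hi : integ P (fun w => e + 2 * C * \1_A w).
  by apply: integD; [exact: integ_cst|exact: integZ].
apply: (@le_trans _ _ (mean P (fun w => e + 2 * C * \1_A w))).
  apply: mean_dist => // w /=; rewrite indicE; case: (pselect (A w)) => Aw.
    rewrite mem_set// mulr1 (le_trans (ler_normB _ _))//.
    by have := fC (Y w); have := gC (Y w); lra.
  by rewrite memNset// mulr0 addr0; apply: fg; exact: HA.
rewrite meanD ?meanZ ?mean_cst//; [|exact: integ_cst|exact: integZ].
by rewrite lerD2l ler_wpM2l ?mulr_ge0// -lee_fin mAE.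
Qed.

Context {d d' : measure_display} {T : measurableType d} {T' : measurableType d'}.
Variables (P : probability T R) (P' : probability T' R).

(** Linearity gives trigonometric polynomials, and uniform approximation gives their uniform limits.
    A general f is compared with an approximant on a cube carrying almost all the mass; the
    approximant obeys the same global bound C, so the complement of the cube costs at most 2 C times
    its probability. *)
Theorem weak_cvg_of_cos (Y : nat -> T -> 'rV[R]_N) (W : T' -> 'rV[R]_N) f C :
  (forall n i, measurable_fun setT (fun w => Y n w 0 i)) ->
  (forall i, measurable_fun setT (fun w => W w 0 i)) ->
  tight_seq P Y -> tight_seq P' (fun=> W) ->
  (forall t a, mean P (fun w => cos (dot t (Y n w) + a)) @[n --> \oo] -->
     mean P' (fun w => cos (dot t (W w) + a))) ->
  continuous f -> (forall x, `|f x| <= C) ->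
  mean P (f \o Y n) @[n --> \oo] --> mean P' (f \o W).
Proof.
move=> mY mW tY tW YW cf fC.
have C0 : 0 <= C by apply: le_trans (fC 0).
have trig g : trigpoly g -> mean P (g \o Y n) @[n --> \oo] --> mean P' (g \o W).
  move=> [s ->].
  have ci d0 (T0 : measurableType d0) (P0 : probability T0 R) (Y0 : T0 -> 'rV[R]_N)
      (c : R * R * 'rV[R]_N) : (forall i, measurable_fun setT (fun w => Y0 w 0 i)) ->
      integ P0 (fun w => cos (dot c.2 (Y0 w) + c.1.2)).
    move=> mY0; apply: (@integ_bounded _ _ _ _ _ 1).
      exact: (measurable_trigpoly mY0 (trigpoly_cos c.2 c.1.2)).
    by move=> w; rewrite ler_norml cos_geN1 cos_le1.
  have mE d0 (T0 : measurableType d0) (P0 : probability T0 R) (Y0 : T0 -> 'rV[R]_N) :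
      (forall i, measurable_fun setT (fun w => Y0 w 0 i)) ->
      mean P0 ((fun x => \sum_(c <- s) c.1.1 * cos (dot c.2 x + c.1.2)) \o Y0) =
      \sum_(c <- s) c.1.1 * mean P0 (fun w => cos (dot c.2 (Y0 w) + c.1.2)).
    move=> mY0; rewrite [LHS]mean_sum => [|c]; last by apply: integZ; exact: ci.
    by apply: eq_bigr => c _; rewrite meanZ//; exact: ci.
  rewrite mE//; under eq_cvg do rewrite mE//.
  by apply: cvg_sumr => c; apply: cvgM; [exact: cvg_cst|exact: YW].
have utrig g : trig_limit g -> mean P (g \o Y n) @[n --> \oo] --> mean P' (g \o W).
  move=> lg; apply/cvgrPdist_le => e e0; have e3 : 0 < e / 3 by rewrite divr_gt0.
  have [h th gh] := lg _ e3.
  have [Cg [_ gCg]] := trig_limit_bounded lg.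
  have [Ch [_ hCh]] := trigpoly_bounded th.
  have /cvgrPdist_le/(_ _ e3) := trig _ th; apply: filterS => n Hn.
  have b1 : `|mean P' (g \o W) - mean P' (h \o W)| <= e / 3.
    rewrite -[leRHS](mean_cst P'); apply: mean_dist; last by move=> w; exact: gh.
    - by apply: (@integ_bounded _ _ _ _ _ Cg) => [|w]; [exact: measurable_trig_limit|exact: gCg].
    - by apply: (@integ_bounded _ _ _ _ _ Ch) => [|w]; [exact: measurable_trigpoly|exact: hCh].
    - exact: integ_cst.
  have b2 : `|mean P (g \o Y n) - mean P (h \o Y n)| <= e / 3.
    rewrite -[leRHS](mean_cst P); apply: mean_dist; last by move=> w; exact: gh.
    - by apply: (@integ_bounded _ _ _ _ _ Cg) => [|w]; [exact: measurable_trig_limit|exact: gCg].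
    - by apply: (@integ_bounded _ _ _ _ _ Ch) => [|w]; [exact: measurable_trigpoly|exact: hCh].
    - exact: integ_cst.
  rewrite ler_norml; move: b1 b2 Hn; rewrite !ler_norml.
  by move=> /andP[? ?] /andP[? ?] /andP[? ?]; apply/andP; split; lra.
apply/cvgrPdist_le => e e0.
(* Makes e' + 2 C e', the cost of replacing f by g under one law, equal to e / 3; it is paid once
   for each law, and the convergence for g costs the last third. *)
pose e' := e / (3 * (1 + 2 * C)).
have C3 : 0 < 3 * (1 + 2 * C) by rewrite mulr_gt0// ltr_pwDl// mulr_ge0.
have e'0 : 0 < e' by rewrite divr_gt0.
have e'E : e' + 2 * C * e' = e / 3.
  by rewrite /e'; field; rewrite gt_eqF// ltr_pwDl// mulr_ge0.
have [L1 L10 HY] := tY _ e'0; have [L2 L20 HW] := tW _ e'0.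
pose L := Num.max L1 L2.
have L0 : 0 < L by rewrite lt_max L10.
have [g [lg gC fg]] := trig_limit_dense cf fC L0 e'0.
have cubeS (L' : R) x : L' <= L -> cube L' x -> cube L x.
  by move=> L'L /cubeP H; apply/cubeP => i; exact: le_trans (H i) L'L.
have e3 : 0 < e / 3 by rewrite divr_gt0.
have /cvgrPdist_le/(_ _ e3) := utrig _ lg.
move: HY; apply: filterS2 => n [A [mA PA HA]] Hn.
have [n' [A' [mA' PA' HA']]] := filter_ex HW.
have b1 : `|mean P (f \o Y n) - mean P (g \o Y n)| <= e / 3.
  rewrite -e'E; apply: (mean_approx (C := C) (L := L) (A := A)) => //.
  - by apply: (@integ_bounded _ _ _ _ _ C) => [|w]; [exact: measurable_continuous|exact: fC].
  - by apply: (@integ_bounded _ _ _ _ _ C) => [|w]; [exact: measurable_trig_limit|exact: gC].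
  - exact: ltW.
  - by move=> w /HA; apply: cubeS; rewrite le_max lexx.
have b2 : `|mean P' (f \o W) - mean P' (g \o W)| <= e / 3.
  rewrite -e'E; apply: (mean_approx (C := C) (L := L) (A := A')) => //.
  - by apply: (@integ_bounded _ _ _ _ _ C) => [|w]; [exact: measurable_continuous|exact: fC].
  - by apply: (@integ_bounded _ _ _ _ _ C) => [|w]; [exact: measurable_trig_limit|exact: gC].
  - exact: ltW.
  - by move=> w /HA'; apply: cubeS; rewrite le_max lexx orbT.
rewrite ler_norml; move: b1 b2 Hn; rewrite !ler_norml.
by move=> /andP[? ?] /andP[? ?] /andP[? ?]; apply/andP; split; lra.
Qed.

End WeakConvergence.

(** * Normal laws *)

Section CentredNormal.
Context {R : realType}.
Variable s : R.
Hypothesis s_gt0 : 0 < s.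
Local Notation mu := (@lebesgue_measure R).
Local Notation phi := (normal_pdf (0 : R) s).

Local Notation centred_normal := (normal_prob (0 : R) s : probability _ R).

Let s_neq0 : s != 0. Proof. exact: lt0r_neq0. Qed.

Let s2_gt0 : 0 < s ^+ 2. Proof. exact: exprn_gt0. Qed.

Lemma std_pdfE x : phi x = normal_peak s * expR (- (x ^+ 2 / s ^+ 2 / 2)).
Proof.
rewrite normal_pdfE// /normal_fun subr0.
by congr (_ * expR _); field.
Qed.

Lemma std_pdf_gt0 x : 0 < phi x.
Proof. by rewrite std_pdfE mulr_gt0 ?expR_gt0// normal_peak_gt0. Qed.

(** This is y exp(-y) <= 1 for y = x^2 / (2 s^2). It provides the decay of boundary terms in the
    integrations by parts below. *)
Lemma sqr_std_pdf_le x : x ^+ 2 * phi x <= 2 * s ^+ 2 * normal_peak s.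
Proof.
rewrite std_pdfE; set y := x ^+ 2 / s ^+ 2 / 2.
have -> : x ^+ 2 * (normal_peak s * expR (- y)) =
    2 * s ^+ 2 * normal_peak s * (y * expR (- y)) by rewrite /y; field.
rewrite ler_piMr//.
  by rewrite mulr_ge0 ?normal_peak_ge0// mulr_ge0// ltW.
rewrite expRN ler_pdivrMr ?expR_gt0// mul1r.
by have := expR_ge1Dx y; lra.
Qed.

Lemma norm_std_pdf_le x : `|x| * phi x <= (1 + 2 * s ^+ 2) * normal_peak s.
Proof.
have h1 := sqr_std_pdf_le x.
have h2 : phi x <= normal_peak s by exact: normal_pdf_ub.
have h3 : `|x| <= 1 + x ^+ 2.
  by rewrite -[x ^+ 2]real_normK ?num_real//; have := normr_ge0 x; nra.
apply: (@le_trans _ _ ((1 + x ^+ 2) * phi x)); last by lra.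
by rewrite ler_wpM2r// ltW// std_pdf_gt0.
Qed.

Lemma is_derive_std_pdf x : is_derive x (1 : R) phi (- (x / s ^+ 2) * phi x).
Proof.
have -> : phi = (fun y => normal_peak s * expR (- (y ^+ 2 / s ^+ 2 / 2))).
  by apply/funext => y; exact: std_pdfE.
apply: is_derive_eq.
by rewrite /GRing.scale/=; field.
Qed.

Lemma continuous_std_pdf : continuous phi.
Proof. exact: continuous_normal_pdf. Qed.

(** The domination is by a multiple of the normal density of twice the variance: half of the
    exponent absorbs the quadratic growth, since 1 + x^2 <= (1 + 4 s^2) exp(x^2 / (4 s^2)). *)
Lemma integrable_std_pdf K (f : R -> R) : continuous f ->
  (forall x, `|f x| <= K * (1 + x ^+ 2)) ->
  mu.-integrable setT (EFin \o (fun x => f x * phi x)).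
Proof.
move=> cf fK.
have K0 : 0 <= K by have := fK 0; rewrite expr0n/= addr0 mulr1; apply: le_trans.
pose s' := Num.sqrt 2 * s.
have s2 : s' != 0 :> R by rewrite mulf_neq0// sqrtr_eq0 -ltNge.
have s'2 : s' ^+ 2 = 2 * s ^+ 2 by rewrite exprMn sqr_sqrtr.
have p2 := normal_peak_gt0 s2.
pose c := K * normal_peak s * (1 + 4 * s ^+ 2) / normal_peak s'.
have c0 : 0 <= c.
  rewrite /c; apply: divr_ge0; rewrite ?normal_peak_ge0//.
  by rewrite mulr_ge0 ?mulr_ge0 ?normal_peak_ge0// addr_ge0// mulr_ge0// ltW.
apply: (@le_integrable _ _ _ mu _ measurableT _
   (EFin \o (fun x => c * normal_pdf 0 s' x))).
- apply/measurable_EFinP; apply: measurable_funM.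
    exact: continuous_measurable_fun.
  exact: measurable_normal_pdf.
- move=> x _ /=; rewrite lee_fin normrM (gtr0_norm (std_pdf_gt0 x)).
  rewrite [leRHS]ger0_norm; last by rewrite mulr_ge0 ?normal_pdf_ge0.
  rewrite std_pdfE normal_pdfE// /normal_fun subr0 s'2.
  have -> : c * (normal_peak s' * expR (- x ^+ 2 / (2 * s ^+ 2 *+ 2))) =
    normal_peak s * (K * ((1 + 4 * s ^+ 2) * expR (- x ^+ 2 / (2 * s ^+ 2 *+ 2)))).
    by rewrite /c; field; rewrite gt_eqF.
  rewrite mulrCA ler_wpM2l ?normal_peak_ge0//.
  apply: (@le_trans _ _ (K * (1 + x ^+ 2) * expR (- (x ^+ 2 / s ^+ 2 / 2)))).
    by rewrite ler_wpM2r ?expR_ge0.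
  rewrite -mulrA ler_wpM2l//.
  have -> : - (x ^+ 2 / s ^+ 2 / 2) = - x ^+ 2 / (2 * s ^+ 2 *+ 2) + - (x ^+ 2 / s ^+ 2 / 4) by field.
  rewrite expRD mulrCA [leRHS]mulrC ler_wpM2l ?expR_ge0//.
  rewrite expRN ler_pdivrMr ?expR_gt0//.
  have := expR_ge1Dx (x ^+ 2 / s ^+ 2 / 4) => H.
  have : s ^+ 2 * (1 + x ^+ 2 / s ^+ 2 / 4) <= s ^+ 2 * expR (x ^+ 2 / s ^+ 2 / 4).
    by rewrite ler_wpM2l// ltW.
  have -> : s ^+ 2 * (1 + x ^+ 2 / s ^+ 2 / 4) = s ^+ 2 + x ^+ 2 / 4 by field.
  have : 1 <= expR (x ^+ 2 / s ^+ 2 / 4).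
    by apply: le_trans H; rewrite lerDl divr_ge0// divr_ge0 ?sqr_ge0.
  have := ltW s2_gt0; set e := expR _ => h1 h2 h3.
  have h4 : s ^+ 2 <= s ^+ 2 * e by rewrite ler_peMr.
  by lra.
- apply: (@integrableZl _ _ _ mu _ measurableT c (EFin \o normal_pdf 0 s')).
  exact: integrable_normal_pdf.
Qed.

(** The Radon-Nikodym derivative of the normal law has the same integrals over measurable sets as
    the explicit density, so the two agree almost everywhere. *)
Lemma ge0_integral_centred_normal (f : R -> R) : measurable_fun setT f ->
  (forall x, 0 <= f x) ->
  (\int[centred_normal]_x (f x)%:E = \int[mu]_x (f x * phi x)%:E)%E.
Proof.
move=> mf f0.
have dom : centred_normal `<< mu by exact: normal_prob_dominates.
have := @Radon_Nikodym_SigmaFinite.change_of_variables _ _ _ centred_normal mu dom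
  (EFin \o f) setT _ measurableT _.
move=> /(_ (fun x => f0 x)) <-; last exact/measurable_EFinP.
apply: ae_eq_integral => //.
- apply: emeasurable_funM; first exact/measurable_EFinP.
  exact: measurable_int (Radon_Nikodym_SigmaFinite.f_integrable dom).
- by apply/measurable_EFinP; apply: measurable_funM => //; exact: measurable_normal_pdf.
apply: (@ae_eqe_mul2l _ _ _ mu setT _ (EFin \o phi)).
apply: integral_ae_eq => //.
- exact: Radon_Nikodym_SigmaFinite.f_integrable.
- by apply/measurable_EFinP; exact: measurable_normal_pdf.
by move=> A _ mA; rewrite -Radon_Nikodym_SigmaFinite.f_integral.
Qed.

Lemma centred_normal_mean K (f : R -> R) : continuous f ->
  (forall x, `|f x| <= K * (1 + x ^+ 2)) ->
  integ centred_normal f /\ mean centred_normal f = \int[mu]_x (f x * phi x).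
Proof.
move=> cf fK; have mf : measurable_fun setT f by exact: continuous_measurable_fun.
have cn : continuous (fun x => `|f x|).
  by move=> x; apply: cvg_norm; exact: cf.
have gei (g : R -> R) : continuous g -> (forall x, 0 <= g x) ->
    (forall x, `|g x| <= 2 * K * (1 + x ^+ 2)) ->
    integ centred_normal g /\ mean centred_normal g = \int[mu]_x (g x * phi x).
  move=> cg g0 gK; have mg : measurable_fun setT g by exact: continuous_measurable_fun.
  have gE := ge0_integral_centred_normal mg g0.
  have ip := integrable_std_pdf cg gK.
  split; last by rewrite /mean /Rintegral gE.
  apply/integrableP; split; first exact/measurable_EFinP.
  under eq_integral => x _ do rewrite /= ger0_norm//.
  rewrite gE; have [_] := integrableP _ _ _ ip.
  apply: le_lt_trans; apply: ge0_le_integral => //.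
  - by move=> x _; rewrite lee_fin mulr_ge0// normal_pdf_ge0.
  - exact: measurable_int ip.
  - by apply: measurableT_comp => //; exact: measurable_int ip.
  - by move=> x _; rewrite /= lee_fin ler_norm.
have K0 : 0 <= K by have := fK 0; rewrite expr0n/= addr0 mulr1; apply: le_trans.
have [||| i1 m1] := gei (fun x => `|f x|).
- by [].
- by [].
- move=> x; rewrite normr_id (le_trans (fK x))// ler_wpM2r ?addr_ge0 ?sqr_ge0//.
  by lra.
(* The decomposition f = (f + |f|) - |f| reduces signed f to two nonnegative functions that are
   again continuous and of quadratic growth. *)
have [||| i2 m2] := gei (fun x => f x + `|f x|).
- by move=> x; apply: cvgD; [exact: cf|exact: cn].
- by move=> x; rewrite -lerBlDl sub0r; have := ler_norm (- f x); rewrite normrN.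
- move=> x; rewrite (le_trans (ler_normD _ _))// normr_id.
  by have := fK x; lra.
have fE x : f x = (f x + `|f x|) - `|f x| by rewrite addrK.
have fi : integ centred_normal f.
  by rewrite (funext fE); exact: integB.
split=> //; transitivity (mean centred_normal (fun x => (f x + `|f x|) - `|f x|)).
  by apply: eq_mean.
rewrite meanB// m1 m2 -RintegralB//.
- by apply: eq_Rintegral => x _; rewrite mulrDl addrK.
- apply: (@integrable_std_pdf (2 * K)); first by move=> x; apply: cvgD; [exact: cf|exact: cn].
  move=> x; rewrite (le_trans (ler_normD _ _))// normr_id.
  by have := fK x; lra.
- by apply: (@integrable_std_pdf K) => // x; rewrite normr_id.
Qed.

(** The fundamental theorem of calculus on [-(n+1), n+1] leaves boundary values of order c / (n +
    1), and dominated convergence passes to the whole line. The normal moments and cosines below all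
    come from this identity with F a function times the density. *)
Lemma Rintegral_derive0 (F f : R -> R) c : (forall x, is_derive x (1 : R) F (f x)) ->
  continuous f -> mu.-integrable setT (EFin \o f) ->
  (forall x, `|x| * `|F x| <= c) -> \int[mu]_x f x = 0.
Proof.
move=> dF cf fi Fc.
have cF : continuous F.
  move=> x; apply: differentiable_continuous; apply/derivable1_diffP.
  by have := dF x => -[].
pose I n : set R := `[- n.+1%:R, n.+1%:R]%classic.
have mI n : measurable (I n) by exact: measurable_itv.
have lim1 : (\int[mu]_x ((f \_ (I n)) x)%:E)%E @[n --> \oo] --> (\int[mu]_x (f x)%:E)%E.
  apply: (@dominated_cvg _ _ _ mu setT measurableT _ _ (fun x => `|f x|%:E)) => //.
  - move=> n; apply/measurable_EFinP; apply/(measurable_restrictT _ (mI n)).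
    by apply: measurable_funTS; exact: continuous_measurable_fun.
  - move=> x _; apply: cvg_near_cst.
    near=> n; rewrite patchE ifT//; apply: mem_set; rewrite /I/= in_itv/= -ler_norml.
    have nx : (Num.truncn `|x| <= n)%N by near: n; exists (Num.truncn `|x|).
    by rewrite (le_trans (ltW (truncnS_gt _)))// ler_nat.
  - exact: (integrable_abse fi).
  - move=> n x _; rewrite lee_fin patchE; case: ifP => // _.
    by rewrite normr0.
have int_n n : (\int[mu]_x ((f \_ (I n)) x)%:E)%E = (F n.+1%:R - F (- n.+1%:R))%:E.
  transitivity (\int[mu]_(x in I n) (f x)%:E)%E.
    by rewrite [RHS]integral_mkcond; apply: eq_integral => x _; rewrite restrict_EFin.
  rewrite (@continuous_FTC2 _ _ F) ?EFinB//.
  - by rewrite gtrN// ltr0n.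
  - exact: continuous_subspaceT.
  - split.
    + by move=> x _; have := dF x => -[].
    + exact/cvg_at_right_filter/cF.
    + exact/cvg_at_left_filter/cF.
  - by move=> x _; rewrite derive1E (@derive_val _ _ _ _ _ _ _ (dF x)).
have lim2 : (F n.+1%:R - F (- n.+1%:R)) @[n --> \oo] --> (0 : R).
  apply/cvgrPdist_le => e e0; have e2 : 0 < e / (2 * (`|c| + 1)).
    by rewrite divr_gt0// mulr_gt0// ltr_wpDl.
  have := near_infty_natSinv_lt (PosNum e2); apply: filterS => n /= ne.
  have n0 : 0 < n.+1%:R :> R by rewrite ltr0n.
  have Fn z : `|z| = n.+1%:R -> `|F z| <= (`|c| + 1) / n.+1%:R.
    move=> sn; rewrite ler_pdivlMr// mulrC -sn (le_trans (Fc z))//.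
    by rewrite (le_trans (ler_norm c))// lerDl.
  rewrite sub0r normrN (le_trans (ler_normB _ _))//.
  have F1 := Fn n.+1%:R (ger0_norm (ltW n0)).
  have F2 : `|F (- n.+1%:R)| <= (`|c| + 1) / n.+1%:R.
    by apply: Fn; rewrite normrN (ger0_norm (ltW n0)).
  have c1 : 0 < `|c| + 1 by rewrite ltr_wpDl.
  have e2E : (`|c| + 1) * (e / (2 * (`|c| + 1))) = e / 2 by field; rewrite gt_eqF.
  have H : (`|c| + 1) / n.+1%:R < e / 2 by rewrite -e2E ltr_pM2l.
  by rewrite (le_trans (lerD F1 F2))// [leRHS]splitr lerD// ltW.
have lim3 : (\int[mu]_x ((f \_ (I n)) x)%:E)%E @[n --> \oo] --> (0 : R)%:E.
  by under eq_cvg do rewrite int_n; apply/cvg_EFin => //; exact: nearW.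
rewrite /Rintegral; have -> := cvg_unique _ lim1 lim3; by [].
Unshelve. all: by end_near.
Qed.

Let bound1 (x : R) : 1 <= 1 + x ^+ 2.
Proof. by rewrite lerDl sqr_ge0. Qed.

Let boundx (x : R) : `|x| <= 1 + x ^+ 2.
Proof. by rewrite -[x ^+ 2]real_normK ?num_real//; have := normr_ge0 x; nra. Qed.

Lemma centred_normal_mean0 : integ centred_normal id /\ mean centred_normal id = 0.
Proof.
have [|x|i m] := @centred_normal_mean 1 id; first by move=> x; exact: cvg_id.
  by rewrite mul1r.
split=> //; rewrite m.
have := @Rintegral_derive0 (fun x => - s ^+ 2 * phi x) (fun x => x * phi x)
  (s ^+ 2 * ((1 + 2 * s ^+ 2) * normal_peak s)).
apply.
- move=> x; have dphi := is_derive_std_pdf x.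
  by apply: is_derive_eq; rewrite /GRing.scale/=; field.
- by move=> x; apply: cvgM; [exact: cvg_id|exact: continuous_std_pdf].
- apply: (@integrable_std_pdf 1); first by move=> x; exact: cvg_id.
  by move=> x; rewrite mul1r.
- move=> x; rewrite normrM normrN (gtr0_norm s2_gt0) (gtr0_norm (std_pdf_gt0 _)).
  by rewrite mulrCA ler_wpM2l ?norm_std_pdf_le// ltW.
Qed.

Lemma centred_normal_var : integ centred_normal (fun x => x ^+ 2) /\
  mean centred_normal (fun x => x ^+ 2) = s ^+ 2.
Proof.
have cX : continuous (fun x : R => x ^+ 2) by move=> x; exact: exprn_continuous.
have [//|x|i m] := @centred_normal_mean 1 (fun x => x ^+ 2).
  by rewrite mul1r ger0_norm ?sqr_ge0// lerDr.
split=> //.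
have c1X : continuous (fun x : R => 1 - s ^- 2 * x ^+ 2).
  move=> x; apply: cvgB; first exact: cvg_cst.
  by apply: cvgM; [exact: cvg_cst|exact: cX].
have si0 : 0 <= s ^- 2 by rewrite invr_ge0 ltW.
have b1X x : `|1 - s ^- 2 * x ^+ 2| <= (1 + s ^- 2) * (1 + x ^+ 2).
  rewrite (le_trans (ler_normB _ _))// normr1 normrM (ger0_norm si0).
  rewrite (ger0_norm (sqr_ge0 x)); have := mulr_ge0 si0 (sqr_ge0 x).
  by have := sqr_ge0 x; lra.
have [||i' m'] := @centred_normal_mean (1 + s ^- 2) (fun x => 1 - s ^- 2 * x ^+ 2).
- exact: c1X.
- exact: b1X.
have : mean centred_normal (fun x => 1 - s ^- 2 * x ^+ 2) = 0.
  (* The derivative of x times the density is (1 - x^2 / s^2) times the density. *)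
  rewrite m'; apply: (@Rintegral_derive0 (fun x => x * phi x) _ (2 * s ^+ 2 * normal_peak s)).
  - move=> x; have dphi := is_derive_std_pdf x.
    by apply: is_derive_eq; rewrite /GRing.scale/=; field.
  - move=> x; apply: cvgM; last exact: continuous_std_pdf.
    exact: c1X.
  - apply: (@integrable_std_pdf (1 + s ^- 2)).
      exact: c1X.
    exact: b1X.
  - move=> x; rewrite normrM mulrA -expr2 real_normK ?num_real//.
    by rewrite (gtr0_norm (std_pdf_gt0 _)) sqr_std_pdf_le.
rewrite meanB//; [|exact: integ_cst|exact: integZ].
rewrite mean_cst meanZ// => /eqP; rewrite subr_eq0 => /eqP.
by move=> /(congr1 ( *%R (s ^+ 2))); rewrite mulr1 mulrA mulfV ?mul1r ?lt0r_neq0.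
Qed.

(** Let g(t) be the left-hand side. Differentiation under the integral gives g'(t) = -
    E[x sin(t x + b)], and integration by parts turns this into - s^2 t g(t); hence g(t) exp(s^2 t^2
    / 2) is constant, equal to its value cos b at 0. *)
Lemma centred_normal_cos t b : mean centred_normal (fun x => cos (t * x + b)) =
  expR (- (s ^+ 2 * t ^+ 2 / 2)) * cos b.
Proof.
pose g t := mean centred_normal (fun x => cos (t * x + b)).
have ccos t' : continuous (fun x : R => cos (t' * x + b)).
  move=> x; apply: continuous_comp; last exact: continuous_cos.
  by apply: cvgD; [apply: cvgM; [exact: cvg_cst|exact: cvg_id]|exact: cvg_cst].
have csin t' : continuous (fun x : R => sin (t' * x + b)).
  move=> x; apply: continuous_comp; last exact: continuous_sin.
  by apply: cvgD; [apply: cvgM; [exact: cvg_cst|exact: cvg_id]|exact: cvg_cst].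
have cos1 x : `|cos x| <= 1 :> R by rewrite ler_norml cos_geN1 cos_le1.
have sin1 x : `|sin x| <= 1 :> R by rewrite ler_norml sin_geN1 sin_le1.
have icos t' : integ centred_normal (fun x => cos (t' * x + b)).
  by have [||] := @centred_normal_mean 1 (fun x => cos (t' * x + b)) => // x; rewrite mul1r (le_trans (cos1 _)).
have isin t' : integ centred_normal (fun x => x * sin (t' * x + b)).
  have [||//] := @centred_normal_mean 1 (fun x => x * sin (t' * x + b)).
    by move=> x; apply: cvgM; [exact: cvg_id|exact: csin].
  by move=> x; rewrite mul1r normrM (le_trans _ (boundx x))// ler_piMr.
have dcos (y x : R) : is_derive y (1 : R) (fun t : R => cos (t * x + b)) (- (x * sin (y * x + b))).
  by apply: is_derive_eq; rewrite /GRing.scale/=; ring.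
have si0 : 0 <= s ^- 2 by rewrite invr_ge0 ltW.
have key t' : mean centred_normal (fun x => x * sin (t' * x + b)) = s ^+ 2 * t' * g t'.
  have : mean centred_normal (fun x => t' * cos (t' * x + b) - s ^- 2 * (x * sin (t' * x + b))) = 0.
    have cf : continuous (fun x : R => t' * cos (t' * x + b) - s ^- 2 * (x * sin (t' * x + b))).
      move=> x; apply: cvgB; apply: cvgM; [exact: cvg_cst|exact: ccos|exact: cvg_cst|].
      by apply: cvgM; [exact: cvg_id|exact: csin].
    have bf x : `|t' * cos (t' * x + b) - s ^- 2 * (x * sin (t' * x + b))| <= (`|t'| + s ^- 2) * (1 + x ^+ 2).
      rewrite mulrDl (le_trans (ler_normB _ _))// !normrM lerD//.
        by rewrite ler_pM// (le_trans (cos1 _)).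
      rewrite (ger0_norm si0) ler_wpM2l//.
      by rewrite (le_trans _ (boundx x))// ler_piMr.
    have [//|//|_ ->] := @centred_normal_mean (`|t'| + s ^- 2) (fun x => t' * cos (t' * x + b) - s ^- 2 * (x * sin (t' * x + b))).
    (* Integration by parts: the integrand is the derivative of sin(t' x + b) times the density. *)
    apply: (@Rintegral_derive0 (fun x => sin (t' * x + b) * phi x) _ ((1 + 2 * s ^+ 2) * normal_peak s)).
    - move=> x; have dphi := is_derive_std_pdf x.
      by apply: is_derive_eq; rewrite /GRing.scale/=; field.
    - by move=> x; apply: cvgM; [exact: cf|exact: continuous_std_pdf].
    - exact: integrable_std_pdf bf.
    - move=> x; rewrite normrM (gtr0_norm (std_pdf_gt0 _)).
      rewrite mulrCA (le_trans _ (norm_std_pdf_le x))// ler_piMl//.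
      by rewrite mulr_ge0// ltW// std_pdf_gt0.
  rewrite meanB//; [|exact: integZ|exact: integZ].
  rewrite !meanZ// => /eqP; rewrite subr_eq0 => /eqP H.
  by rewrite -mulrA [t' * g t']H mulrA mulfV ?mul1r// lt0r_neq0.
have dg t' : is_derive t' (1 : R) g (- (s ^+ 2 * t' * g t')).
  have ia : `]t' - 1, t' + 1[%classic t' by rewrite /= in_itv/= ltrBlDr ltrDl ltr01.
  have der1 (x y : R) : `]t' - 1, t' + 1[%classic x -> setT y -> derivable (fun t : R => cos (t * y + b)) x 1.
    by move=> _ _; have := dcos x y => -[].
  have p1 (x y : R) : partial1of2 (fun t x : R => cos (t * x + b)) x y = - (y * sin (x * y + b)).
    by rewrite partial1of2E (@derive_val _ _ _ _ _ _ _ (dcos x y)).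
  have bnd (x y : R) : `]t' - 1, t' + 1[%classic x -> setT y ->
      `|partial1of2 (fun t x : R => cos (t * x + b)) x y| <= `|y|.
    by move=> _ _; rewrite p1 normrN normrM ler_piMr.
  have inorm : centred_normal.-integrable setT (EFin \o (fun y : R => `|y|)).
    by apply: integ_norm; case: centred_normal_mean0.
  have D := @derivable_under_integral _ _ _ centred_normal (fun t x : R => cos (t * x + b))
    setT measurableT t' _ _ ia (fun x _ => icos x) der1 (fun y => `|y|) (fun y => normr_ge0 y) inorm bnd.
  have E := @differentiation_under_integral _ _ _ centred_normal (fun t x : R => cos (t * x + b))
    setT measurableT t' _ _ ia (fun x _ => icos x) der1 (fun y => `|y|) (fun y => normr_ge0 y) inorm bnd.
  apply: DeriveDef; first exact: D.
  rewrite -derive1E [LHS]E -key -meanN; last exact: isin.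
  by apply: eq_Rintegral => x _; rewrite p1.
pose k t := g t * expR (s ^+ 2 * t ^+ 2 / 2).
have dk t' : is_derive t' (1 : R) k 0.
  have dgt := dg t'.
  by apply: is_derive_eq; rewrite /GRing.scale/=; field.
have := is_derive_0_is_cst t 0 dk.
rewrite /k expr0n/= mulr0 mul0r expR0 mulr1 => kE.
have -> : mean centred_normal (fun x => cos (t * x + b)) = k t * expR (- (s ^+ 2 * t ^+ 2 / 2)).
  by rewrite /k -mulrA -expRD subrr expR0 mulr1.
rewrite /k kE mulrC; congr (_ * _).
by rewrite /g; under eq_mean do rewrite mul0r add0r; rewrite mean_cst.
Qed.

End CentredNormal.

Section MeanDominated.
Context {R : realType} {d : measure_display} {T : measurableType d}.
Variable P : probability T R.

Lemma cvg_mean_dominated (f : nat -> T -> R) (f0 g : T -> R) :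
  (forall n, measurable_fun setT (f n)) -> measurable_fun setT f0 ->
  (forall w, f n w @[n --> \oo] --> f0 w) -> integ P g ->
  (forall n w, `|f n w| <= g w) -> mean P (f n) @[n --> \oo] --> mean P f0.
Proof.
move=> mf mf0 ff0 gi fg.
have f0g w : `|f0 w| <= g w.
  have H : `|f n w| @[n --> \oo] --> `|f0 w| by apply: cvg_norm (ff0 w).
  by rewrite -(cvg_lim _ H)//; apply: limr_le; [apply/cvg_ex; exists `|f0 w| |exact: nearW].
have fi n : integ P (f n) by apply: integ_le (mf n) (fg n) gi.
have f0i : integ P f0 by apply: integ_le mf0 f0g gi.
apply: fine_cvg; rewrite /mean /Rintegral fineK ?integrable_fin_num//.
apply: (@dominated_cvg _ _ _ P setT measurableT _ _ (fun w => (g w)%:E)) => //.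
- by move=> n; apply/measurable_EFinP.
- by move=> w _; apply/cvg_EFin; [exact: nearW|exact: ff0].
- by move=> n w _ /=; rewrite lee_fin.
Qed.

End MeanDominated.

(** * Laws determined by their mean cosines *)

Section LawFromCos.
Context {R : realType} {d d' : measure_display}.
Context {T : measurableType d} {T' : measurableType d'}.
Variables (P : probability T R) (P' : probability T' R).

Lemma probability_bigsetU_le (d0 : measure_display) (T0 : measurableType d0)
    (P0 : probability T0 R) (I : Type) (s : seq I) (A : I -> set T0) :
  (forall i, measurable (A i)) ->
  (P0 (\big[setU/set0]_(i <- s) A i) <= \sum_(i <- s) P0 (A i))%E.
Proof.
move=> mA; elim: s => [|i s IHs]; first by rewrite !big_nil measure0.
rewrite !big_cons (le_trans (measureU2 _ _ _))//; last by rewrite leeD2l.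
exact: bigsetU_measurable.
Qed.

Lemma tight_sqint (d0 : measure_display) (T0 : measurableType d0)
    (P0 : probability T0 R) (N : nat) (W : T0 -> 'rV[R]_N) :
  (forall i, sqint P0 (fun w => W w 0 i)) -> tight_seq P0 (fun=> W).
Proof.
move=> sW e e0; pose S w := \sum_i W w 0 i ^+ 2.
pose V := \sum_i mean P0 (fun w => W w 0 i ^+ 2).
have V0 : 0 <= V by apply: sumr_ge0 => i _; apply: mean_ge0 => w; exact: sqr_ge0.
(* Chebyshev's inequality and the union bound give V / L^2, which this choice makes at most e; the
   added 1 keeps L positive when V = 0. *)
pose L := Num.sqrt ((V + 1) / e).
have L0 : 0 < L by rewrite sqrtr_gt0 divr_gt0// ltr_wpDl.
have L2 : L ^+ 2 = (V + 1) / e by rewrite sqr_sqrtr// divr_ge0 ?ltW// ltr_wpDl.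
exists L => //; apply: nearW => _.
have mW i : measurable_fun setT (fun w => W w 0 i) by case: (sW i).
have mi i : measurable [set w | (L <= `|W w 0 i|)%R].
  rewrite -[X in measurable X]setTI.
  by apply: (measurable_fun_le (f := cst L)) => //; exact: measurableT_comp.
exists (\big[setU/set0]_(i < N) [set w | (L <= `|W w 0 i|)%R]); split.
- exact: bigsetU_measurable.
- apply: (@le_trans _ _ (\sum_(i < N) P0 [set w | (L <= `|W w 0 i|)%R])%E).
    exact: probability_bigsetU_le.
  apply: (@le_trans _ _ (\sum_(i < N) (L ^- 2 * mean P0 (fun w => W w 0 i ^+ 2))%:E)%E).
    by apply: lee_sum => i _; exact: markov_sqr.
  rewrite sumEFin lee_fin -mulr_sumr -/V L2 invf_div mulrAC.
  by rewrite ler_pdivrMr ?ltr_wpDl// ler_wpM2l ?ltW// ltrDl.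
move=> w Hw; apply/cubeP => i; rewrite leNgt; apply/negP => /ltW Li; apply: Hw.
by rewrite (bigD1 i)//=; left.
Qed.

Let ramp (x : R) (n : nat) (y : R) : R := Num.min 1 (n%:R * Num.max 0 (x - y)).

Let ramp_bound x n y : `|ramp x n y| <= 1.
Proof.
rewrite /ramp ger0_norm ?ge_min ?lexx// le_min ler01/= mulr_ge0//.
by rewrite le_max lexx.
Qed.

Let continuous_ramp x n : continuous (ramp x n).
Proof.
move=> y; apply: (@continuous_min _ _ (cst 1) (fun y => n%:R * Num.max 0 (x - y))).
  exact: cvg_cst.
apply: cvgM; first exact: cvg_cst.
apply: (@continuous_max _ _ (cst 0) (fun y => x - y)); first exact: cvg_cst.
by apply: cvgB; [exact: cvg_cst|exact: cvg_id].
Qed.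

Let cvg_ramp x y : ramp x n y @[n --> \oo] --> (\1_`]-oo, x[%classic y : R).
Proof.
rewrite indicE; apply: cvg_near_cst; rewrite /ramp.
have [yx|xy] := ltP y x.
  rewrite mem_set/= ?in_itv//=.
  have yx0 : 0 < x - y by rewrite subr_gt0.
  near=> n; rewrite max_r ?ltW//; apply/min_idPl.
  rewrite -ler_pdivrMr// mul1r; near: n.
  exact: nbhs_infty_ger.
rewrite memNset/= ?in_itv/=; last by apply/negP; rewrite -leNgt.
by apply: nearW => n; rewrite max_l ?subr_le0// mulr0 min_r.
Unshelve. all: by end_near.
Qed.

(** Uniqueness is drawn from weak convergence of a constant sequence: equal cosines give equal means
    of bounded continuous functions, the ramps then give the open rays, and these form a pi-system
    generating the Borel sets. Square integrability supplies tightness. *)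
Lemma law_from_cos (Z : T -> R) (Z' : T' -> R) : sqint P Z -> sqint P' Z' ->
  (forall t b, mean P (fun w => cos (t * Z w + b)) =
               mean P' (fun w => cos (t * Z' w + b))) ->
  forall A, measurable A -> P (Z @^-1` A) = P' (Z' @^-1` A).
Proof.
move=> sZ sZ' ZZ' A mA.
have mZ := sqint_measurable sZ; have mZ' := sqint_measurable sZ'.
have eq_cont (f : R -> R) : continuous f -> (forall x, `|f x| <= 1) ->
    mean P (f \o Z) = mean P' (f \o Z').
  move=> cf f1.
  pose Y (w : T) : 'rV[R]_1 := \row_j Z w; pose W (w : T') : 'rV[R]_1 := \row_j Z' w.
  pose g (x : 'rV[R]_1) := f (x 0 0).
  have YE i : (fun w => Y w 0 i) = Z by apply/funext => w; rewrite mxE.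
  have WE i : (fun w => W w 0 i) = Z' by apply/funext => w; rewrite mxE.
  have H := @weak_cvg_of_cos R 1 _ _ _ _ P P' (fun=> Y) W g 1 _ _ _ _ _ _ _.
  have : mean P (g \o Y) @[_ --> \oo] --> mean P' (g \o W).
    apply: H.
    - by move=> _ i; rewrite YE.
    - by move=> i; rewrite WE.
    - by apply: tight_sqint => i; rewrite YE.
    - by apply: tight_sqint => i; rewrite WE.
    - move=> t a; rewrite (_ : mean P' _ = mean P (fun w => cos (dot t (Y w) + a))).
        exact: cvg_cst.
      transitivity (mean P' (fun w => cos (t 0 0 * Z' w + a))).
        by apply: eq_mean => w; rewrite /dot big_ord1 mxE.
      by rewrite -ZZ'; apply: eq_mean => w; rewrite /dot big_ord1 mxE.
    - move=> x; apply: (@continuous_comp _ _ _ (fun x : 'rV[R]_1 => x 0 0) f).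
        exact: coord_continuous.
      exact: cf.
    - by move=> x; exact: f1.
  have gY : g \o Y = f \o Z by apply/funext => w; rewrite /g/= mxE.
  have gW : g \o W = f \o Z' by apply/funext => w; rewrite /g/= mxE.
  rewrite gY gW => /cvg_lim <- //; by rewrite lim_cst.
have ray x : P (Z @^-1` `]-oo, x[%classic) = P' (Z' @^-1` `]-oo, x[%classic).
  have mI : measurable (`]-oo, x[%classic : set R) by exact: measurable_itv.
  have mP : measurable (Z @^-1` `]-oo, x[%classic).
    by rewrite -[X in measurable X]setTI; exact: mZ.
  have mP' : measurable (Z' @^-1` `]-oo, x[%classic).
    by rewrite -[X in measurable X]setTI; exact: mZ'.
  have [_ <-] := mean_indic P mP; have [_ <-] := mean_indic P' mP'.
  congr EFin.
  have l1 : mean P (ramp x n \o Z) @[n --> \oo] --> mean P (\1_`]-oo, x[%classic \o Z : T -> R).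
    apply: (cvg_mean_dominated (g := cst 1)) => //.
    - move=> n; apply: measurableT_comp => //.
      by apply: continuous_measurable_fun; exact: continuous_ramp.
    - by apply: measurableT_comp => //; exact: measurable_indic.
    - by move=> w; exact: cvg_ramp.
    - exact: integ_cst.
    - by move=> n w; exact: ramp_bound.
  have l2 : mean P' (ramp x n \o Z') @[n --> \oo] --> mean P' (\1_`]-oo, x[%classic \o Z' : T' -> R).
    apply: (cvg_mean_dominated (g := cst 1)) => //.
    - move=> n; apply: measurableT_comp => //.
      by apply: continuous_measurable_fun; exact: continuous_ramp.
    - by apply: measurableT_comp => //; exact: measurable_indic.
    - by move=> w; exact: cvg_ramp.
    - exact: integ_cst.
    - by move=> n w; exact: ramp_bound.
  have E n : mean P (ramp x n \o Z) = mean P' (ramp x n \o Z').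
    by apply: eq_cont; [exact: continuous_ramp|exact: ramp_bound].
  by move: l2; under eq_cvg do rewrite -E; exact: cvg_unique l1.
pose F : {mfun T >-> R} := HB.pack Z (isMeasurableFun.Build _ _ _ _ Z mZ).
pose F' : {mfun T' >-> R} := HB.pack Z' (isMeasurableFun.Build _ _ _ _ Z' mZ').
have := @measure_unique _ R R (@RGenInftyO.G R) (fun n => `]-oo, n%:R[%classic)
  (@RGenInftyO.measurableE R) _ _ _ (distribution P F) (distribution P' F').
apply => //.
- move=> _ _ [x ->] [y ->]; exists (Num.min x y); apply/seteqP; split => z /=.
    by rewrite !in_itv/= lt_min => -[-> ->].
  by rewrite !in_itv/= lt_min => /andP[].
- by move=> n; exists n%:R.
- apply/seteqP; split=> // z _; exists (Num.truncn `|z|).+1 => //=.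
  by rewrite in_itv/= (le_lt_trans (ler_norm _))// truncnS_gt.
- by move=> _ [x ->]; exact: ray.
- move=> n; apply: le_lt_trans (ltry 1); exact: probability_le1.
Qed.

End LawFromCos.

Section GaussianVectors.
Context {R : realType}.

Lemma mean_fst (d d' : measure_display) (T : measurableType d)
    (T' : measurableType d') (P : probability T R) (P' : probability T' R)
    (f : T -> R) : integ P f ->
  integ ((P \x P')%E : probability _ R) (fun w => f w.1) /\
  mean ((P \x P')%E : probability _ R) (fun w => f w.1) = mean P f.
Proof.
move=> fi; have mf := integ_measurable fi.
have mf1 : measurable_fun setT (fun w : T * T' => f w.1) by exact: measurableT_comp.
have F1 (g : T -> R) : measurable_fun setT g -> (forall w, 0 <= g w) ->
    (\int[P \x P']_w (g w.1)%:E = \int[P]_w (g w)%:E)%E.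
  move=> mg g0; rewrite fubini_tonelli1//=.
  - apply: eq_integral => x _; rewrite /fubini_F/= integral_cst//=.
    by rewrite probability_setT mule1.
  - by apply/measurable_EFinP; exact: measurableT_comp.
  - by move=> w; rewrite lee_fin.
have int1 : integ ((P \x P')%E : probability _ R) (fun w => f w.1).
  apply/integrableP; split; first exact/measurable_EFinP.
  have [_] := integrableP _ _ _ fi.
  by rewrite -(F1 (fun w => `|f w|))//; exact: measurableT_comp.
split=> //; rewrite /mean /Rintegral -integral12_prod_meas1//; congr fine.
apply: eq_integral => x _; rewrite /fubini_F/= integral_cst//=.
by rewrite probability_setT mule1.
Qed.

Lemma mean_snd (d d' : measure_display) (T : measurableType d)
    (T' : measurableType d') (P : probability T R) (P' : probability T' R)
    (f : T' -> R) : integ P' f ->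
  integ ((P \x P')%E : probability _ R) (fun w => f w.2) /\
  mean ((P \x P')%E : probability _ R) (fun w => f w.2) = mean P' f.
Proof.
move=> fi; have mf := integ_measurable fi.
have mf1 : measurable_fun setT (fun w : T * T' => f w.2) by exact: measurableT_comp.
have F1 (g : T' -> R) : measurable_fun setT g -> (forall w, 0 <= g w) ->
    (\int[P \x P']_w (g w.2)%:E = \int[P']_w (g w)%:E)%E.
  move=> mg g0; rewrite fubini_tonelli1//=.
  - by rewrite /fubini_F/= integral_cst//= probability_setT mule1.
  - by apply/measurable_EFinP; exact: measurableT_comp.
  - by move=> w; rewrite lee_fin.
have int1 : integ ((P \x P')%E : probability _ R) (fun w => f w.2).
  apply/integrableP; split; first exact/measurable_EFinP.
  have [_] := integrableP _ _ _ fi.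
  by rewrite -(F1 (fun w => `|f w|))//; exact: measurableT_comp.
split=> //; rewrite /mean /Rintegral -integral12_prod_meas1//; congr fine.
by rewrite /fubini_F/= integral_cst//= probability_setT mule1.
Qed.

Lemma mean_prod2 (d d' : measure_display) (T : measurableType d)
    (T' : measurableType d') (P : probability T R) (P' : probability T' R)
    (f : T -> R) (g : T' -> R) : integ P f -> integ P' g ->
  integ ((P \x P')%E : probability _ R) (fun w => f w.1 * g w.2) /\
  mean ((P \x P')%E : probability _ R) (fun w => f w.1 * g w.2) = mean P f * mean P' g.
Proof.
move=> fi gi; have [f1 <-] := mean_fst P' fi; have [g1 <-] := mean_snd P gi.
have mf := integ_measurable fi; have mg := integ_measurable gi.
apply: indep_mean_mul => // _ _ [A mA <-] [B mB <-]; rewrite !setTI.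
have mfA : measurable (f @^-1` A) by rewrite -[X in measurable X]setTI; exact: mf.
have mgB : measurable (g @^-1` B) by rewrite -[X in measurable X]setTI; exact: mg.
rewrite (_ : _ `&` _ = (f @^-1` A) `*` (g @^-1` B))//.
rewrite (_ : _ @^-1` A = (f @^-1` A) `*` setT); last first.
  by apply/seteqP; split=> // w [].
rewrite (_ : _ @^-1` B = setT `*` (g @^-1` B)); last first.
  by apply/seteqP; split=> // w [].
have PT : P setT = 1%E := probability_setT P.
have PT' : P' setT = 1%E := probability_setT P'.
have pE A' B' : measurable A' -> measurable B' ->
  ((P \x P')%E : probability _ R) (A' `*` B') = (P A' * P' B')%E.
  by move=> mA' mB'; exact: product_measure1E.
by rewrite !pE// PT PT' mule1 mul1e.
Qed.

(* N independent standard normal variables, given by the characteristic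
   function and the first two moments of their linear combinations. *)
Lemma std_gaussian_exists (N : nat) : exists (d : measure_display)
    (T : measurableType d) (P : probability T R) (G : nat -> T -> R),
  [/\ forall i, (i < N)%N -> sqint P (G i),
      forall i, (i < N)%N -> mean P (G i) = 0,
      forall i j, (i < N)%N -> (j < N)%N ->
        mean P (fun w => G i w * G j w) = (i == j)%:R &
      forall (t : nat -> R) (b : R),
        mean P (fun w => cos (\sum_(i < N) t i * G i w + b)) =
        expR (- (\sum_(i < N) t i ^+ 2 / 2)) * cos b].
Proof.
have std1 : (0 : R) < 1 by [].
elim: N => [|N [d [T [P [G [sG G0 GG Gcos]]]]]].
  exists _, R, (dirac (0 : R) : probability R R), (fun _ _ => 0); split=> // t b.
  under eq_mean do rewrite big_ord0 add0r.
  by rewrite mean_cst big_ord0 oppr0 expR0 mul1r.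
(* One more variable is adjoined by taking the product with a standard normal law on the line;
   earlier variables are read on the first factor. *)
pose Q : probability _ R := normal_prob (0 : R) (1 : R).
pose PQ : probability _ R := (P \x Q)%E.
pose G' i (w : T * _) : R := if (i < N)%N then G i w.1 else w.2.
have [id1 id0] := centred_normal_mean0 std1.
have [sq1 sqE] := centred_normal_var std1.
have sid : sqint Q id by split=> //; exact: measurable_id.
have lt_or i : (i < N.+1)%N -> (i < N)%N \/ i = N.
  by rewrite ltnS leq_eqVlt => /predU1P[->|->]; [right|left].
have mG i : (i < N)%N -> measurable_fun setT (G i) by move=> /sG[].
have G'1 i : (i < N)%N -> G' i = fun w => G i w.1.
  by move=> iN; apply/funext => w; rewrite /G' iN.
have G'2 : G' N = fun w => w.2 by apply/funext => w; rewrite /G' ltnn.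
exists _, _, PQ, G'; split.
- move=> i /lt_or[iN|->].
    rewrite G'1//; split; first by apply: measurableT_comp; [exact: mG|].
    exact: (mean_fst Q (sG i iN).2).1.
  rewrite G'2; split; first exact: measurable_snd.
  exact: (mean_snd P sq1).1.
- move=> i /lt_or[iN|->].
    by rewrite G'1// (mean_fst Q (sqint_integ (sG i iN))).2 G0.
  by rewrite G'2 (mean_snd P id1).2.
- move=> i j /lt_or[iN|->] /lt_or[jN|->].
  + rewrite !G'1//.
    by rewrite (mean_fst Q (sqint_mul (sG i iN) (sG j jN))).2 GG.
  + rewrite G'1// G'2 (mean_prod2 (sqint_integ (sG i iN)) id1).2 G0// mul0r.
    by rewrite ltn_eqF.
  + rewrite (G'1 j)// G'2; under eq_mean do rewrite mulrC.
    by rewrite (mean_prod2 (sqint_integ (sG j jN)) id1).2 G0// mul0r gtn_eqF.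
  + rewrite G'2 eqxx; under eq_mean do rewrite -expr2.
    by rewrite (mean_snd P sq1).2 sqE expr1n.
move=> t b; rewrite big_ord_recr/=.
pose S w := \sum_(i < N) t i * G i w + b.
have mS : measurable_fun setT S.
  apply: measurable_funD => //; apply: measurable_sum => i.
  by apply: measurable_funM => //; exact: mG.
have mtN : measurable_fun setT (fun x : R => t N * x) by exact: measurable_funM.
have [cc ccE] := mean_prod2 (integ_cos P mS) (integ_cos Q mtN).
have [ss ssE] := mean_prod2 (integ_sin P mS) (integ_sin Q mtN).
transitivity (mean PQ (fun w => cos (S w.1) * cos (t N * w.2) - sin (S w.1) * sin (t N * w.2))).
  apply: eq_mean => w; rewrite -cosD big_ord_recr/= G'2 addrAC; congr cos.
  congr (_ + _ + _); apply: eq_bigr => i _.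
  by rewrite G'1.
rewrite meanB// ccE ssE.
have ct : mean Q (fun x => cos (t N * x)) = expR (- (t N ^+ 2 / 2)).
  have := centred_normal_cos std1 (t N) 0; rewrite cos0 mulr1 expr1n mul1r => <-.
  by apply: eq_mean => x; rewrite addr0.
(* A sine is a cosine with phase - pi / 2, where the factor cos b of the normal formula vanishes. *)
have st : mean Q (fun x => sin (t N * x)) = 0.
  have := centred_normal_cos std1 (t N) (- (pi / 2)).
  rewrite cosN cos_pihalf mulr0 => <-.
  by apply: eq_mean => x; rewrite cosBpihalf.
by rewrite st mulr0 subr0 ct Gcos mulrAC -expRD -opprD.
Qed.

End GaussianVectors.

(** * Factorisation of positive semidefinite matrices *)

Section PSD.
Context {R : realType}.

Definition psdmx (n : nat) (A : 'M[R]_n) : Prop :=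
  A^T = A /\ forall x : 'rV[R]_n, 0 <= (x *m A *m x^T) 0 0.

Lemma mx11_dotC (n : nat) (y v : 'rV[R]_n) : y *m v^T = ((v *m y^T) 0 0)%:M.
Proof.
rewrite [LHS]mx11_scalar; congr (_%:M); rewrite !mxE.
by apply: eq_bigr => i _; rewrite !mxE mulrC.
Qed.

Lemma mx11_dot_gt0 (n : nat) (v : 'rV[R]_n) : v != 0 -> 0 < (v *m v^T) 0 0.
Proof.
move=> vn0; have E : (v *m v^T) 0 0 = \sum_i v 0 i ^+ 2.
  by rewrite mxE; apply: eq_bigr => i _; rewrite mxE expr2.
rewrite E lt0r sumr_ge0 ?andbT => [|i _]; last exact: sqr_ge0.
apply: contra vn0 => /eqP/psumr_eq0P H; apply/eqP/rowP => j; rewrite [RHS]mxE.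
by apply/eqP; rewrite -sqrf_eq0 H// => i _; exact: sqr_ge0.
Qed.

(** Cholesky factorisation by induction on the size. A positive corner a is eliminated, and the
    factor of the Schur complement C - v' v / a is bordered by the square root of a; a zero corner
    forces its whole row to vanish. *)
Lemma psd_factor (n : nat) (A : 'M[R]_n) : psdmx A -> exists F : 'M[R]_n, A = F *m F^T.
Proof.
elim: n A => [|n IHn] A [sA pA].
  by exists 0; apply/matrixP => -[].
rewrite -[n.+1]/(1 + n)%N in A sA pA *.
pose a := A 0 0; pose v : 'rV[R]_n := @ursubmx R 1 n 1 n A.
pose C : 'M[R]_n := @drsubmx R 1 n 1 n A.
have AE : A = block_mx a%:M v v^T C.
  rewrite -[LHS]submxK; congr block_mx.
    by apply/matrixP => i j; rewrite !ord1 !mxE; congr (A _ _); apply/val_inj.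
  by rewrite trmx_ursub sA.
have sC : C^T = C by rewrite trmx_drsub sA.
have quad (s : R) (y : 'rV[R]_n) :
    0 <= s ^+ 2 * a + 2 * s * (v *m y^T) 0 0 + (y *m C *m y^T) 0 0.
  have := pA (row_mx s%:M y); rewrite AE mul_row_block tr_row_mx mul_row_col.
  rewrite !mulmxDl tr_scalar_mx (mx11_dotC y v) -!scalar_mxM mul_scalar_mx -scalemxAl.
  set p := v *m y^T; set z := y *m C *m y^T; rewrite !mxE !eqxx !mulr1n.
  by move: (p 0 0) (z 0 0) => p0 z0; lra.
have [a0|an0] := eqVneq a 0.
  have v0 : v = 0.
    apply/eqP; apply/negPn/negP => vn0.
    have vv : 0 < (v *m v^T) 0 0.
      exact: mx11_dot_gt0.
    (* With a = 0 the form is affine in s; this s gives it the value -1, contradicting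
       semidefiniteness. *)
    have := quad (- ((v *m C *m v^T) 0 0 + 1) / (2 * (v *m v^T) 0 0)) v.
    rewrite a0 mulr0 add0r; move: vv ((v *m C *m v^T) 0 0).
    move: ((v *m v^T) 0 0) => z z0 k.
    have -> : 2 * (- (k + 1) / (2 * z)) * z = - (k + 1) by field; rewrite gt_eqF.
    by lra.
  have [|F FE] := IHn C.
    by split=> // y; have := quad 0 y; rewrite expr0n/= !(mul0r, mulr0) !add0r.
  exists (block_mx 0 0 0 F : 'M[R]_(1 + n)).
  rewrite AE a0 v0 FE tr_block_mx mulmx_block !(mul0mx, mulmx0, trmx0, addr0, add0r).
  by congr block_mx; apply/matrixP => i j; rewrite !mxE mul0rn.
have a_gt0 : 0 < a.
  rewrite lt0r an0/=; have := quad 1 0.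
  by rewrite trmx0 mulmx0 !mul0mx !mxE expr1n !mul1r mulr0 !addr0.
have [|F FE] := IHn (C - a^-1 *: (v^T *m v)).
  split; first by rewrite linearB/= linearZ/= trmx_mul trmxK sC.
  (* The s that minimises the form for fixed y: the minimum is the form of the Schur complement at
     y. *)
  move=> y; have := quad (- a^-1 * (v *m y^T) 0 0) y.
  rewrite mulmxBr mulmxBl -scalemxAr -scalemxAl !mulmxA.
  rewrite (mx11_dotC y v) mul_scalar_mx -scalemxAl.
  set p := v *m y^T; set z := y *m C *m y^T; rewrite !mxE.
  move: (p 0 0) (z 0 0) => p0 z0.
  by congr (0 <= _); field.
exists (block_mx (Num.sqrt a)%:M 0 ((Num.sqrt a)^-1 *: v^T) F : 'M[R]_(1 + n)).
rewrite AE tr_block_mx mulmx_block !tr_scalar_mx trmx0 linearZ/= trmxK.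
rewrite !(mul0mx, mulmx0, addr0) -FE; congr block_mx.
- by rewrite mul_scalar_mx scale_scalar_mx -expr2 sqr_sqrtr// ltW.
- by rewrite mul_scalar_mx scalerA mulfV ?scale1r// gt_eqF// sqrtr_gt0.
- by rewrite mul_mx_scalar scalerA mulfV ?scale1r// gt_eqF// sqrtr_gt0.
- rewrite -scalemxAl -scalemxAr scalerA -invfM -expr2 sqr_sqrtr ?ltW//.
  by rewrite addrC subrK.
Qed.

End PSD.

(** * Limits in probability *)

Section EntrywiseConvergence.
Context {R : realType} {U : Type} (F : set_system U) {FF : Filter F}.

(** Entrywise and along an arbitrary filter, so that the same rules serve deterministic limits in n
    and limits in probability. *)
Definition mxcvg (m n : nat) (A : U -> 'M[R]_(m, n)) (L : 'M[R]_(m, n)) : Prop :=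
  forall i j, A x i j @[x --> F] --> L i j.

Lemma mxcvg_cst m n (L : 'M[R]_(m, n)) : mxcvg (fun=> L) L.
Proof. by move=> i j; exact: cvg_cst. Qed.

Lemma mxcvgD m n (A A' : U -> 'M[R]_(m, n)) L L' : mxcvg A L -> mxcvg A' L' ->
  mxcvg (fun x => A x + A' x) (L + L').
Proof.
by move=> AL AL' i j; under eq_cvg do rewrite mxE; rewrite mxE; exact: cvgD.
Qed.

Lemma mxcvgN m n (A : U -> 'M[R]_(m, n)) L : mxcvg A L -> mxcvg (fun x => - A x) (- L).
Proof. by move=> AL i j; under eq_cvg do rewrite mxE; rewrite mxE; exact: cvgN. Qed.

Lemma mxcvgB m n (A A' : U -> 'M[R]_(m, n)) L L' : mxcvg A L -> mxcvg A' L' ->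
  mxcvg (fun x => A x - A' x) (L - L').
Proof. by move=> AL AL'; apply: mxcvgD => //; exact: mxcvgN. Qed.

Lemma mxcvgM m n k (A : U -> 'M[R]_(m, n)) (A' : U -> 'M[R]_(n, k)) L L' :
  mxcvg A L -> mxcvg A' L' -> mxcvg (fun x => A x *m A' x) (L *m L').
Proof.
move=> AL AL' i j; under eq_cvg do rewrite mxE; rewrite mxE.
by apply: cvg_sumr => l; exact: cvgM.
Qed.

Lemma mxcvg_det n (A : U -> 'M[R]_n) L : mxcvg A L ->
  \det (A x) @[x --> F] --> \det L.
Proof.
move=> AL; apply: cvg_sumr => s; apply: cvgM; first exact: cvg_cst.
by apply: cvg_prodr => i; exact: AL.
Qed.

Lemma mxcvg_adj n (A : U -> 'M[R]_n) L : mxcvg A L ->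
  mxcvg (fun x => \adj (A x)) (\adj L).
Proof.
move=> AL i j; under eq_cvg do rewrite mxE; rewrite mxE.
apply: cvgM; first exact: cvg_cst.
by apply: mxcvg_det => k l; under eq_cvg do rewrite !mxE; rewrite !mxE; exact: AL.
Qed.

Lemma mxcvg_near_unit n (A : U -> 'M[R]_n) L : mxcvg A L -> L \in unitmx ->
  \forall x \near F, A x \in unitmx.
Proof.
move=> AL; rewrite unitmxE unitfE => dL.
have /cvgrPdist_lt := mxcvg_det AL.
move=> /(_ `|\det L|); rewrite normr_gt0 => /(_ dL); apply: filterS => x.
rewrite unitmxE unitfE => H; apply/negP => /eqP d0.
by move: H; rewrite d0 subr0 ltxx.
Qed.

(** By Cramer's rule, determinant and adjugate being polynomial in the entries. The formula for
    [invmx] holds only at invertible matrices, hence the detour through an eventual equality. *)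
Lemma mxcvgV n (A : U -> 'M[R]_n) L : mxcvg A L -> L \in unitmx ->
  mxcvg (fun x => invmx (A x)) (invmx L).
Proof.
move=> AL Lu i j.
have -> : (invmx L) i j = (\det L)^-1 * (\adj L) i j by rewrite /invmx Lu mxE.
have : (\det (A x))^-1 * (\adj (A x)) i j @[x --> F] --> (\det L)^-1 * (\adj L) i j.
  apply: cvgM; last exact: mxcvg_adj.
  by apply: cvgV; [move: Lu; rewrite unitmxE unitfE|exact: mxcvg_det].
apply: cvg_trans; apply: near_eq_cvg.
by move: (mxcvg_near_unit AL Lu); apply: filterS => x Ax; rewrite /invmx Ax !mxE.
Qed.

Lemma near_mxcvg m n (A A' : U -> 'M[R]_(m, n)) L :
  (\forall x \near F, A x = A' x) -> mxcvg A L -> mxcvg A' L.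
Proof.
move=> AA' AL i j; apply: cvg_trans (AL i j); apply: near_eq_cvg.
by move: AA'; apply: filterS => x ->.
Qed.

End EntrywiseConvergence.

(** * Measurability of random matrices *)

Section MeasurableMatrices.
Context {R : realType} {d : measure_display} {T : measurableType d}.

Definition mxmeas (m n : nat) (A : T -> 'M[R]_(m, n)) : Prop :=
  forall i j, measurable_fun setT (fun w => A w i j).

Lemma mxmeas_cst m n (L : 'M[R]_(m, n)) : mxmeas (fun=> L).
Proof. by move=> i j; exact: measurable_cst. Qed.

Lemma mxmeasD m n (A A' : T -> 'M[R]_(m, n)) : mxmeas A -> mxmeas A' ->
  mxmeas (fun w => A w + A' w).
Proof.
move=> mA mA' i j; under eq_fun do rewrite mxE.
exact: measurable_funD.
Qed.

Lemma mxmeasZ m n c (A : T -> 'M[R]_(m, n)) : mxmeas A -> mxmeas (fun w => c *: A w).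
Proof. by move=> mA i j; under eq_fun do rewrite mxE; exact: measurable_funM. Qed.

Lemma mxmeasB m n (A A' : T -> 'M[R]_(m, n)) : mxmeas A -> mxmeas A' ->
  mxmeas (fun w => A w - A' w).
Proof.
by move=> mA mA' i j; under eq_fun do rewrite !mxE; exact: measurable_funB.
Qed.

Lemma mxmeasT m n (A : T -> 'M[R]_(m, n)) : mxmeas A -> mxmeas (fun w => (A w)^T).
Proof. by move=> mA i j; under eq_fun do rewrite mxE; exact: mA. Qed.

Lemma mxmeasM m n k (A : T -> 'M[R]_(m, n)) (A' : T -> 'M[R]_(n, k)) :
  mxmeas A -> mxmeas A' -> mxmeas (fun w => A w *m A' w).
Proof.
move=> mA mA' i j; under eq_fun do rewrite mxE.
by apply: measurable_sum => l; exact: measurable_funM.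
Qed.

Lemma mxmeas_det n (A : T -> 'M[R]_n) : mxmeas A ->
  measurable_fun setT (fun w => \det (A w)).
Proof.
move=> mA; apply: measurable_sum => s; apply: measurable_funM => //.
by apply: measurable_prod => i _; exact: mA.
Qed.

(* x^-1 is the limit of x / (x^2 + 1 / (n + 1)), also at the junk value 0^-1 = 0. *)
Lemma measurable_inv : measurable_fun setT (fun x : R => x^-1).
Proof.
have pos n (x : R) : 0 < x ^+ 2 + n.+1%:R^-1 by rewrite ltr_wpDl ?sqr_ge0// invr_gt0.
apply: (@measurable_fun_cvg _ _ _ _ (fun n (x : R) => x / (x ^+ 2 + n.+1%:R^-1))).
  move=> n; apply: continuous_measurable_fun => x.
  apply: cvgM; first exact: cvg_id.
  apply: cvgV; first by rewrite gt_eqF.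
  by apply: cvgD; [exact: exprn_continuous|exact: cvg_cst].
move=> x _; have [->|x0] := eqVneq x 0.
  by rewrite invr0; under eq_cvg do rewrite mul0r; exact: cvg_cst.
rewrite (_ : x^-1 = x / (x ^+ 2 + 0)); last by rewrite addr0; field.
apply: cvgM; first exact: cvg_cst.
apply: cvgV; first by rewrite addr0 expf_neq0.
by apply: cvgD; [exact: cvg_cst|exact: cvg_harmonic].
Qed.

(** [invmx] returns a singular matrix unchanged, so measurability is checked on the two measurable
    pieces where the determinant is zero or not. *)
Lemma mxmeasV n (A : T -> 'M[R]_n) : mxmeas A -> mxmeas (fun w => invmx (A w)).
Proof.
move=> mA i j.
have mdet := mxmeas_det mA.
rewrite (_ : (fun w => _) = fun w => if \det (A w) == 0 then A w i j
    else (\det (A w))^-1 * (\adj (A w)) i j); last first.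
  apply/funext => w; rewrite /invmx unitmxE unitfE.
  by case: eqVneq => //= _; rewrite mxE.
apply: measurable_fun_ifT => //.
- exact: measurable_fun_eqr.
- apply: measurable_funM; first exact: (measurableT_comp measurable_inv).
  under eq_fun do rewrite mxE; apply: measurable_funM => //.
  by apply: mxmeas_det => k l; under eq_fun do rewrite !mxE; exact: mA.
Qed.

End MeasurableMatrices.

Section InProbability.
Context {R : realType} {d : measure_display} {T : measurableType d}.
Variable P : probability T R.

(* The filter of the events of (outer) probability tending to 1: its limits
   are the limits in probability. *)
Definition whp : set_system (nat * T) := [set S | forall e : R, 0 < e ->
  \forall n \near \oo, exists A, [/\ measurable A, (P A <= e%:E)%E &
    forall w, ~ A w -> S (n, w)]].

Global Instance whp_filter : Filter whp.
Proof.
split.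
- by move=> e e0; apply: nearW => n; exists set0; rewrite measure0 lee_fin ltW.
- move=> S S' HS HS' e e0; have e2 : 0 < e / 2 by rewrite divr_gt0.
  move: (HS _ e2) (HS' _ e2); apply: filterS2 => n [A [mA PA AS]] [A' [mA' PA' AS']].
  exists (A `|` A'); split; first exact: measurableU.
    rewrite (le_trans (measureU2 _ mA mA'))// [e]splitr EFinD.
    exact: leeD.
  by move=> w /not_orP[/AS ? /AS' ?]; split.
- move=> S S' SS' HS e e0; move: (HS e e0); apply: filterS => n [A [mA PA AS]].
  by exists A; split=> // w /AS /SS'.
Qed.

Lemma whp_near (Q : set nat) : (\forall n \near \oo, Q n) ->
  \forall x \near whp, Q x.1.
Proof.
move=> HQ e e0; move: HQ; apply: filterS => n Qn.
by exists set0; split=> //; rewrite measure0 lee_fin ltW.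
Qed.

Lemma whp_cvg_det (u : nat -> R) (l : R) : u n @[n --> \oo] --> l ->
  u x.1 @[x --> whp] --> l.
Proof.
move=> /cvgrPdist_le H; apply/cvgrPdist_le => e e0.
exact: (whp_near (H e e0)).
Qed.

(** Boundedness in probability. The bound L may depend on the level e, so this is weaker than being
    bounded by one constant along the filter [whp]. *)
Definition bounded_whp (f : nat * T -> R) : Prop := forall e : R, 0 < e ->
  exists2 L : R, 0 < L & \forall n \near \oo, exists A, [/\ measurable A,
    (P A <= e%:E)%E & forall w, ~ A w -> `|f (n, w)| <= L].

Lemma whp_bounded_cvg0 (f g : nat * T -> R) : bounded_whp f ->
  g x @[x --> whp] --> 0 -> f x * g x @[x --> whp] --> 0.
Proof.
move=> bf /cvgrPdist_le cg; apply/cvgrPdist_le => r r0 e e0.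
have e2 : 0 < e / 2 by rewrite divr_gt0.
have [L L0 HL] := bf _ e2.
have := cg _ (divr_gt0 r0 L0) _ e2.
move: HL; apply: filterS2 => n [A [mA PA Af]] [A' [mA' PA' Ag]].
exists (A `|` A'); split; first exact: measurableU.
  rewrite (le_trans (measureU2 _ mA mA'))// [e]splitr EFinD.
  exact: leeD.
move=> w /not_orP[/Af fL /Ag /=]; rewrite !sub0r !normrN normrM => gr.
rewrite -[r](divfK (lt0r_neq0 L0)) mulrC.
by rewrite ler_pM.
Qed.

Lemma bounded_whpD (f g : nat * T -> R) : bounded_whp f -> bounded_whp g ->
  bounded_whp (fun x => f x + g x).
Proof.
move=> bf bg e e0; have e2 : 0 < e / 2 by rewrite divr_gt0.
have [L L0 HL] := bf _ e2; have [L' L'0 HL'] := bg _ e2.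
exists (L + L'); first exact: addr_gt0.
move: HL HL'; apply: filterS2 => n [A [mA PA Af]] [A' [mA' PA' Ag]].
exists (A `|` A'); split; first exact: measurableU.
  rewrite (le_trans (measureU2 _ mA mA'))// [e]splitr EFinD.
  exact: leeD.
move=> w /not_orP[/Af fL /Ag gL].
by rewrite (le_trans (ler_normD _ _))// lerD.
Qed.

Lemma bounded_whpZ c (f : nat * T -> R) : bounded_whp f ->
  bounded_whp (fun x => c * f x).
Proof.
move=> bf e e0; have [L L0 HL] := bf _ e0.
have c0 : 0 < `|c| + 1 by rewrite ltr_wpDl.
exists ((`|c| + 1) * L); first exact: mulr_gt0.
move: HL; apply: filterS => n [A [mA PA Af]]; exists A; split=> // w /Af fL.
by rewrite normrM ler_pM// lerDl.
Qed.

Lemma bounded_whp0 : bounded_whp (fun=> 0).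
Proof.
move=> e e0; exists 1 => //; apply: nearW => n; exists set0; split=> //.
  by rewrite measure0 lee_fin ltW.
by rewrite normr0.
Qed.

Lemma bounded_whp_sum (I : Type) (s : seq I) (f : I -> nat * T -> R) :
  (forall i, bounded_whp (f i)) -> bounded_whp (fun x => \sum_(i <- s) f i x).
Proof.
move=> bf; elim: s => [|i s IHs].
  by under [X in bounded_whp X]eq_fun do rewrite big_nil; exact: bounded_whp0.
by under [X in bounded_whp X]eq_fun do rewrite big_cons; exact: (@bounded_whpD (f i) (fun x => \sum_(j <- s) f j x)).
Qed.

Lemma cvg0_bounded_whp (f : nat * T -> R) : f x @[x --> whp] --> 0 -> bounded_whp f.
Proof.
move=> /cvgrPdist_le/(_ 1 ltr01) H e e0; exists 1 => //.
move: (H _ e0); apply: filterS => n [A [mA PA Af]]; exists A; split=> // w /Af.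
by rewrite /= sub0r normrN.
Qed.

Lemma measurable_ge_norm (f : T -> R) L : measurable_fun setT f ->
  measurable [set w | (L <= `|f w|)%R].
Proof.
move=> mf; rewrite -[X in measurable X]setTI.
by apply: (measurable_fun_le (f := cst L)) => //; exact: measurableT_comp.
Qed.

Lemma L2_cvg0_whp (f : nat -> T -> R) : (forall n, sqint P (f n)) ->
  mean P (fun w => f n w ^+ 2) @[n --> \oo] --> 0 -> f x.1 x.2 @[x --> whp] --> 0.
Proof.
move=> sf /cvgrPdist_le cf; apply/cvgrPdist_le => r r0 e e0.
have r2 : 0 < r ^+ 2 by rewrite exprn_gt0.
have := cf _ (mulr_gt0 r2 e0); apply: filterS => n.
rewrite sub0r normrN => H; exists [set w | (r <= `|f n w|)%R]; split.
- by apply: measurable_ge_norm; case: (sf n).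
- rewrite (le_trans (markov_sqr r0 (sf n)))// lee_fin mulrC ler_pdivrMr//.
  by rewrite mulrC (le_trans (ler_norm _)).
- by move=> w /negP; rewrite -ltNge/= sub0r normrN => /ltW.
Qed.

Lemma L2_bounded_whp (f : nat -> T -> R) C : (forall n, sqint P (f n)) ->
  (\forall n \near \oo, mean P (fun w => f n w ^+ 2) <= C) ->
  bounded_whp (fun x => f x.1 x.2).
Proof.
move=> sf fC e e0; pose L := Num.sqrt ((`|C| + 1) / e).
have C0 : 0 < `|C| + 1 by rewrite ltr_wpDl.
have L0 : 0 < L by rewrite sqrtr_gt0 divr_gt0.
have L2 : L ^+ 2 = (`|C| + 1) / e by rewrite sqr_sqrtr// ltW// divr_gt0.
exists L => //; move: fC; apply: filterS => n fC.
exists [set w | (L <= `|f n w|)%R]; split.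
- by apply: measurable_ge_norm; case: (sf n).
- rewrite (le_trans (markov_sqr L0 (sf n)))// lee_fin L2 invf_div mulrAC.
  rewrite ler_pdivrMr// ler_wpM2l//; first exact: ltW.
  apply: le_trans fC _.
  by rewrite (le_trans (ler_norm C))// lerDl.
- by move=> w /negP; rewrite -ltNge/= => /ltW.
Qed.

Lemma norm_cosB_le (x y : R) : `|cos x - cos y| <= `|x - y|.
Proof.
wlog xy : x y / y <= x.
  by move=> H; have [/H//|/ltW/H] := leP y x; rewrite distrC [leRHS]distrC.
have dcos z : z \in `]y, x[ -> is_derive z (1 : R) cos (- sin z).
  by move=> _; exact: is_derive_cos.
have ccos : {within `[y, x], continuous (@cos R)}.
  by apply: continuous_subspaceT; exact: continuous_cos.
have [c _ E] := MVT_segment xy dcos ccos.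
by rewrite E normrM normrN ler_piMl// ler_norml sin_geN1 sin_le1.
Qed.

(** The cosine is 1-Lipschitz and bounded: outside an event of probability at most e / 4 the two
    cosines differ by at most e / 4, and on it by at most 2. The total e / 4 + 2 (e / 4) leaves e /
    4 for the convergence of g. *)
Lemma mean_cos_close (f g : nat -> T -> R) (l : R) :
  (forall n, measurable_fun setT (f n)) -> (forall n, measurable_fun setT (g n)) ->
  f x.1 x.2 - g x.1 x.2 @[x --> whp] --> 0 ->
  mean P (fun w => cos (g n w)) @[n --> \oo] --> l ->
  mean P (fun w => cos (f n w)) @[n --> \oo] --> l.
Proof.
move=> mf mg /cvgrPdist_le fg /cvgrPdist_le gl; apply/cvgrPdist_le => e e0.
have e4 : 0 < e / 4 by rewrite divr_gt0.
have := fg _ e4 _ e4; move: (gl _ e4); apply: filterS2 => n Hn [A [mA PA HA]].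
have [iA mAE] := mean_indic P mA.
have ii : integ P (fun w => e / 4 + 2 * \1_A w).
  by apply: integD; [exact: integ_cst|exact: integZ].
have : `|mean P (fun w => cos (f n w)) - mean P (fun w => cos (g n w))| <=
    mean P (fun w => e / 4 + 2 * \1_A w).
  apply: mean_dist => //; [exact: integ_cos|exact: integ_cos|] => w.
  rewrite indicE; case: (pselect (A w)) => Aw.
    rewrite mem_set// mulr1 (le_trans (ler_normB _ _))//.
    have := norm_cos_le1 (f n w); have := norm_cos_le1 (g n w); lra.
  rewrite memNset// mulr0 addr0 (le_trans (norm_cosB_le _ _))//.
  by have := HA w Aw; rewrite /= sub0r normrN.
rewrite meanD; [|exact: integ_cst|exact: integZ]; rewrite (meanZ 2 iA) mean_cst.
have : mean P (\1_A : T -> R) <= e / 4 by rewrite -lee_fin mAE.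
by move: Hn; rewrite !ler_norml => /andP[? ?] ? /andP[? ?]; apply/andP; split; lra.
Qed.

End InProbability.

(** * Asymptotic equivalence in mean square *)

Section SquareIntegrableLimits.
Context {R : realType} {d : measure_display} {T : measurableType d}.
Variable P : probability T R.
Implicit Types F G : nat -> T -> R.

Definition L2_bounded G : Prop := (forall n, sqint P (G n)) /\
  exists C, \forall n \near \oo, mean P (fun w => G n w ^+ 2) <= C.

Definition L2_null F : Prop := (forall n, sqint P (F n)) /\
  mean P (fun w => F n w ^+ 2) @[n --> \oo] --> 0.

(** The bound on G belongs to the definition because it makes second moments transferable: products
    of close sequences have close means, which mere closeness in probability would not give. *)
Definition L2_close F G : Prop :=
  L2_bounded G /\ L2_null (fun n w => F n w - G n w).

Lemma mean_sqr_ge0 (f : T -> R) : 0 <= mean P (fun w => f w ^+ 2).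
Proof. by apply: mean_ge0 => w; exact: sqr_ge0. Qed.

Lemma L2_boundedD F G : L2_bounded F -> L2_bounded G ->
  L2_bounded (fun n w => F n w + G n w).
Proof.
move=> [sF [C HC]] [sG [C' HC']]; split; first by move=> n; exact: sqintD.
exists (2 * (C + C')); move: HC HC'; apply: filterS2 => n h h'.
by rewrite (le_trans (mean_sqrD_le (sF n) (sG n)))// ler_wpM2l// lerD.
Qed.

Lemma L2_nullD F G : L2_null F -> L2_null G -> L2_null (fun n w => F n w + G n w).
Proof.
move=> [sF F0] [sG G0]; split; first by move=> n; exact: sqintD.
have H : 2 * (mean P (fun w => F n w ^+ 2) + mean P (fun w => G n w ^+ 2))
    @[n --> \oo] --> (0 : R).
  rewrite (_ : 0 = 2 * (0 + 0)); last by rewrite addr0 mulr0.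
  by apply: cvgM; [exact: cvg_cst|exact: cvgD].
apply: (squeeze_cvgr _ (cvg_cst 0) H); apply: nearW => n.
by rewrite mean_sqr_ge0 mean_sqrD_le.
Qed.

Lemma L2_boundedZ (c : nat -> R) (l : R) G : c n @[n --> \oo] --> l -> L2_bounded G ->
  L2_bounded (fun n w => c n * G n w).
Proof.
move=> cl [sG [C HC]]; split; first by move=> n; exact: sqintZ.
exists (((`|l| + 1) ^+ 2) * C).
move/cvgrPdist_le : cl => /(_ 1 ltr01); move: HC; apply: filterS2 => n h cln.
have cn : `|c n| <= `|l| + 1.
  rewrite -[c n](subrK l) addrC (le_trans (ler_normD _ _))// lerD2l.
  by rewrite distrC.
under eq_mean do rewrite exprMn; rewrite meanZ; last by case: (sG n).
apply: ler_pM => //; [exact: sqr_ge0|exact: mean_sqr_ge0|].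
by rewrite -[c n ^+ 2]real_normK ?num_real// ler_sqr ?nnegrE// addr_ge0.
Qed.

Lemma L2_nullZ (c : nat -> R) (l : R) F : c n @[n --> \oo] --> l -> L2_null F ->
  L2_null (fun n w => c n * F n w).
Proof.
move=> cl [sF F0]; split; first by move=> n; exact: sqintZ.
rewrite (_ : 0 = l ^+ 2 * 0); last by rewrite mulr0.
have E n : mean P (fun w => (c n * F n w) ^+ 2) = c n ^+ 2 * mean P (fun w => F n w ^+ 2).
  by under eq_mean do rewrite exprMn; rewrite meanZ//; case: (sF n).
under eq_cvg do rewrite E; apply: cvgM => //.
by under eq_cvg do rewrite expr2; rewrite expr2; exact: cvgM.
Qed.

Lemma L2_bounded_null (c : nat -> R) G : c n @[n --> \oo] --> (0 : R) ->
  L2_bounded G -> L2_null (fun n w => c n * G n w).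
Proof.
move=> c0 [sG [C HC]]; split; first by move=> n; exact: sqintZ.
have H : c n ^+ 2 * C @[n --> \oo] --> (0 : R).
  rewrite (_ : 0 = 0 * 0 * C); last by rewrite !mul0r.
  apply: cvgM; last exact: cvg_cst.
  by under eq_cvg do rewrite expr2; exact: cvgM.
apply: (squeeze_cvgr _ (cvg_cst 0) H); move: HC; apply: filterS => n h.
rewrite mean_sqr_ge0/=; under eq_mean do rewrite exprMn.
by rewrite meanZ ?ler_wpM2l ?sqr_ge0//; case: (sG n).
Qed.

Lemma L2_close_sqint F G : L2_close F G -> forall n, sqint P (F n).
Proof.
move=> [[sG _] [sFG _]] n.
rewrite (_ : F n = fun w => (F n w - G n w) + G n w); first exact: sqintD.
by apply/funext => w; rewrite subrK.
Qed.

Lemma L2_closeD F G F' G' : L2_close F G -> L2_close F' G' ->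
  L2_close (fun n w => F n w + F' n w) (fun n w => G n w + G' n w).
Proof.
move=> [bG nF] [bG' nF']; split; first exact: L2_boundedD.
rewrite (_ : (fun n w => _) = fun n w => (F n w - G n w) + (F' n w - G' n w)).
  exact: L2_nullD.
by apply/funext => n; apply/funext => w; rewrite opprD addrACA.
Qed.

Lemma L2_closeZ (c : nat -> R) (l : R) F G : c n @[n --> \oo] --> l -> L2_close F G ->
  L2_close (fun n w => c n * F n w) (fun n w => l * G n w).
Proof.
move=> cl [bG nF]; split; first exact: (L2_boundedZ (cvg_cst l) bG).
rewrite (_ : (fun n w => _) = fun n w =>
  c n * (F n w - G n w) + (c n - l) * G n w).
  apply: L2_nullD; first exact: L2_nullZ cl nF.
  apply: L2_bounded_null => //; rewrite -(subrr l).
  by apply: cvgB => //; exact: cvg_cst.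
by apply/funext => n; apply/funext => w; ring.
Qed.

Lemma L2_close_refl G : L2_bounded G -> L2_close G G.
Proof.
move=> bG; split=> //; rewrite (_ : (fun n w => _) = fun _ _ => 0).
  split; first by move=> n; exact: sqint_cst.
  rewrite (_ : (fun=> _) = fun=> 0); first exact: cvg_cst.
  by apply/funext => n; under eq_mean do rewrite expr0n; rewrite mean_cst.
by apply/funext => n; apply/funext => w; rewrite subrr.
Qed.

Lemma L2_close_sum (I : Type) (s : seq I) (F G : I -> nat -> T -> R) :
  (forall i, L2_close (F i) (G i)) ->
  L2_close (fun n w => \sum_(i <- s) F i n w) (fun n w => \sum_(i <- s) G i n w).
Proof.
move=> FG; elim: s => [|i s IHs].
  have E (H : I -> nat -> T -> R) :
      (fun n w => \sum_(i <- [::]) H i n w) = (fun=> fun=> 0).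
    by apply/funext => n; apply/funext => w; rewrite big_nil.
  rewrite !E.
  apply: L2_close_refl; split; first by move=> n; exact: sqint_cst.
  by exists 0; apply: nearW => n; under eq_mean do rewrite expr0n; rewrite mean_cst.
rewrite (_ : (fun n w => \sum_(j <- i :: s) F j n w) =
    fun n w => F i n w + \sum_(j <- s) F j n w); last first.
  by apply/funext => n; apply/funext => w; rewrite big_cons.
rewrite (_ : (fun n w => \sum_(j <- i :: s) G j n w) =
    fun n w => G i n w + \sum_(j <- s) G j n w); last first.
  by apply/funext => n; apply/funext => w; rewrite big_cons.
exact: (@L2_closeD (F i) (G i)).
Qed.

Lemma L2_null_mul F G : L2_null F -> L2_bounded G ->
  mean P (fun w => F n w * G n w) @[n --> \oo] --> 0.
Proof.
move=> [sF F0] [sG [C HC]]; apply/cvgrPdist_le => e e0.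
have C0 : 0 < `|C| + 1 by rewrite ltr_wpDl.
(* The weight for which the bounded factor contributes at most e / 2; the null factor is then
   required to have second moment at most e / (2 k). *)
pose k := 2 * (`|C| + 1) / e.
have k0 : 0 < k by rewrite divr_gt0// mulr_gt0.
have ek : 0 < e / (2 * k) by rewrite divr_gt0// mulr_gt0.
move/cvgrPdist_le : F0 => /(_ _ ek); move: HC; apply: filterS2 => n GC.
rewrite !sub0r !normrN ger0_norm ?mean_sqr_ge0// => Fn.
rewrite (le_trans (mean_mul_le k0 (sF n) (sG n)))// [leRHS]splitr lerD//.
  rewrite -(ler_pdivlMl _ _ k0) (le_trans Fn)//.
  by rewrite le_eqVlt; apply/orP; left; apply/eqP; field; rewrite gt_eqF// gt_eqF.
rewrite mulrC ler_pdivrMr// /k (_ : e / 2 * (2 * (`|C| + 1) / e) = `|C| + 1).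
  by rewrite (le_trans GC)// (le_trans (ler_norm C))// lerDl.
by field; rewrite gt_eqF.
Qed.

Lemma L2_null_bounded F : L2_null F -> L2_bounded F.
Proof.
move=> [sF F0]; split=> //; exists 1.
move/cvgrPdist_le : F0 => /(_ _ ltr01); apply: filterS => n.
by rewrite sub0r normrN; exact: le_trans (ler_norm _).
Qed.

Lemma L2_close_bounded F G : L2_close F G -> L2_bounded F.
Proof.
move=> [bG nF]; rewrite (_ : F = fun n w => G n w + (F n w - G n w)).
  by apply: L2_boundedD => //; exact: L2_null_bounded.
by apply/funext => n; apply/funext => w; rewrite addrC subrK.
Qed.

Lemma L2_close_mul F G F' G' (l : R) : L2_close F G -> L2_close F' G' ->
  mean P (fun w => G n w * G' n w) @[n --> \oo] --> l ->
  mean P (fun w => F n w * F' n w) @[n --> \oo] --> l.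
Proof.
move=> FG FG' Gl; have sF := L2_close_sqint FG; have sF' := L2_close_sqint FG'.
move: FG FG' => [bG nF] [bG' nF'].
have [sG _] := bG; have [sG' _] := bG'.
have [sD _] := nF; have [sD' _] := nF'.
have E n : mean P (fun w => F n w * F' n w) = mean P (fun w => G n w * G' n w) +
    (mean P (fun w => (F n w - G n w) * G' n w) +
    (mean P (fun w => (F' n w - G' n w) * G n w) +
     mean P (fun w => (F n w - G n w) * (F' n w - G' n w)))).
  rewrite -!meanD; try (by apply: eq_mean => w; ring);
    repeat (apply: integD || exact: sqint_mul).
under eq_cvg do rewrite E.
rewrite -[l]addr0; apply: cvgD => //; rewrite -[0]addr0.
apply: cvgD; first exact: L2_null_mul.
rewrite -[0]addr0; apply: cvgD; first exact: L2_null_mul.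
by apply: L2_null_mul => //; exact: L2_null_bounded.
Qed.

End SquareIntegrableLimits.

(** * Sequences satisfying Lindeberg's condition *)

Section LindebergClass.
Context {R : realType} {d : measure_display} {T : measurableType d}.
Variable P : probability T R.
Implicit Types f g : nat -> T -> R.

Definition lindeberg_class f : Prop := (forall i, sqint P (f i)) /\ lindeberg P f.

Lemma gauge_mono h (x y : R) : 0 <= h -> `|x| <= `|y| -> gauge h x <= gauge h y.
Proof.
move=> h0 xy; rewrite /gauge ler_pM//; first exact: sqr_ge0.
- by rewrite le_min ler01 mulr_ge0.
- by rewrite -[x ^+ 2]real_normK ?num_real// -[y ^+ 2]real_normK ?num_real// ler_sqr ?nnegrE.
- by rewrite le_min !ge_min lexx/= [X in _ || X]ler_wpM2l// orbT.
Qed.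

Lemma gaugeZ h c (x : R) : 0 <= h ->
  gauge h (c * x) <= c ^+ 2 * (1 + `|c|) * gauge h x.
Proof.
move=> h0; rewrite /gauge exprMn.
have -> : c ^+ 2 * (1 + `|c|) * (x ^+ 2 * Num.min 1 (h * `|x|)) =
  c ^+ 2 * x ^+ 2 * ((1 + `|c|) * Num.min 1 (h * `|x|)) by ring.
rewrite ler_wpM2l//; first by apply: mulr_ge0; exact: sqr_ge0.
have hx : 0 <= h * `|x| by rewrite mulr_ge0.
rewrite normrM mulrCA; move: (h * `|x|) hx => z z0.
have := normr_ge0 c; move: `|c| => k k0.
have [z1|z1] := leP 1 z; first by rewrite ge_min; apply/orP; left; lra.
by rewrite ge_min; apply/orP; right; nra.
Qed.

(** A sum is at most twice its larger term in absolute value, and scaling by 2 costs 2^2 (1 + 2) =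
    12. *)
Lemma gaugeD h (x y : R) : 0 <= h ->
  gauge h (x + y) <= 12 * (gauge h x + gauge h y).
Proof.
move=> h0; wlog xy : x y / `|x| <= `|y|.
  move=> H; have [/H//|/ltW/H] := leP `|x| `|y|.
  by rewrite addrC [gauge h x + _]addrC.
apply: (@le_trans _ _ (gauge h (2 * y))).
  apply: gauge_mono => //; rewrite (le_trans (ler_normD _ _))// normrM.
  by rewrite ger0_norm// mulr_natl mulr2n lerD2r.
rewrite (le_trans (gaugeZ _ _ h0))// ger0_norm//.
have := gauge_ge0 x h0; have := gauge_ge0 y h0; lra.
Qed.

Lemma lindeberg_classD f g : lindeberg_class f -> lindeberg_class g ->
  lindeberg_class (fun i w => f i w + g i w).
Proof.
move=> [sf Lf] [sg Lg]; split; first by move=> i; exact: sqintD.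
move=> e e0; have e24 : 0 < e / 24 by rewrite divr_gt0.
move: (Lf _ e24) (Lg _ e24); apply: filterS2 => n fn gn i.
have h0 : 0 <= (Num.sqrt n%:R : R)^-1 by rewrite invr_ge0 sqrtr_ge0.
have fi := integ_gauge h0 (sf i); have gi := integ_gauge h0 (sg i).
apply: (@le_trans _ _ (mean P (fun w => 12 * (gauge (Num.sqrt n%:R)^-1 (f i w) +
    gauge (Num.sqrt n%:R)^-1 (g i w))))).
  apply: mean_le; [exact: integ_gauge h0 (sqintD (sf i) (sg i))| |].
    by apply: integZ; exact: integD.
  by move=> w; exact: gaugeD.
rewrite meanZ; last exact: integD.
by rewrite meanD//; have := fn i; have := gn i; lra.
Qed.

Lemma lindeberg_classZ c f : lindeberg_class f -> lindeberg_class (fun i w => c * f i w).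
Proof.
move=> [sf Lf]; split; first by move=> i; exact: sqintZ.
move=> e e0; pose k := c ^+ 2 * (1 + `|c|) + 1.
have k1 : 0 <= c ^+ 2 * (1 + `|c|) by rewrite mulr_ge0 ?sqr_ge0// addr_ge0.
have k0 : 0 < k by rewrite ltr_wpDl.
move: (Lf _ (divr_gt0 e0 k0)); apply: filterS => n fn i.
have h0 : 0 <= (Num.sqrt n%:R : R)^-1 by rewrite invr_ge0 sqrtr_ge0.
have fi := integ_gauge h0 (sf i).
apply: (@le_trans _ _ (mean P (fun w => (c ^+ 2 * (1 + `|c|)) *
    gauge (Num.sqrt n%:R)^-1 (f i w)))).
  apply: mean_le; [exact: integ_gauge h0 (sqintZ c (sf i))|exact: integZ|].
  by move=> w; exact: gaugeZ.
rewrite meanZ// -[leRHS](divfK (lt0r_neq0 k0)) mulrC ler_pM//.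
- by apply: mean_ge0 => w; exact: gauge_ge0.
- by rewrite /k lerDl.
Qed.

Lemma lindeberg_class_sum (I : Type) (s : seq I) (f : I -> nat -> T -> R) :
  lindeberg_class (fun _ _ => 0) ->
  (forall j, lindeberg_class (f j)) ->
  lindeberg_class (fun i w => \sum_(j <- s) f j i w).
Proof.
move=> L0 Lf; elim: s => [|j s IHs].
  rewrite (_ : (fun i w => _) = fun _ _ => 0)//.
  by apply/funext => i; apply/funext => w; rewrite big_nil.
rewrite (_ : (fun i w => _) = fun i w => f j i w + \sum_(k <- s) f k i w); last first.
  by apply/funext => i; apply/funext => w; rewrite big_cons.
exact: lindeberg_classD.
Qed.

Lemma cvg_invsqrt : (Num.sqrt n%:R : R)^-1 @[n --> \oo] --> (0 : R).
Proof.
apply/cvgrPdist_le => e e0.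
have e2 : 0 < e ^+ 2 by rewrite exprn_gt0.
have := nbhs_infty_gtr (e ^- 2); apply: filterS => n ne.
rewrite sub0r normrN ger0_norm ?invr_ge0 ?sqrtr_ge0//.
have n0 : 0 < n%:R :> R by apply: lt_trans ne; rewrite invr_gt0.
rewrite -[leRHS]invrK lef_pV2 ?posrE ?sqrtr_gt0 ?invr_gt0//.
rewrite -ler_sqr ?nnegrE ?sqrtr_ge0 ?invr_ge0 ?(ltW e0)//.
by rewrite sqr_sqrtr ?ler0n// exprVn ltW.
Qed.

(** Since h |z|^3 <= h (1 + z^4), the mean gauge is at most h (1 + C) uniformly in the index. No
    common law is required. *)
Lemma lindeberg_class4 f C : (forall i, sqint P (f i)) ->
  (forall i, integ P (fun w => f i w ^+ 4)) ->
  (forall i, mean P (fun w => f i w ^+ 4) <= C) -> lindeberg_class f.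
Proof.
move=> sf f4 fC; split=> // e e0.
have C0 : 0 < `|C| + 1 by rewrite ltr_wpDl.
have eC : 0 < e / (`|C| + 1) by rewrite divr_gt0.
move/cvgrPdist_le : cvg_invsqrt => /(_ _ eC); apply: filterS => n.
have h0 : 0 <= (Num.sqrt n%:R : R)^-1 by rewrite invr_ge0 sqrtr_ge0.
rewrite sub0r normrN ger0_norm// => hn i.
set h := (Num.sqrt n%:R)^-1 in h0 hn *.
have hi : integ P (fun w => h * (1 + f i w ^+ 4)).
  by apply: integZ; apply: integD => //; exact: integ_cst.
apply: (@le_trans _ _ (mean P (fun w => h * (1 + f i w ^+ 4)))).
  apply: mean_le => //; first exact: integ_gauge.
  move=> w; rewrite (le_trans (gauge_le_cube _ _))// ler_wpM2l//.
  have -> : f i w ^+ 4 = (`|f i w| ^+ 2) ^+ 2.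
    by rewrite real_normK ?num_real//; ring.
  move: `|f i w| (normr_ge0 (f i w)) => z z0.
  have zy : 2 * z <= 1 + z ^+ 2 by have := sqr_ge0 (z - 1); lra.
  by rewrite exprSr; move: (z ^+ 2) (sqr_ge0 z) zy => y y0 zy; nra.
rewrite meanZ; last by apply: integD => //; exact: integ_cst.
rewrite meanD//; last exact: integ_cst.
rewrite mean_cst -[leRHS](divfK (lt0r_neq0 C0)) ler_pM//.
  rewrite addr_ge0//; apply: mean_ge0 => w.
  by rewrite (_ : _ ^+ 4 = (f i w ^+ 2) ^+ 2) ?sqr_ge0//; ring.
by rewrite addrC lerD2r (le_trans (fC i))// ler_norm.
Qed.

Lemma lindeberg_class_cst c : lindeberg_class (fun _ _ => c).
Proof.
apply: (@lindeberg_class4 _ (c ^+ 4)) => i.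
- exact: sqint_cst.
- exact: integ_cst.
- by rewrite mean_cst.
Qed.

(** The mean gauge depends only on the law, so uniformity in i reduces to i = 0. There the gauge
    tends to 0 pointwise and is dominated by the square: a second moment of g(X) is enough. *)
Lemma lindeberg_class_same_law (g : R -> R) (X : nat -> {RV P >-> R}) :
  measurable_fun setT g -> (forall i j, same_law (X i) (X j)) ->
  (forall i, sqint P (g \o X i)) -> lindeberg_class (fun i w => g (X i w)).
Proof.
move=> mg XX sgX; split=> // e e0.
have gE h i : 0 <= h -> mean P (fun w => gauge h (g (X i w))) =
    mean P (fun w => gauge h (g (X 0%N w))).
  move=> h0; rewrite /mean /Rintegral.
  have mgg : measurable_fun setT (fun x => (gauge h (g x))%:E).
    by apply/measurable_EFinP; apply: (measurableT_comp (measurable_gauge h)).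
  have gg0 y : (0 <= (gauge h (g y))%:E)%E by rewrite lee_fin gauge_ge0.
  have := ge0_integral_distribution (X i) mgg gg0.
  rewrite [X in _ = X -> _](_ : _ = \int[P]_w (gauge h (g (X i w)))%:E)%E// => <-.
  have := ge0_integral_distribution (X 0%N) mgg gg0.
  rewrite [X in _ = X -> _](_ : _ = \int[P]_w (gauge h (g (X 0%N w)))%:E)%E// => <-.
  by congr fine; apply: eq_measure_integral => A mA _; exact: XX.
have : mean P (fun w => gauge (Num.sqrt n%:R)^-1 (g (X 0%N w))) @[n --> \oo] --> mean P (cst 0).
  apply: (cvg_mean_dominated (g := fun w => g (X 0%N w) ^+ 2)).
  - move=> n; apply: (measurableT_comp (measurable_gauge _)).
    by case: (sgX 0%N).
  - exact: measurable_cst.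
  - move=> w; have H : (Num.sqrt n%:R)^-1 * `|g (X 0%N w)| ^+ 3 @[n --> \oo] --> 0.
      by rewrite -[0](mul0r (`|g (X 0%N w)| ^+ 3)); apply: cvgM; [exact: cvg_invsqrt|exact: cvg_cst].
    apply: (squeeze_cvgr _ (cvg_cst 0) H); apply: nearW => n.
    by rewrite gauge_ge0 ?invr_ge0 ?sqrtr_ge0// gauge_le_cube.
  - by case: (sgX 0%N).
  - move=> n w; rewrite ger0_norm ?gauge_ge0 ?invr_ge0 ?sqrtr_ge0//.
    exact: gauge_le_sqr.
rewrite mean_cst => /cvgrPdist_le/(_ _ e0); apply: filterS => n.
rewrite sub0r normrN => H i; rewrite gE ?invr_ge0 ?sqrtr_ge0//.
exact: le_trans (ler_norm _) H.
Qed.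

End LindebergClass.

(** * Normalised sums of polynomials in the rows of the noise *)

Section RowPolynomials.
Context {R : realType} {K : finType}.
Implicit Types f g : (K -> R) -> R.

Definition monomial (a : {ffun K -> nat}) (v : K -> R) : R := \prod_k v k ^+ a k.

(** A function with some presentation by monomials of total degree at most D. Degree 2 is the bound
    for the summands, so that their pairwise products stay within the four available moments. *)
Definition polyfun (D : nat) f : Prop := exists s : seq (R * {ffun K -> nat}),
  (forall c, c \in s -> (\sum_k c.2 k <= D)%N) /\
  f = fun v => \sum_(c <- s) c.1 * monomial c.2 v.

Lemma polyfun_cst c D : polyfun D (fun=> c).
Proof.
exists [:: (c, [ffun=> 0%N])]; split.
  by move=> a; rewrite inE => /eqP ->; rewrite big1// => k _; rewrite ffunE.
apply/funext => v; rewrite big_seq1/= /monomial big1 ?mulr1// => k _.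
by rewrite ffunE.
Qed.

Lemma polyfun_var k D : (0 < D)%N -> polyfun D (fun v => v k).
Proof.
move=> D0; exists [:: (1, [ffun j => (j == k) : nat])]; split.
  move=> a; rewrite inE => /eqP -> /=; rewrite (bigD1 k)//= ffunE eqxx.
  by rewrite big1 ?addn0// => j jk; rewrite ffunE (negbTE jk).
apply/funext => v; rewrite big_seq1/= /monomial mul1r (bigD1 k)//= ffunE eqxx.
by rewrite big1 ?mulr1// => j jk; rewrite ffunE (negbTE jk).
Qed.

Lemma polyfunD D f g : polyfun D f -> polyfun D g -> polyfun D (fun v => f v + g v).
Proof.
move=> [s [sD ->]] [s' [sD' ->]]; exists (s ++ s'); split.
  by move=> c; rewrite mem_cat => /orP[/sD|/sD'].
by apply/funext => v; rewrite big_cat.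
Qed.

Lemma polyfunM D D' f g : polyfun D f -> polyfun D' g ->
  polyfun (D + D') (fun v => f v * g v).
Proof.
move=> [s [sD ->]] [s' [sD' ->]].
pose F (c c' : R * {ffun K -> nat}) : R * {ffun K -> nat} :=
  (c.1 * c'.1, [ffun k => (c.2 k + c'.2 k)%N]).
exists [seq F c c' | c <- s, c' <- s']; split.
  move=> _ /allpairsP[[c c'] /= [cs c's' ->]] /=.
  under eq_bigr do rewrite ffunE.
  by rewrite big_split/= leq_add ?sD ?sD'.
apply/funext => v; rewrite big_allpairs_dep mulr_suml; apply: eq_bigr => c _.
rewrite mulr_sumr; apply: eq_bigr => c' _ /=.
rewrite mulrACA; congr (_ * _); rewrite /monomial -big_split/=.
by apply: eq_bigr => k _; rewrite ffunE exprD.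
Qed.

Lemma polyfunZ D c f : polyfun D f -> polyfun D (fun v => c * f v).
Proof. by move=> pf; apply: (@polyfunM 0 D (fun=> c)) => //; exact: polyfun_cst. Qed.

Lemma polyfun_sum D (I : Type) (s : seq I) (f : I -> (K -> R) -> R) :
  (forall i, polyfun D (f i)) -> polyfun D (fun v => \sum_(i <- s) f i v).
Proof.
move=> pf; elim: s => [|i s IHs].
  rewrite (_ : (fun v => _) = fun=> 0); first exact: polyfun_cst.
  by apply/funext => v; rewrite big_nil.
rewrite (_ : (fun v => _) = fun v => f i v + \sum_(j <- s) f j v).
  exact: polyfunD.
by apply/funext => v; rewrite big_cons.
Qed.

End RowPolynomials.

Section RowSums.
Context {R : realType} {d : measure_display} {T : measurableType d}.
Variable P : probability T R.
Variables (K : finType) (X : nat * K -> T -> R) (mom : K -> nat -> R).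
Hypothesis mX : forall i, measurable_fun setT (X i).
Hypothesis indX : independent_RVs P X.
(* The first four moments do not depend on the row; the laws may. *)
Hypothesis momX : forall i k a, (a <= 4)%N ->
  integ P (fun w => X (i, k) w ^+ a) /\ mean P (fun w => X (i, k) w ^+ a) = mom k a.
Implicit Types f g : (K -> R) -> R.

Definition row_at (i : nat) f (w : T) : R := f (fun k => X (i, k) w).

Lemma mean_monomial i (a : {ffun K -> nat}) : (\sum_k a k <= 4)%N ->
  integ P (row_at i (monomial a)) /\
  mean P (row_at i (monomial a)) = \prod_k mom k (a k).
Proof.
move=> a4; have ak k : (a k <= 4)%N.
  by apply: leq_trans a4; rewrite (bigD1 k)//= leq_addr.
pose s := [seq (i, k) | k <- index_enum K].
have us : uniq s by rewrite map_inj_uniq ?index_enum_uniq// => k k' [].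
have [||si sE] := @mean_prod _ _ _ P _ X mX indX s (fun ik x => x ^+ a ik.2) us.
- by move=> ik; exact: exprn_measurable.
- by move=> [j k] /mapP[k' _ [-> ->]]; case: (momX i k' (ak k')).
have E : row_at i (monomial a) = fun w => \prod_(ik <- s) X ik w ^+ a ik.2.
  by apply/funext => w; rewrite /row_at /monomial big_map.
rewrite E; split=> //; rewrite sE big_map; apply: eq_bigr => k _ /=.
by case: (momX i k (ak k)).
Qed.

(** By independence within a row, the mean of a monomial is a product of moments of order at most
    four, and these are the same on all rows even where the laws are not. *)
Lemma polyfun_mean D f i j : (D <= 4)%N -> polyfun D f ->
  integ P (row_at i f) /\ mean P (row_at i f) = mean P (row_at j f).
Proof.
move=> D4 [s [sD ->]].
have H l : integ P (row_at l (fun v => \sum_(c <- s) c.1 * monomial c.2 v)) /\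
    mean P (row_at l (fun v => \sum_(c <- s) c.1 * monomial c.2 v)) =
    \sum_(c <- s) c.1 * \prod_k mom k (c.2 k).
  elim: s sD => [|c s IHs] sD.
    rewrite (_ : row_at _ _ = cst 0); first by rewrite mean_cst big_nil; split=> //; exact: integ_cst.
    by apply/funext => w; rewrite /row_at big_nil.
  have [|IHi IHE] := IHs; first by move=> c' c's; apply: sD; rewrite inE c's orbT.
  have [|mi mE] := @mean_monomial l c.2.
    by apply: leq_trans D4; apply: sD; rewrite inE eqxx.
  rewrite (_ : row_at _ _ = fun w => c.1 * row_at l (monomial c.2) w +
      row_at l (fun v => \sum_(c <- s) c.1 * monomial c.2 v) w); last first.
    by apply/funext => w; rewrite /row_at big_cons.
  split; first by apply: integD => //; exact: integZ.
  by rewrite meanD ?meanZ ?mE ?IHE ?big_cons//; exact: integZ.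
by have [Hi ->] := H i; have [_ ->] := H j.
Qed.

Lemma row_at_measurable_on D f i : polyfun D f ->
  measurable_on X [set ij | ij.1 = i] (row_at i f).
Proof.
move=> [s [_ ->]]; apply: measurable_sum => c; apply: measurable_funM => //.
apply: measurable_prod => k _; apply: measurable_funX.
exact: measurable_onX.
Qed.

Lemma row_at_sqint f i : polyfun 2 f -> sqint P (row_at i f).
Proof.
move=> pf; split.
  exact: (measurable_on_measurable mX (@row_at_measurable_on _ _ i pf)).
have [|] := @polyfun_mean (2 + 2) (fun v => f v * f v) i i isT.
  exact: polyfunM.
by move=> + _; congr (integ P _); apply/funext => w; rewrite /row_at expr2.
Qed.

Lemma mean_row_mul f g i j : i != j -> polyfun 2 f -> polyfun 2 g ->
  mean P (row_at 0 f) = 0 -> mean P (fun w => row_at i f w * row_at j g w) = 0.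
Proof.
move=> ij pf pg f0.
have disj : [set ij : nat * K | ij.1 = i] `&` [set ij | ij.1 = j] = set0.
  by apply/seteqP; split=> // -[a b] /= [ai aj]; move: ij; rewrite -ai -aj eqxx.
have [_ ->] := mean_mul_disjoint mX indX disj (@row_at_measurable_on _ _ i pf)
  (@row_at_measurable_on _ _ j pg) (sqint_integ (row_at_sqint i pf)) (sqint_integ (row_at_sqint j pg)).
have [|_ ->] := @polyfun_mean 2 f i 0 _ pf => //.
by rewrite f0 mul0r.
Qed.

Definition row_sum (c : nat -> R) f (n : nat) (w : T) : R :=
  (Num.sqrt n%:R)^-1 * \sum_(i < n) c i * row_at i f w.

Lemma row_sumD c f g n w :
  row_sum c (fun v => f v + g v) n w = row_sum c f n w + row_sum c g n w.
Proof.
rewrite /row_sum -mulrDr -big_split/=; congr (_ * _).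
by apply: eq_bigr => i _; rewrite -mulrDr.
Qed.

Lemma row_sumZ c a f n w : row_sum c (fun v => a * f v) n w = a * row_sum c f n w.
Proof.
rewrite /row_sum [RHS]mulrCA (mulr_sumr _ _ _ a); congr (_ * _).
by apply: eq_bigr => i _; rewrite mulrCA.
Qed.

Lemma row_sum_sum c (I : Type) (s : seq I) (f : I -> (K -> R) -> R) n w :
  row_sum c (fun v => \sum_(j <- s) f j v) n w = \sum_(j <- s) row_sum c (f j) n w.
Proof.
elim: s => [|j s IHs].
  rewrite big_nil /row_sum big1 ?mulr0// => i _.
  by rewrite /row_at big_nil mulr0.
rewrite big_cons -IHs -row_sumD (_ : (fun v => _) = fun v => f j v + \sum_(j <- s) f j v)//.
by apply/funext => v; rewrite big_cons.
Qed.

Lemma row_sum_sqint c f n : polyfun 2 f -> sqint P (row_sum c f n).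
Proof.
move=> pf; apply: sqintZ; apply: sqint_sum => i; apply: sqintZ.
exact: row_at_sqint.
Qed.

(** Expand the double sum: terms from different rows factor by independence and vanish, for which
    centring one of the two polynomials suffices. The diagonal terms share a common mean. *)
Lemma mean_row_sum_mul (c c' : nat -> R) f g n : polyfun 2 f -> polyfun 2 g ->
  mean P (row_at 0 f) = 0 ->
  mean P (fun w => row_sum c f n w * row_sum c' g n w) =
  (n%:R^-1 * \sum_(i < n) c i * c' i) * mean P (row_at 0 (fun v => f v * g v)).
Proof.
move=> pf pg f0.
have fg i j : integ P (fun w => row_at i f w * row_at j g w).
  by apply: sqint_mul; exact: row_at_sqint.
transitivity (mean P (fun w => n%:R^-1 * \sum_(i < n) \sum_(j < n)
    (c i * c' j) * (row_at i f w * row_at j g w))).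
  apply: eq_mean => w; rewrite /row_sum mulrACA -invfM -expr2 sqr_sqrtr//.
  congr (_ * _); rewrite mulr_suml; apply: eq_bigr => i _.
  by rewrite mulr_sumr; apply: eq_bigr => j _; rewrite mulrACA.
rewrite meanZ; last by apply: integ_sum => i; apply: integ_sum => j; exact: integZ.
rewrite -mulrA; congr (_ * _); rewrite mean_sum; last first.
  by move=> i; apply: integ_sum => j; exact: integZ.
rewrite mulr_suml; apply: eq_bigr => i _; rewrite mean_sum; last first.
  by move=> j; exact: integZ.
rewrite (bigD1 i)//= big1 ?addr0 => [|j ji]; last first.
  by rewrite meanZ// mean_row_mul ?mulr0// eq_sym.
rewrite meanZ//; congr (_ * _).
by have [|_ <-] := @polyfun_mean (2 + 2) (fun v => f v * g v) i 0 isT; first exact: polyfunM.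
Qed.

Lemma cvg_mean_seq (c : nat -> R) (l : R) : c n @[n --> \oo] --> l ->
  n%:R^-1 * (\sum_(i < n) c i) @[n --> \oo] --> l.
Proof.
(* The Cesaro mean of index n averages n + 1 terms, hence the shift. *)
move=> /cesaro cl; rewrite -(cvg_shiftS _) /=.
apply: cvg_trans cl; apply: near_eq_cvg; apply: nearW => n.
by rewrite /arithmetic_mean/= seriesEord.
Qed.

(** The squared error has mean equal to a constant times the average of the (c_i - l)^2, which tends
    to 0 by Cesaro. This is what replaces the row-dependent entries of M by their limits. *)
Lemma row_sum_close (c : nat -> R) (l : R) f : c n @[n --> \oo] --> l ->
  polyfun 2 f -> mean P (row_at 0 f) = 0 ->
  L2_close P (row_sum c f) (row_sum (fun=> l) f).
Proof.
move=> cl pf f0; set m := mean P (row_at 0 (fun v => f v * f v)).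
have sq c' n : mean P (fun w => row_sum c' f n w ^+ 2) =
    (n%:R^-1 * \sum_(i < n) c' i * c' i) * m.
  by under eq_mean do rewrite expr2; exact: mean_row_sum_mul.
split; split.
- by move=> n; exact: row_sum_sqint.
- have H : n%:R^-1 * (\sum_(i < n) l * l) * m @[n --> \oo] --> l * l * m.
    by apply: cvgM; [exact: (cvg_mean_seq (c := fun=> l * l) (cvg_cst _))|exact: cvg_cst].
  exists (l * l * m + 1); move/cvgrPdist_le : H => /(_ 1 ltr01).
  apply: filterS => n; rewrite sq ler_distlC => /andP[_].
  by rewrite addrC.
- by move=> n; apply: sqintB; exact: row_sum_sqint.
- rewrite (_ : 0 = (l - l) * (l - l) * m); last by rewrite subrr !mul0r.
  have E n : mean P (fun w => (row_sum c f n w - row_sum (fun=> l) f n w) ^+ 2) =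
      (n%:R^-1 * \sum_(i < n) (c i - l) * (c i - l)) * m.
    rewrite -(sq (fun i => c i - l)); apply: eq_mean => w; congr (_ ^+ 2).
    rewrite /row_sum -mulrBr; congr (_ * _); rewrite -sumrB.
    by apply: eq_bigr => i _; rewrite mulrBl.
  under eq_cvg do rewrite E; apply: cvgM; last exact: cvg_cst.
  apply: (cvg_mean_seq (c := fun i => (c i - l) * (c i - l))).
  by apply: cvgM; apply: cvgB => //; exact: cvg_cst.
Qed.

Lemma row_sum_clt f b : polyfun 2 f -> mean P (row_at 0 f) = 0 ->
  lindeberg P (fun i => row_at i f) ->
  mean P (fun w => cos (row_sum (fun=> 1) f n w + b)) @[n --> \oo] -->
  expR (- mean P (row_at 0 (fun v => f v * f v)) / 2) * cos b.
Proof.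
move=> pf f0 Lf.
have E n w : row_sum (fun=> 1) f n w = (Num.sqrt n%:R)^-1 * \sum_(i < n) row_at i f w.
  by congr (_ * _); apply: eq_bigr => i _; rewrite mul1r.
have E' n : mean P (fun w => cos (row_sum (fun=> 1) f n w + b)) =
    mean P (fun w => cos ((Num.sqrt n%:R)^-1 * (\sum_(i < n) row_at i f w) + b)).
  by apply: eq_mean => w; rewrite E.
under eq_cvg do rewrite E'.
apply: (@clt_cos _ _ _ P _ X mX indX (fun i => row_at i f)) => //.
- by move=> i; exact: row_at_measurable_on pf.
- by move=> i; exact: row_at_sqint.
- by move=> i; have [|_ ->] := @polyfun_mean 2 f i 0 _ pf.
move=> i; have [|_ <-] := @polyfun_mean (2 + 2) (fun v => f v * f v) i 0 isT.
  exact: polyfunM.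
by apply: eq_mean => w; rewrite expr2.
Qed.

End RowSums.

(** * Linear and centred quadratic forms in the noises of a row *)

Section CentredQuadratics.
Context {R : realType} {d : measure_display} {T : measurableType d}.
Variable P : probability T R.
Variables (K : finType) (X : nat * K -> T -> R) (mom : K -> nat -> R).
Hypothesis mX : forall i, measurable_fun setT (X i).
Hypothesis indX : independent_RVs P X.
Hypothesis momX : forall i k a, (a <= 4)%N ->
  integ P (fun w => X (i, k) w ^+ a) /\ mean P (fun w => X (i, k) w ^+ a) = mom k a.
Hypothesis mom1 : forall k, mom k 1%N = 0.

Definition lin (al : K -> R) (v : K -> R) : R := \sum_k al k * v k.

(** The subtracted sum is the mean of the product of the two forms, the noises of a row being
    centred and independent. *)
Definition quad (al be : K -> R) (v : K -> R) : R :=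
  lin al v * lin be v - \sum_k al k * be k * mom k 2%N.

Lemma polyfun_lin al D : (0 < D)%N -> polyfun D (lin al).
Proof. by move=> D0; apply: polyfun_sum => k; apply: polyfunZ; exact: polyfun_var. Qed.

Lemma polyfun_quad al be : polyfun 2 (quad al be).
Proof.
apply: polyfunD; last exact: polyfun_cst.
by apply: (@polyfunM _ _ 1 1); exact: polyfun_lin.
Qed.

Lemma mean_var2 i k k' : integ P (fun w => X (i, k) w * X (i, k') w) /\
  mean P (fun w => X (i, k) w * X (i, k') w) = if k == k' then mom k 2%N else 0.
Proof.
have [->|kk'] := eqVneq k k'.
  have [] := @momX i k' 2%N isT.
  by rewrite (_ : (fun w => _) = fun w => X (i, k') w * X (i, k') w).
have disj : [set (i, k)] `&` [set (i, k')] = set0.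
  by apply/seteqP; split=> // ik [/= -> [k'k]]; rewrite k'k eqxx in kk'.
have [i1 m1] := @momX i k 1%N isT; have [i1' m1'] := @momX i k' 1%N isT.
have mk : measurable_on X [set (i, k)] (X (i, k)) by exact: measurable_onX.
have mk' : measurable_on X [set (i, k')] (X (i, k')) by exact: measurable_onX.
have [ii ->] := mean_mul_disjoint mX indX disj mk mk' i1 i1'.
split=> //; rewrite (_ : mean P (X (i, k)) = mom k 1%N); last by rewrite -m1.
by rewrite mom1 mul0r.
Qed.

Lemma lin_mean0 al i : mean P (row_at X i (lin al)) = 0.
Proof.
have i1 k : integ P (fun w => al k * X (i, k) w).
  by apply: integZ; case: (@momX i k 1%N isT).
rewrite [LHS]mean_sum//; apply: big1 => k _.
have [ik mk] := @momX i k 1%N isT.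
have E : mean P (X (i, k)) = 0 by rewrite -(mom1 k) -mk.
by rewrite meanZ// E mulr0.
Qed.

Lemma row_quadE al be i w : row_at X i (quad al be) w =
  \sum_k \sum_k' (al k * be k') * (X (i, k) w * X (i, k') w)
  - \sum_k al k * be k * mom k 2%N.
Proof.
rewrite /row_at /quad; congr (_ - _); rewrite mulr_suml; apply: eq_bigr => k _.
by rewrite mulr_sumr; apply: eq_bigr => k' _; rewrite mulrACA.
Qed.

Lemma quad_mean0 al be i : mean P (row_at X i (quad al be)) = 0.
Proof.
have i1 k k' : integ P (fun w => (al k * be k') * (X (i, k) w * X (i, k') w)).
  by apply: integZ; case: (mean_var2 i k k').
have i2 k : integ P (fun w => \sum_k' (al k * be k') * (X (i, k) w * X (i, k') w)).
  exact: integ_sum.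
under eq_mean do rewrite row_quadE.
rewrite meanB; [|exact: integ_sum|exact: integ_cst].
rewrite mean_cst mean_sum// -sumrB; apply: big1 => k _.
rewrite mean_sum// (bigD1 k)//= big1 ?addr0 => [|k' k'k].
  have [ik mk] := mean_var2 i k k; rewrite meanZ// mk eqxx.
  by rewrite subrr.
have [ik mk] := mean_var2 i k k'; rewrite meanZ// mk eq_sym (negbTE k'k).
by rewrite mulr0.
Qed.

Lemma lindeberg_class_var k : lindeberg_class P (fun i => X (i, k)).
Proof.
apply: (@lindeberg_class4 _ _ _ _ _ (mom k 4)) => i.
- by split=> //; case: (@momX i k 2%N isT).
- by case: (@momX i k 4%N isT).
- by case: (@momX i k 4%N isT) => _ ->.
Qed.

(** The fourth moment of a product of two independent noises is the product of their fourth moments,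
    so the fourth-moment criterion applies. *)
Lemma lindeberg_class_var2 k k' : k != k' ->
  lindeberg_class P (fun i w => X (i, k) w * X (i, k') w).
Proof.
move=> kk'; have disj (i : nat) : [set (i, k)] `&` [set (i, k')] = set0.
  by apply/seteqP; split=> // ik [/= -> [k'k]]; rewrite k'k eqxx in kk'.
have prod i a : (a <= 4)%N ->
    integ P (fun w => (X (i, k) w * X (i, k') w) ^+ a) /\
    mean P (fun w => (X (i, k) w * X (i, k') w) ^+ a) = mom k a * mom k' a.
  move=> a4; have [i1 m1] := @momX i k a a4; have [i1' m1'] := @momX i k' a a4.
  have mk : measurable_on X [set (i, k)] (fun w => X (i, k) w ^+ a).
    by apply: measurable_funX; exact: measurable_onX.
  have mk' : measurable_on X [set (i, k')] (fun w => X (i, k') w ^+ a).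
    by apply: measurable_funX; exact: measurable_onX.
  have [] := mean_mul_disjoint mX indX (disj i) mk mk' i1 i1'.
  rewrite m1 m1' (_ : (fun w => _ * _) = fun w => (X (i, k) w * X (i, k') w) ^+ a)//.
  by apply/funext => w; rewrite exprMn.
apply: (@lindeberg_class4 _ _ _ _ _ (mom k 4 * mom k' 4)) => i.
- split; first exact: measurable_funM.
  by case: (prod i 2%N isT).
- by case: (prod i 4%N isT).
- by case: (prod i 4%N isT) => _ ->.
Qed.

Lemma lindeberg_class_lin al : lindeberg_class P (fun i => row_at X i (lin al)).
Proof.
apply: lindeberg_class_sum; first exact: lindeberg_class_cst.
move=> k; apply: lindeberg_classZ; exact: lindeberg_class_var.
Qed.

(** Mixed products are covered by fourth moments. A square would need an eighth moment for that, so
    Lindeberg's condition is asked for exactly those squares that occur with a nonzero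
    coefficient. *)
Lemma lindeberg_class_quad al be :
  (forall k, al k * be k != 0 -> lindeberg_class P (fun i w => X (i, k) w ^+ 2)) ->
  lindeberg_class P (fun i => row_at X i (quad al be)).
Proof.
move=> sqk; have -> : (fun i => row_at X i (quad al be)) = fun i w =>
  \sum_k \sum_k' (al k * be k') * (X (i, k) w * X (i, k') w)
  + - (\sum_k al k * be k * mom k 2%N).
  by apply/funext => i; apply/funext => w; exact: row_quadE.
have L0 : lindeberg_class P (fun _ _ => 0) by exact: lindeberg_class_cst.
apply: lindeberg_classD; last exact: lindeberg_class_cst.
apply: lindeberg_class_sum => // k; apply: lindeberg_class_sum => // k'.
have [kk'|kk'] := eqVneq k k'; last first.
  by apply: lindeberg_classZ; exact: lindeberg_class_var2.
rewrite -kk'; have [->|ab] := eqVneq (al k * be k) 0.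
  rewrite (_ : (fun i w => _) = fun _ _ => 0)//.
  by apply/funext => i; apply/funext => w; rewrite mul0r.
apply: lindeberg_classZ.
rewrite (_ : (fun i w => _) = fun i w => X (i, k) w ^+ 2); first exact: sqk.
by apply/funext => i; apply/funext => w; rewrite expr2.
Qed.

End CentredQuadratics.

Section Moments.
Context {R : realType} {d : measure_display} {T : measurableType d}.
Variable P : probability T R.

Definition moment_seq (s g1 g2 : R) (a : nat) : R :=
  nth 0 [:: 1; 0; s ^+ 2; g1 * s ^+ 3; (g2 + 3) * s ^+ 4] a.

(** The assumptions are equations between expectations; integrability is extracted from the fourth
    one, an integral of a nonnegative function with a finite value, and descends to lower powers by
    |x|^b <= 1 + x^4. *)
Lemma moments4_mean (X : {RV P >-> R}) s g1 g2 a : moments4 P X s g1 g2 ->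
  (a <= 4)%N ->
  integ P (fun w => X w ^+ a) /\ mean P (fun w => X w ^+ a) = moment_seq s g1 g2 a.
Proof.
move=> [E1 V2 E3 E4] a4.
have mXa b : measurable_fun setT (fun w => X w ^+ b) by exact: measurable_funX.
have X40 w : 0 <= X w ^+ 4.
  by rewrite (_ : X w ^+ 4 = (X w ^+ 2) ^+ 2) ?sqr_ge0//; ring.
have i4 : integ P (fun w => X w ^+ 4).
  apply/integrableP; split; first exact/measurable_EFinP.
  under eq_integral => w _ do rewrite /= ger0_norm//.
  by move: E4; rewrite unlock => ->; rewrite ltry.
have ib b : (b <= 4)%N -> integ P (fun w => X w ^+ b).
  move=> b4; apply: (@integ_le _ _ _ P _ (fun w => 1 + X w ^+ 4)) => //; last first.
    by apply: integD => //; exact: integ_cst.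
  move=> w; rewrite normrX (_ : X w ^+ 4 = `|X w| ^+ 4); last first.
    by rewrite -normrX ger0_norm.
  have [x1|x1] := leP `|X w| 1.
    by rewrite (le_trans (exprn_ile1 _ (normr_ge0 _) x1))// lerDl exprn_ge0.
  by rewrite (le_trans (ler_weXn2l (ltW x1) b4))// lerDr.
split; first exact: ib.
have mE b c : (b <= 4)%N -> 'E_P[fun w => (X w ^+ b)%R]%E = c%:E ->
    mean P (fun w => X w ^+ b) = c.
  by move=> b4; rewrite expectation_mean; [case|exact: ib].
move: a a4 => [|[|[|[|[|//]]]]] _ /=.
- by rewrite -[RHS](mean_cst P).
- exact: mE.
- apply: mE => //; rewrite -V2 /variance; move: E1; rewrite !unlock => ->/=.
  have -> : (X : T -> R) \- cst 0 = X by apply/funext => z; rewrite /= subr0.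
  by [].
- exact: mE.
- exact: mE.
Qed.

End Moments.

(** * The three kinds of noise as one independent family *)

Section BigSum3.
Variables (A B C : Type).

Definition get1 (x : nat * (A + (B + C))) : option (nat * A) :=
  if x.2 is inl a then Some (x.1, a) else None.
Definition get2 (x : nat * (A + (B + C))) : option (nat * B) :=
  if x.2 is inr (inl b) then Some (x.1, b) else None.
Definition get3 (x : nat * (A + (B + C))) : option (nat * C) :=
  if x.2 is inr (inr c) then Some (x.1, c) else None.

Lemma big_sum3 (M : Type) (idx : M) (op : Monoid.com_law idx)
    (s : seq (nat * (A + (B + C)))) (F : nat * (A + (B + C)) -> M) :
  \big[op/idx]_(x <- s) F x =
  op (\big[op/idx]_(a <- pmap get1 s) F (a.1, inl a.2))
    (op (\big[op/idx]_(b <- pmap get2 s) F (b.1, inr (inl b.2)))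
        (\big[op/idx]_(c <- pmap get3 s) F (c.1, inr (inr c.2)))).
Proof.
elim: s => [|[i x] s IHs]; first by rewrite !big_nil !Monoid.simpm.
rewrite big_cons IHs; case: x => [a|[b|c]]; rewrite /= big_cons/=.
- by rewrite Monoid.mulmA.
- by rewrite Monoid.mulmCA; congr (op _ _); rewrite Monoid.mulmA.
- by rewrite Monoid.mulmCA; congr (op _ _); rewrite Monoid.mulmCA.
Qed.

End BigSum3.

Section CombinedFamily.
Context {R : realType} {d : measure_display} {T : measurableType d}.
Variable P : probability T R.
Variables (p q : nat).
Variables (eps : nat -> 'I_q -> {RV P >-> R}) (delta psi : nat -> 'I_p -> {RV P >-> R}).

(** With all noises in one family indexed by row and kind, independence of different rows, or of
    different noises of a row, is independence over disjoint index sets. *)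
Definition noise (x : nat * ('I_q + ('I_p + 'I_p))) : T -> R :=
  match x.2 with
  | inl k => eps x.1 k
  | inr (inl j) => delta x.1 j
  | inr (inr j) => psi x.1 j
  end.

Lemma noise_measurable x : measurable_fun setT (noise x).
Proof. by case: x => i [k|[j|j]]. Qed.

Let eps_ (ij : nat * 'I_q) : T -> R := eps ij.1 ij.2.
Let delta_ (ij : nat * 'I_p) : T -> R := delta ij.1 ij.2.
Let psi_ (ij : nat * 'I_p) : T -> R := psi ij.1 ij.2.

Lemma sigma_of_bigI (I : eqType) (X : I -> T -> R) (s : seq I) (A : I -> set T) :
  (forall i, i \in s -> events_of (X i) (A i)) ->
  sigma_of X (\big[setI/setT]_(i <- s) A i).
Proof.
move=> sA; pose G := \bigcup_(i in [set: I]) events_of (X i).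
suff : measurable (\big[setI/setT]_(i <- s) A i : set (g_sigma_algebraType G)) by [].
elim: s sA => [|i s IHs] sA; first by rewrite big_nil; exact: measurableT.
rewrite big_cons; apply: measurableI; last first.
  by apply: IHs => j js; apply: sA; rewrite inE js orbT.
by apply: sub_sigma_algebra; exists i => //; apply: sA; rewrite inE eqxx.
Qed.

(** A finite intersection is sorted by kind. Mutual independence of the three sigma-algebras
    separates the three blocks, and independence within each kind then factors each block. *)
Lemma noise_independent : independent_RVs P eps_ -> independent_RVs P delta_ ->
  independent_RVs P psi_ ->
  mutually_independent P (fun k : 'I_3 =>
    nth set0 [:: sigma_of delta_; sigma_of psi_; sigma_of eps_] k) ->
  independent_RVs P noise.
Proof.
move=> ie id ip i3 s A us sA.
pose Ae (x : nat * 'I_q) := A (x.1, inl x.2).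
pose Ad (x : nat * 'I_p) := A (x.1, inr (inl x.2)).
pose Ap (x : nat * 'I_p) := A (x.1, inr (inr x.2)).
pose se := pmap (@get1 _ _ _) s; pose sd := pmap (@get2 _ _ _) s.
pose sp := pmap (@get3 _ _ _) s.
have use : uniq se.
  apply: (@pmap_uniq _ _ (@get1 'I_q 'I_p 'I_p) (fun x => (x.1, inl x.2))) => //.
  by case=> i [k|[j|j]].
have usd : uniq sd.
  apply: (@pmap_uniq _ _ (@get2 'I_q 'I_p 'I_p) (fun x => (x.1, inr (inl x.2)))) => //.
  by case=> i [k|[j|j]].
have usp : uniq sp.
  apply: (@pmap_uniq _ _ (@get3 'I_q 'I_p 'I_p) (fun x => (x.1, inr (inr x.2)))) => //.
  by case=> i [k|[j|j]].
have Hse x : x \in se -> events_of (eps_ x) (Ae x).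
  rewrite mem_pmap => /mapP[[i [k|[j|j]]] //= xs [->]].
  exact: (sA _ xs).
have Hsd x : x \in sd -> events_of (delta_ x) (Ad x).
  rewrite mem_pmap => /mapP[[i [k|[j|j]]] //= xs [->]].
  exact: (sA _ xs).
have Hsp x : x \in sp -> events_of (psi_ x) (Ap x).
  rewrite mem_pmap => /mapP[[i [k|[j|j]]] //= xs [->]].
  exact: (sA _ xs).
rewrite !big_sum3 -/se -/sd -/sp -(ie _ _ use Hse) -(id _ _ usd Hsd) -(ip _ _ usp Hsp).
pose k0 : 'I_3 := @Ordinal 3 0 isT; pose k1 : 'I_3 := @Ordinal 3 1 isT.
pose k2 : 'I_3 := @Ordinal 3 2 isT.
(* The order eps, delta, psi of the sorted product differs from the order delta, psi, eps of the
   hypothesis. *)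
have /= := i3 [:: k2; k0; k1] (fun k => nth set0 [:: \big[setI/setT]_(x <- sd) Ad x;
  \big[setI/setT]_(x <- sp) Ap x; \big[setI/setT]_(x <- se) Ae x] k) isT.
rewrite !big_cons !big_nil /= setIT mule1; apply => k.
rewrite !inE => /or3P[]/eqP ->/=; exact: sigma_of_bigI.
Qed.

End CombinedFamily.

Section MatrixNorm.
Context {R : realType}.

Lemma mx_entry_norm_le (m n : nat) (A : 'M[R]_(m, n)) i j : `|A i j| <= `|A|.
Proof.
by rewrite [leRHS]mx_normrE (le_bigmax _ (fun ij => `|A ij.1 ij.2|) (i, j)).
Qed.

Lemma mxcvg_cvg {U : Type} (F : set_system U) {FF : Filter F} (m n : nat)
    (A : U -> 'M[R]_(m, n)) (L : 'M[R]_(m, n)) : mxcvg F A L -> A x @[x --> F] --> L.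
Proof.
move=> AL; apply/cvgrPdist_le => e e0.
have : \forall x \near F, forall ij : 'I_m * 'I_n, `|L ij.1 ij.2 - A x ij.1 ij.2| <= e.
  apply: filter_forall => -[i j]; move/cvgrPdist_le : (AL i j); exact.
apply: filterS => x H; rewrite [leLHS]mx_normrE; apply: bigmax_le => [|ij _].
  exact: ltW.
by rewrite !mxE; exact: H.
Qed.

End MatrixNorm.

Section NormalMatrices.
Context {R : realType}.

(** The matrix is F g with Om = F F' and g a vector of independent standard normals. Its linear
    forms have explicit mean cosines, and these determine their laws. *)
Lemma normal_mx_exists (a b : nat) (Om : 'M[R]_(a * b)) : psdmx Om ->
  exists (d : measure_display) (T : measurableType d) (P : probability T R)
    (Y : T -> 'M[R]_(a, b)),
  [/\ normal_mx P Y 0 Om,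
      forall i, sqint P (fun w => mxvec (Y w) 0 i) &
      forall t c, mean P (fun w => cos (dot t (mxvec (Y w)) + c)) =
        expR (- ((t *m Om *m t^T) 0 0 / 2)) * cos c].
Proof.
move=> /psd_factor[F OmE].
have [d [T [P [G [sG G0 GG Gcos]]]]] := @std_gaussian_exists R (a * b).
pose g w : 'rV[R]_(a * b) := \row_i G i w.
pose Y w : 'M[R]_(a, b) := vec_mx (g w *m F^T).
have YE w i : mxvec (Y w) 0 i = \sum_k F i k * G k w.
  by rewrite vec_mxK mxE; apply: eq_bigr => k _; rewrite !mxE mulrC.
have sY i : sqint P (fun w => mxvec (Y w) 0 i).
  under [X in sqint P X]eq_fun do rewrite YE.
  by apply: sqint_sum => k; apply: sqintZ; exact: sG.
have Y0 i : mean P (fun w => mxvec (Y w) 0 i) = 0.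
  under eq_mean do rewrite YE.
  rewrite mean_sum => [|k]; last by apply/integZ/sqint_integ/sG.
  by apply: big1 => k _; rewrite meanZ ?G0 ?mulr0//; exact/sqint_integ/sG.
have YY i j : mean P (fun w => mxvec (Y w) 0 i * mxvec (Y w) 0 j) = Om i j.
  have iGG k l : integ P (fun w => (F i k * F j l) * (G (k : 'I_(a * b)) w * G (l : 'I_(a * b)) w)).
    by apply: integZ; apply: sqint_mul; exact: sG.
  transitivity (mean P (fun w => \sum_k \sum_l (F i k * F j l) * (G k w * G l w))).
    apply: eq_mean => w; rewrite !YE mulr_suml; apply: eq_bigr => k _.
    by rewrite mulr_sumr; apply: eq_bigr => l _; rewrite mulrACA.
  rewrite mean_sum => [|k]; last exact: integ_sum.
  rewrite OmE mxE; apply: eq_bigr => k _; rewrite mean_sum// (bigD1 k)//= big1 => [|l lk].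
    rewrite meanZ ?GG//; last by apply: sqint_mul; exact: sG.
    by rewrite eqxx mulr1 addr0 mxE.
  rewrite meanZ ?GG//; last by apply: sqint_mul; exact: sG.
  by rewrite eq_sym (negbTE (lk : val l != val k)) mulr0.
have Ycos t c : mean P (fun w => cos (dot t (mxvec (Y w)) + c)) =
    expR (- ((t *m Om *m t^T) 0 0 / 2)) * cos c.
  (* The standard normals are indexed by all natural numbers, so the coefficient row t F is extended
     by 0. *)
  pose u (i : nat) : R := oapp (fun k : 'I_(a * b) => (t *m F) 0 k) 0 (insub i).
  have uE (k : 'I_(a * b)) : u k = (t *m F) 0 k by rewrite /u valK.
  transitivity (mean P (fun w => cos (\sum_(i < a * b) u i * G i w + c))).
    apply: eq_mean => w; congr (cos (_ + _)).
    under [RHS]eq_bigr do rewrite uE mxE mulr_suml.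
    rewrite exchange_big; apply: eq_bigr => i _; rewrite YE mulr_sumr.
    by apply: eq_bigr => k _; rewrite mulrA.
  rewrite Gcos; congr (expR (- _) * _).
  rewrite OmE mulmxA -(mulmxA (t *m F)) -trmx_mul mxE mulr_suml.
  by apply: eq_bigr => k _; rewrite uE [(t *m F)^T _ _]mxE expr2.
exists d, T, P, Y; split=> //; split.
- move=> [i j]; have [] := sY (mxvec_index i j).
  by under eq_fun do rewrite mxvecE.
- move=> t; set v := (t^T *m Om *m t^T^T) 0 0.
  have XE w : (t^T *m vec (Y w)) 0 0 = dot t^T (mxvec (Y w)).
    by rewrite mxE; apply: eq_bigr => k _; rewrite [vec _ _ _]mxE.
  have sX : sqint P (fun w => dot t^T (mxvec (Y w))).
    by apply: sqint_sum => i; apply: sqintZ; exact: sY.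
  have Xcos s c : mean P (fun w => cos (s * dot t^T (mxvec (Y w)) + c)) =
      expR (- (s ^+ 2 * v / 2)) * cos c.
    under eq_mean do rewrite -dotZl.
    rewrite Ycos; congr (expR (- (_ / 2)) * _).
    by rewrite -!scalemxAl linearZ/= -scalemxAr scalerA [LHS]mxE.
  have v0 : 0 <= v.
    rewrite /v OmE mulmxA -(mulmxA (t^T *m F)) -trmx_mul mxE.
    by apply: sumr_ge0 => k _; rewrite [(t^T *m F)^T _ _]mxE -expr2 sqr_ge0.
  exists 0, (Num.sqrt v); split; first exact: sqrtr_ge0.
  move=> A mA; rewrite (_ : (fun w => _) = fun w => dot t^T (mxvec (Y w))); last first.
    by apply/funext => w; exact: XE.
  (* Zero variance is compared with the constant 0, whose law is the Dirac mass required by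
     [normal_RV] in that case. *)
  have [v1|v1] := eqVneq (Num.sqrt v) 0.
    have v00 : v = 0 by rewrite -(sqr_sqrtr v0) v1 expr0n.
    rewrite (@law_from_cos _ _ _ _ _ P P _ (cst 0)) => //; last 2 first.
    + exact: sqint_cst.
    + move=> s c; rewrite Xcos v00 mulr0 mul0r oppr0 expR0 mul1r.
      by under eq_mean do rewrite mulr0 add0r; rewrite mean_cst.
    rewrite preimage_cst diracE; case: ifP => _; first exact: probability_setT.
    exact: measure0.
  have s0 : 0 < Num.sqrt v by rewrite lt0r v1 sqrtr_ge0.
  rewrite (@law_from_cos _ _ _ _ _ P (normal_prob 0 (Num.sqrt v)) _ id) => //.
  + split; first exact: measurable_id.
    by case: (centred_normal_var s0).
  + move=> s c; rewrite Xcos centred_normal_cos// sqr_sqrtr//.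
    by rewrite [v * _]mulrC.
- move=> k; under eq_fun do rewrite /vec mxE.
  rewrite expectation_mean ?Y0; last exact/sqint_integ.
  by rewrite /vec mxE linear0 mxE.
- move=> k l; have E i : (fun w => vec (Y w) i 0) = fun w => mxvec (Y w) 0 i.
    by apply/funext => w; rewrite /vec mxE.
  have EY i : 'E_P[fun w => mxvec (Y w) 0%R i]%E = 0%E.
    by rewrite expectation_mean ?Y0//; exact: sqint_integ.
  have iYY : integ P (fun w => mxvec (Y w) 0 k * mxvec (Y w) 0 l) by exact: sqint_mul.
  have EX (X : T -> R) : X \- cst (fine 0%E) = X by apply/funext => w; rewrite /= subr0.
  rewrite !E covariance.unlock !EY !EX -YY -(expectation_mean iYY)//.
Qed.

End NormalMatrices.

(** * The measurement error model *)

Section Model.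
Context {R : realType} {d : measure_display} {T : measurableType d}.
Variable P : probability T R.
Variables (p q : nat).
Variables (seps g1eps g2eps sdelta g1delta g2delta spsi g1psi g2psi : R).
Variables (eps : nat -> 'I_q -> {RV P >-> R}) (delta psi : nat -> 'I_p -> {RV P >-> R}).
Variables (M : nat -> 'cV[R]_p) (sM : 'cV[R]_p) (B : 'M[R]_(p, q)).

Local Notation noises := ('I_q + ('I_p + 'I_p))%type.
Local Notation X0 := (noise eps delta psi).

Definition noise_moment (k : noises) : nat -> R :=
  match k with
  | inl _ => moment_seq seps g1eps g2eps
  | inr (inl _) => moment_seq sdelta g1delta g2delta
  | inr (inr _) => moment_seq spsi g1psi g2psi
  end.
Local Notation mom := noise_moment.

(** [coefY] and [coefE] are the coefficient vectors, in the noises of one row, of an entry of X - M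
    and of an entry of E - Delta B. *)
Definition coefY (j : 'I_p) (k : noises) : R :=
  match k with inl _ => 0 | inr (inl l) => (l == j)%:R | inr (inr l) => (l == j)%:R end.

Definition coefE (i : 'I_q) (k : noises) : R :=
  match k with inl l => (l == i)%:R | inr (inl l) => - B l i | inr (inr _) => 0 end.

Definition Mrows (n : nat) : 'M[R]_(n, p) := \matrix_(i < n, j < p) M i j 0.
Definition Xrows (n : nat) (w : T) : 'M[R]_(n, p) :=
  Mrows n + first_rows psi n w + first_rows delta n w.

(* [vec (score n w)] is the vector u_n of which the second moments converge. *)
Definition score (n : nat) (w : T) : 'M[R]_(p, q) :=
  ((hmx sdelta (Xrows n w) (first_rows delta n w) (first_rows eps n w) B)^T +
   B^T *m KbarX spsi sdelta (Mrows n) *m Hmx spsi sdelta (Mrows n) (Xrows n w))^T.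

Lemma sum_delta (I : finType) (i : I) (F : I -> R) : \sum_j (j == i)%:R * F j = F i.
Proof.
by rewrite (bigD1 i)//= eqxx mul1r big1 ?addr0// => j /negbTE ->; rewrite mul0r.
Qed.

Lemma lin_coefY j i w : row_at X0 i (lin (coefY j)) w = psi i j w + delta i j w.
Proof.
rewrite /row_at /lin !big_sumType/= big1 => [|k _]; last by rewrite mul0r.
by rewrite add0r !sum_delta addrC.
Qed.

Lemma lin_coefE k i w : row_at X0 i (lin (coefE k)) w =
  eps i k w - \sum_l delta i l w * B l k.
Proof.
rewrite /row_at /lin !big_sumType/= sum_delta; congr (_ + _).
rewrite [X in _ + X]big1 => [|l _]; last by rewrite mul0r.
by rewrite addr0 -sumrN; apply: eq_bigr => l _; rewrite mulNr mulrC.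
Qed.

Lemma quad_coefYY j l i w : row_at X0 i (quad mom (coefY j) (coefY l)) w =
  (psi i j w + delta i j w) * (psi i l w + delta i l w)
  - (j == l)%:R * (spsi ^+ 2 + sdelta ^+ 2).
Proof.
rewrite -!lin_coefY /row_at /quad; congr (_ - _).
rewrite !big_sumType/= big1 => [|k _]; last by rewrite !mul0r.
rewrite add0r.
under eq_bigr do rewrite -mulrA.
under [X in _ + X]eq_bigr do rewrite -mulrA.
by rewrite !sum_delta addrC mulrDr.
Qed.

Lemma quad_coefYE j k i w : row_at X0 i (quad mom (coefY j) (coefE k)) w =
  (psi i j w + delta i j w) * (eps i k w - \sum_l delta i l w * B l k)
  + sdelta ^+ 2 * B j k.
Proof.
rewrite -lin_coefY -lin_coefE /row_at /quad; congr (_ + _).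
rewrite !big_sumType/= big1 => [|l _]; last by rewrite !mul0r.
rewrite add0r [X in _ + X]big1 => [|l _]; last by rewrite mulr0 mul0r.
under eq_bigr do rewrite -mulrA.
by rewrite sum_delta addr0 mulNr opprK mulrC.
Qed.

Lemma sqrt_mulVn (n : nat) : Num.sqrt n%:R * n%:R^-1 = (Num.sqrt n%:R)^-1 :> R.
Proof.
have [->|n0] := posnP n; first by rewrite sqrtr0 mul0r invr0.
have s0 : Num.sqrt n%:R != 0 :> R by rewrite sqrtr_eq0 -ltNge ltr0n.
by rewrite -[in X in _ * X](sqr_sqrtr (ler0n R n)); field.
Qed.

Lemma sqrt_mul_sum (n : nat) (c : R) :
  Num.sqrt n%:R * c = (Num.sqrt n%:R)^-1 * \sum_(i < n) c.
Proof.
rewrite sumr_const card_ord -[c *+ n]mulr_natl mulrA; congr (_ * _).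
have [->|n0] := posnP n; first by rewrite sqrtr0 mulr0.
have s0 : Num.sqrt n%:R != 0 :> R by rewrite sqrtr_eq0 -ltNge ltr0n.
by rewrite -[in X in _ * X](sqr_sqrtr (ler0n R n)); field.
Qed.

(** Substitute X = M + (X - M) in each row: the products of entries of M cancel against those in
    SigmaX, the cross terms are linear in the noise with weights from M, and the variances centre
    the quadratic part. The convention 0^-1 = 0 makes this valid at n = 0. *)
Lemma Hmx_row_sum n w l j : Hmx spsi sdelta (Mrows n) (Xrows n w) l j =
  row_sum X0 (fun=> 1) (quad mom (coefY l) (coefY j)) n w +
  (row_sum X0 (fun i => M i l 0) (lin (coefY j)) n w +
   row_sum X0 (fun i => M i j 0) (lin (coefY l)) n w).
Proof.
have -> : Hmx spsi sdelta (Mrows n) (Xrows n w) l j =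
    (Num.sqrt n%:R)^-1 * (\sum_(i < n) Xrows n w i l * Xrows n w i j) -
    Num.sqrt n%:R * (n%:R^-1 * (\sum_(i < n) M i l 0 * M i j 0) +
      (l == j)%:R * (spsi ^+ 2 + sdelta ^+ 2)).
  rewrite /Hmx /SigmaX !mxE; congr (_ * _ - _ * _).
    by apply: eq_bigr => i _; rewrite [X in X * _]mxE.
  rewrite -addrA; congr (_ * _ + _).
    by apply: eq_bigr => i _; rewrite !mxE.
  by case: (l == j); rewrite ?mulr1n ?mulr0n ?mul1r ?mul0r ?addr0.
rewrite mulrDr mulrA sqrt_mulVn (sqrt_mul_sum _ (_ * _)) -mulrDr -mulrBr.
rewrite /row_sum -!mulrDr; congr (_ * _).
rewrite -big_split/= -sumrB -!big_split/=; apply: eq_bigr => i _.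
by rewrite quad_coefYY !lin_coefY !mxE; ring.
Qed.

Lemma hmx_row_sum n w j k :
  hmx sdelta (Xrows n w) (first_rows delta n w) (first_rows eps n w) B j k =
  row_sum X0 (fun=> 1) (quad mom (coefY j) (coefE k)) n w +
  row_sum X0 (fun i => M i j 0) (lin (coefE k)) n w.
Proof.
rewrite /hmx !mxE -mulrA (sqrt_mul_sum _ (_ * _)) -mulrDr /row_sum -!mulrDr.
congr (_ * _); rewrite -!big_split/=; apply: eq_bigr => i _.
rewrite quad_coefYE lin_coefE !mxE.
under eq_bigr do rewrite mxE.
by move: (\sum_l _) => S; ring.
Qed.

Definition KbarX_lim : 'M[R]_p :=
  (sdelta ^+ 2)%:M *m invmx (Sigma_lim spsi sdelta sM).

(* The limit of the contribution of one row to [score], as a function of the noises in that row. *)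
Definition xi_entry (j : 'I_p) (k : 'I_q) (v : noises -> R) : R :=
  (quad mom (coefY j) (coefE k) v + sM j 0 * lin (coefE k) v) +
  \sum_l (B^T *m KbarX_lim) k l *
    (quad mom (coefY l) (coefY j) v +
     (sM l 0 * lin (coefY j) v + sM j 0 * lin (coefY l) v)).

Hypothesis indX : independent_RVs P X0.
Hypothesis eps4 : forall i j, moments4 P (eps i j) seps g1eps g2eps.
Hypothesis delta_law : forall i j k l, same_law (delta i j) (delta k l).
Hypothesis delta4 : forall i j, moments4 P (delta i j) sdelta g1delta g2delta.
Hypothesis psi_law : forall i j k l, same_law (psi i j) (psi k l).
Hypothesis psi4 : forall i j, moments4 P (psi i j) spsi g1psi g2psi.
Hypothesis cvgM_ : M n @[n --> \oo] --> sM.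
Hypothesis Sigma_unit : Sigma_lim spsi sdelta sM \in unitmx.

Let mX := @noise_measurable _ _ _ P p q eps delta psi.

Let momX i k a : (a <= 4)%N -> integ P (fun w => X0 (i, k) w ^+ a) /\
  mean P (fun w => X0 (i, k) w ^+ a) = mom k a.
Proof. by case: k => [k|[k|k]] a4; apply: moments4_mean. Qed.

Let mom1 k : mom k 1%N = 0. Proof. by case: k => [k|[k|k]]. Qed.

Let Mcvg j : (M i j 0) @[i --> \oo] --> sM j 0.
Proof.
exact: (cvg_comp _ _ cvgM_ (@coord_continuous _ _ _ j 0 sM)).
Qed.

Lemma lindeberg_class_sqr k : (if k is inl _ then false else true) ->
  lindeberg_class P (fun i w => X0 (i, k) w ^+ 2).
Proof.
have sq i k' : sqint P (fun w => X0 (i, k') w ^+ 2).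
  split; first by apply: measurable_funX; exact: mX.
  have [] := @momX i k' 4 isT.
  rewrite (_ : (fun w => _) = fun w => (X0 (i, k') w ^+ 2) ^+ 2)//.
  by apply/funext => w; ring.
case: k => [//|[j|j]] _.
- apply: (@lindeberg_class_same_law _ _ _ _ (fun x => x ^+ 2) (fun i => delta i j)) => //.
  by move=> i; exact: (sq i (inr (inl j))).
- apply: (@lindeberg_class_same_law _ _ _ _ (fun x => x ^+ 2) (fun i => psi i j)) => //.
  by move=> i; exact: (sq i (inr (inr j))).
Qed.

Lemma polyfun_xi j k : polyfun 2 (xi_entry j k).
Proof.
apply: polyfunD.
  by apply: polyfunD; [exact: polyfun_quad|apply: polyfunZ; exact: polyfun_lin].
apply: polyfun_sum => l; apply: polyfunZ; apply: polyfunD; first exact: polyfun_quad.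
by apply: polyfunD; apply: polyfunZ; exact: polyfun_lin.
Qed.

Let integ2 f i : polyfun 2 f -> integ P (row_at X0 i f).
Proof. by move=> pf; apply: sqint_integ; apply: (row_at_sqint mX indX momX). Qed.

Let quad0 al be i : mean P (row_at X0 i (quad mom al be)) = 0.
Proof. exact: (quad_mean0 mX indX momX mom1). Qed.

Let lin0 al i : mean P (row_at X0 i (lin al)) = 0.
Proof. exact: (lin_mean0 momX mom1). Qed.

Lemma xi_mean0 j k : mean P (row_at X0 0 (xi_entry j k)) = 0.
Proof.
have pq al be := @polyfun_quad _ _ mom al be; have pl al := @polyfun_lin R noises al 2 isT.
have D f g : polyfun 2 f -> polyfun 2 g -> mean P (row_at X0 0 f) = 0 ->
    mean P (row_at X0 0 g) = 0 -> mean P (row_at X0 0 (fun v => f v + g v)) = 0.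
  move=> pf pg f0 g0; transitivity (mean P (row_at X0 0 f) + mean P (row_at X0 0 g)).
    exact: (meanD (integ2 0 pf) (integ2 0 pg)).
  by rewrite f0 g0 addr0.
have Z c f : polyfun 2 f -> mean P (row_at X0 0 f) = 0 ->
    mean P (row_at X0 0 (fun v => c * f v)) = 0.
  move=> pf f0; transitivity (c * mean P (row_at X0 0 f)); last by rewrite f0 mulr0.
  exact: (meanZ c (integ2 0 pf)).
have S (I : Type) (s : seq I) (f : I -> (noises -> R) -> R) : (forall i, polyfun 2 (f i)) ->
    (forall i, mean P (row_at X0 0 (f i)) = 0) ->
    mean P (row_at X0 0 (fun v => \sum_(i <- s) f i v)) = 0.
  move=> pf f0; rewrite [LHS]mean_sum => [|i]; last exact: integ2.
  by apply: big1 => i _; exact: f0.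
apply: (D _ _); [|apply: polyfun_sum => l|apply: (D _ _)|apply: S => l] => //.
- by apply: polyfunD => //; exact: polyfunZ.
- by apply/polyfunZ/polyfunD => //; apply: polyfunD; exact: polyfunZ.
- exact: polyfunZ.
- exact: (Z _ _).
- by apply/polyfunZ/polyfunD => //; apply: polyfunD; exact: polyfunZ.
apply: (Z _ _); first by apply: polyfunD => //; apply: polyfunD; exact: polyfunZ.
apply: (D _ _) => //; first by apply: polyfunD; exact: polyfunZ.
by apply: (D _ _); [exact: polyfunZ|exact: polyfunZ|exact: (Z _ _)|exact: (Z _ _)].
Qed.

(* The eps need not have the same law, but no eps_ik is squared in xi. *)
Lemma lindeberg_class_xi j k : lindeberg_class P (fun i => row_at X0 i (xi_entry j k)).
Proof.
have Lq al be : (forall l, al (inl l) * be (inl l) = 0) ->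
    lindeberg_class P (fun i => row_at X0 i (quad mom al be)).
  move=> ab; apply: (lindeberg_class_quad mX indX momX).
  move=> [l|l] H; first by rewrite ab eqxx in H.
  exact: lindeberg_class_sqr.
have Ll al : lindeberg_class P (fun i => row_at X0 i (lin al)).
  exact: (lindeberg_class_lin mX momX).
apply: lindeberg_classD.
  apply: lindeberg_classD; last by apply: lindeberg_classZ; exact: Ll.
  by apply: Lq => l; rewrite mul0r.
apply: lindeberg_class_sum; first exact: lindeberg_class_cst.
move=> l; apply: lindeberg_classZ; apply: lindeberg_classD.
  by apply: Lq => l'; rewrite mul0r.
by apply: lindeberg_classD; apply: lindeberg_classZ; exact: Ll.
Qed.

(** M'M / n averages the outer products of the rows, which converge since the rows do. *)
Lemma SigmaD_cvg : mxcvg \oo (fun n => SigmaD spsi (Mrows n)) (sM *m sM^T + (spsi ^+ 2)%:M).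
Proof.
apply: mxcvgD; last exact: mxcvg_cst.
move=> i j.
have E n : (n%:R^-1 *: ((Mrows n)^T *m Mrows n)) i j =
    n%:R^-1 * \sum_(l < n) (M l i 0 * M l j 0).
  by rewrite !mxE; congr (_ * _); apply: eq_bigr => l _; rewrite !mxE.
under eq_cvg do rewrite E.
have -> : (sM *m sM^T) i j = sM i 0 * sM j 0 by rewrite !mxE big_ord1 !mxE.
apply: (cvg_mean_seq (c := fun l => M l i 0 * M l j 0)).
by apply: cvgM; exact: Mcvg.
Qed.

Lemma SigmaX_cvg : mxcvg \oo (fun n => SigmaX spsi sdelta (Mrows n)) (Sigma_lim spsi sdelta sM).
Proof. by apply: mxcvgD; [exact: SigmaD_cvg|exact: mxcvg_cst]. Qed.

Lemma KbarX_cvg : mxcvg \oo (fun n => KbarX spsi sdelta (Mrows n)) KbarX_lim.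
Proof.
have E n : KbarX spsi sdelta (Mrows n) =
    (sdelta ^+ 2)%:M *m invmx (SigmaX spsi sdelta (Mrows n)).
  by rewrite /KbarX; congr (_ *m _); rewrite /SigmaX /SigmaD [LHS]addrC addKr.
rewrite (_ : (fun n => _) = fun n => (sdelta ^+ 2)%:M *m invmx (SigmaX spsi sdelta (Mrows n))).
  by apply: mxcvgM; [exact: mxcvg_cst|apply: mxcvgV => //; exact: SigmaX_cvg].
by apply/funext => n; exact: E.
Qed.

Let close (c : nat -> R) (l : R) f : c n @[n --> \oo] --> l -> polyfun 2 f ->
  mean P (row_at X0 0 f) = 0 -> L2_close P (row_sum X0 c f) (fun n w => l * row_sum X0 (fun=> 1) f n w).
Proof.
move=> cl pf f0; have := row_sum_close mX indX momX cl pf f0.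
congr (L2_close P _ _); apply/funext => n; apply/funext => w.
rewrite /row_sum mulrCA; congr (_ * _); rewrite mulr_sumr.
by apply: eq_bigr => i _; rewrite mul1r.
Qed.

Let close1 f : polyfun 2 f -> mean P (row_at X0 0 f) = 0 ->
  L2_close P (row_sum X0 (fun=> 1) f) (row_sum X0 (fun=> 1) f).
Proof. by move=> pf f0; apply: (row_sum_close mX indX momX) => //; exact: cvg_cst. Qed.

Lemma Hmx_close l j :
  L2_close P (fun n w => Hmx spsi sdelta (Mrows n) (Xrows n w) l j)
  (fun n w => row_sum X0 (fun=> 1) (quad mom (coefY l) (coefY j)) n w +
    (sM l 0 * row_sum X0 (fun=> 1) (lin (coefY j)) n w +
     sM j 0 * row_sum X0 (fun=> 1) (lin (coefY l)) n w)).
Proof.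
rewrite (_ : (fun n w => Hmx _ _ _ _ _ _) = fun n w =>
  row_sum X0 (fun=> 1) (quad mom (coefY l) (coefY j)) n w +
  (row_sum X0 (fun i => M i l 0) (lin (coefY j)) n w +
   row_sum X0 (fun i => M i j 0) (lin (coefY l)) n w)); last first.
  by apply/funext => n; apply/funext => w; exact: Hmx_row_sum.
apply: L2_closeD; first by apply: close1 => //; exact: polyfun_quad.
by apply: L2_closeD; apply: close => //; exact: polyfun_lin.
Qed.

Lemma score_close j k :
  L2_close P (fun n w => score n w j k) (row_sum X0 (fun=> 1) (xi_entry j k)).
Proof.
rewrite (_ : (fun n w => score n w j k) = fun n w =>
  (row_sum X0 (fun=> 1) (quad mom (coefY j) (coefE k)) n w +
   row_sum X0 (fun i => M i j 0) (lin (coefE k)) n w) +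
  \sum_l (B^T *m KbarX spsi sdelta (Mrows n)) k l *
    Hmx spsi sdelta (Mrows n) (Xrows n w) l j); last first.
  apply/funext => n; apply/funext => w.
  by rewrite /score mxE [LHS]mxE [X in X + _ = _]mxE hmx_row_sum [X in _ + X = _]mxE.
rewrite (_ : row_sum X0 (fun=> 1) (xi_entry j k) = fun n w =>
  (row_sum X0 (fun=> 1) (quad mom (coefY j) (coefE k)) n w +
   sM j 0 * row_sum X0 (fun=> 1) (lin (coefE k)) n w) +
  \sum_l (B^T *m KbarX_lim) k l *
   (row_sum X0 (fun=> 1) (quad mom (coefY l) (coefY j)) n w +
    (sM l 0 * row_sum X0 (fun=> 1) (lin (coefY j)) n w +
     sM j 0 * row_sum X0 (fun=> 1) (lin (coefY l)) n w))); last first.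
  apply/funext => n; apply/funext => w.
  rewrite /xi_entry !row_sumD row_sumZ; congr (_ + _).
  rewrite [LHS]row_sum_sum; by apply: eq_bigr => l _; rewrite row_sumZ !row_sumD !row_sumZ.
apply: L2_closeD.
  apply: L2_closeD; first by apply: close1 => //; exact: polyfun_quad.
  by apply: close => //; exact: polyfun_lin.
apply: L2_close_sum => l; apply: (L2_closeZ _ (Hmx_close l j)).
have H : mxcvg \oo (fun n => B^T *m KbarX spsi sdelta (Mrows n)) (B^T *m KbarX_lim).
  by apply: mxcvgM; [exact: mxcvg_cst|exact: KbarX_cvg].
exact: (H k l).
Qed.

Definition xi (v : noises -> R) : 'rV[R]_(p * q) :=
  mxvec (\matrix_(j, k) xi_entry j k v).

Definition xi_cov : 'M[R]_(p * q) :=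
  \matrix_(a, b) mean P (row_at X0 0 (fun v => xi v 0 a * xi v 0 b)).

Definition xi_sum (n : nat) (w : T) : 'M[R]_(p, q) :=
  \matrix_(j, k) row_sum X0 (fun=> 1) (xi_entry j k) n w.

Let xi_mxvec j k v : xi v 0 (mxvec_index j k) = xi_entry j k v.
Proof. by rewrite mxvecE mxE. Qed.

Let xi_sum_mxvec j k n w :
  mxvec (xi_sum n w) 0 (mxvec_index j k) = row_sum X0 (fun=> 1) (xi_entry j k) n w.
Proof. by rewrite mxvecE mxE. Qed.

Lemma polyfun_xi_coord a : polyfun 2 (fun v => xi v 0 a).
Proof.
case/mxvec_indexP: a => j k; under [X in polyfun _ X]eq_fun do rewrite xi_mxvec.
exact: polyfun_xi.
Qed.

Lemma xi_coord_mean0 a : mean P (row_at X0 0 (fun v => xi v 0 a)) = 0.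
Proof.
case/mxvec_indexP: a => j k; rewrite -(xi_mean0 j k).
by apply: eq_mean => w; rewrite /row_at xi_mxvec.
Qed.

Lemma dot_xi_sum t n w : dot t (mxvec (xi_sum n w)) =
  row_sum X0 (fun=> 1) (fun v => dot t (xi v)) n w.
Proof.
rewrite row_sum_sum; apply: eq_bigr => a _; rewrite row_sumZ; congr (_ * _).
case/mxvec_indexP: a => j k; rewrite xi_sum_mxvec; congr row_sum.
by apply/funext => v; rewrite xi_mxvec.
Qed.

Lemma polyfun_dot_xi t : polyfun 2 (fun v => dot t (xi v)).
Proof. by apply: polyfun_sum => a; apply: polyfunZ; exact: polyfun_xi_coord. Qed.

Lemma dot_xi_mean0 t : mean P (row_at X0 0 (fun v => dot t (xi v))) = 0.
Proof.
rewrite [LHS]mean_sum => [|a]; last by apply: integZ; exact: (integ2 0 (polyfun_xi_coord a)).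
apply: big1 => a _; rewrite meanZ; last exact: (integ2 0 (polyfun_xi_coord a)).
by rewrite (xi_coord_mean0 a) mulr0.
Qed.

Lemma dot_xi_var t : mean P (row_at X0 0 (fun v => dot t (xi v) * dot t (xi v))) =
  (t *m xi_cov *m t^T) 0 0.
Proof.
have i2 a b : integ P (row_at X0 0 (fun v => xi v 0 a * xi v 0 b)).
  by apply: (@sqint_mul _ _ _ P (row_at X0 0 (fun v => xi v 0 a))
    (row_at X0 0 (fun v => xi v 0 b))); apply: (row_at_sqint mX indX momX);
    exact: polyfun_xi_coord.
transitivity (mean P (fun w => \sum_a \sum_b
    (t 0 a * t 0 b) * row_at X0 0 (fun v => xi v 0 a * xi v 0 b) w)).
  apply: eq_mean => w; rewrite /row_at /dot mulr_suml; apply: eq_bigr => a _.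
  by rewrite mulr_sumr; apply: eq_bigr => b _; rewrite mulrACA.
rewrite mean_sum => [|a]; last by apply: integ_sum => b; exact: integZ.
rewrite mxE; under [RHS]eq_bigr do rewrite mxE mulr_suml.
rewrite exchange_big/=; apply: eq_bigr => a _.
rewrite mean_sum => [|b]; last exact: integZ.
by apply: eq_bigr => b _; rewrite meanZ// !mxE mulrAC.
Qed.

Lemma xi_cov_psd : psdmx xi_cov.
Proof.
split; first by apply/matrixP => a b; rewrite !mxE; apply: eq_mean => w; rewrite /row_at mulrC.
by move=> t; rewrite -dot_xi_var; apply: mean_ge0 => w; rewrite /row_at -expr2 sqr_ge0.
Qed.

(** Cramer-Wold: in direction t the matrix sum becomes the row sum of the single centred polynomial
    t . xi, whose variance is the quadratic form of [xi_cov] at t. *)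
Lemma xi_sum_clt t b :
  mean P (fun w => cos (dot t (mxvec (xi_sum n w)) + b)) @[n --> \oo] -->
  expR (- ((t *m xi_cov *m t^T) 0 0) / 2) * cos b.
Proof.
rewrite -dot_xi_var.
rewrite (_ : (fun n => _) = fun n => mean P (fun w =>
  cos (row_sum X0 (fun=> 1) (fun v => dot t (xi v)) n w + b))); last first.
  by apply/funext => n; apply: eq_mean => w; rewrite dot_xi_sum.
apply: (row_sum_clt mX indX momX) => //; [exact: polyfun_dot_xi|exact: dot_xi_mean0|].
suff [] : lindeberg_class P (fun i => row_at X0 i (fun v => dot t (xi v))) by [].
apply: lindeberg_class_sum; first exact: lindeberg_class_cst.
move=> a; apply: lindeberg_classZ; case/mxvec_indexP: a => j k.
rewrite (_ : (fun i w => _) = fun i => row_at X0 i (xi_entry j k)).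
  exact: lindeberg_class_xi.
by apply/funext => i; apply/funext => w; rewrite /row_at xi_mxvec.
Qed.

Lemma xi_sum_sqint n j k : sqint P (fun w => xi_sum n w j k).
Proof.
under [X in sqint P X]eq_fun do rewrite mxE.
by apply: (row_sum_sqint mX indX momX); exact: polyfun_xi.
Qed.

Lemma score_sqint n j k : sqint P (fun w => score n w j k).
Proof. exact: (L2_close_sqint (score_close j k) n). Qed.

Lemma score_null j k : L2_null P (fun n w => score n w j k - xi_sum n w j k).
Proof.
rewrite (_ : (fun n w => _) = fun n w =>
  score n w j k - row_sum X0 (fun=> 1) (xi_entry j k) n w).
  by case: (score_close j k).
by apply/funext => n; apply/funext => w; rewrite [xi_sum _ _ _ _]mxE.
Qed.

Lemma xi_sum_bounded j k : bounded_whp P (fun x => xi_sum x.1 x.2 j k).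
Proof.
have [[sG [C HC]] _] := score_close j k.
rewrite (_ : (fun x => _) = fun x => row_sum X0 (fun=> 1) (xi_entry j k) x.1 x.2).
  exact: L2_bounded_whp sG HC.
by apply/funext => x; rewrite [LHS]mxE.
Qed.

(** This identifies Lambda. For n > 0 the second moments of the limiting row sums are exactly
    [xi_cov], and closeness in mean square transfers their limit to the score. *)
Lemma score_second_moment :
  mxcvg \oo (fun n => second_moment P (fun w => vec (score n w))) xi_cov.
Proof.
move=> a b.
have E n : second_moment P (fun w => vec (score n w)) a b =
    mean P (fun w => mxvec (score n w) 0 a * mxvec (score n w) 0 b).
  case/mxvec_indexP: a => j k; case/mxvec_indexP: b => j' k'.
  rewrite mxE (_ : (fun w => _) = fun w => score n w j k * score n w j' k').
    rewrite expectation_mean; first by apply: eq_mean => w; rewrite !mxvecE.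
    by apply: sqint_mul; exact: score_sqint.
  have vE w x : vec (score n w) x 0 = mxvec (score n w) 0 x by rewrite /vec mxE.
  by apply/funext => w; rewrite mxE big_ord1 vE [X in _ * X]mxE vE !mxvecE.
under eq_cvg do rewrite E.
case/mxvec_indexP: a {E} => j k; case/mxvec_indexP: b => j' k'.
rewrite (_ : (fun n => _) = fun n => mean P (fun w => score n w j k * score n w j' k')); last first.
  by apply/funext => n; apply: eq_mean => w; rewrite !mxvecE.
apply: (L2_close_mul (score_close j k) (score_close j' k')).
set m := xi_cov _ _.
have E n : mean P (fun w => row_sum X0 (fun=> 1) (xi_entry j k) n w *
    row_sum X0 (fun=> 1) (xi_entry j' k') n w) = (n%:R^-1 * \sum_(i < n) 1 * 1) * m.
  rewrite (mean_row_sum_mul mX indX momX) ?xi_mean0//; try exact: polyfun_xi.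
  congr (_ * _); rewrite /m mxE; apply: eq_mean => w.
  by rewrite /row_at !xi_mxvec.
have : (n%:R^-1 * \sum_(i < n) 1 * 1) * m @[n --> \oo] --> 1 * 1 * m.
  apply: cvgM; last exact: cvg_cst.
  by apply: (cvg_mean_seq (c := fun=> 1 * 1)); exact: cvg_cst.
by under eq_cvg do rewrite -E; rewrite !mul1r.
Qed.

Lemma lim_second_moment :
  lim (second_moment P (fun w => vec (score n w)) @[n --> \oo]) = xi_cov.
Proof. by apply: cvg_lim => //; apply: mxcvg_cvg; exact: score_second_moment. Qed.

(* [Hmx] is bounded in mean square, so that X'X / n and [SigmaX] have the same limit. *)
Lemma gram_cvg : mxcvg (whp P) (fun x => x.1%:R^-1 *:
  ((Xrows x.1 x.2)^T *m Xrows x.1 x.2)) (Sigma_lim spsi sdelta sM).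
Proof.
pose H x := Hmx spsi sdelta (Mrows x.1) (Xrows x.1 x.2).
have H0 : mxcvg (whp P) (fun x => (Num.sqrt x.1%:R)^-1 *: H x) 0.
  move=> l j; rewrite mxE; under eq_cvg do rewrite mxE.
  have [sF F0] := L2_bounded_null cvg_invsqrt (L2_close_bounded (Hmx_close l j)).
  exact: (L2_cvg0_whp sF F0).
have SX : mxcvg (whp P) (fun x => SigmaX spsi sdelta (Mrows x.1)) (Sigma_lim spsi sdelta sM).
  by move=> l j; apply: (@whp_cvg_det _ _ _ _ (fun n => SigmaX spsi sdelta (Mrows n) l j)); exact: SigmaX_cvg.
rewrite -[Sigma_lim _ _ _]addr0.
apply: near_mxcvg (mxcvgD SX H0).
have : \forall x \near whp P, (0 < x.1)%N by apply: (whp_near _ (nbhs_infty_gt 0)).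
apply: (@filterS _ _ (whp_filter P)) => -[n w] /= n0; rewrite /H /Hmx scalerBr !scalerA.
have s0 : Num.sqrt n%:R != 0 :> R by rewrite sqrtr_eq0 -ltNge ltr0n.
by rewrite mulVf// scale1r addrC subrK -invfM -expr2 sqr_sqrtr.
Qed.

End Model.

(** * Slutsky and the estimators *)

Section MatrixLimitsInProbability.
Context {R : realType} {d : measure_display} {T : measurableType d}.
Variable P : probability T R.

Definition mxbounded (m n : nat) (V : nat * T -> 'M[R]_(m, n)) : Prop :=
  forall i j, bounded_whp P (fun x => V x i j).

Lemma mxboundedMl (m n k : nat) (A : 'M[R]_(m, n)) (V : nat * T -> 'M[R]_(n, k)) :
  mxbounded V -> mxbounded (fun x => A *m V x).
Proof.
move=> bV i j; rewrite (_ : (fun x => _) = fun x => \sum_l A i l * V x l j); last first.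
  by apply/funext => x; rewrite mxE.
by apply: bounded_whp_sum => l; apply: bounded_whpZ; exact: bV.
Qed.

Lemma mxbounded_cvg0 (m n k : nat) (A : nat * T -> 'M[R]_(m, n))
    (V : nat * T -> 'M[R]_(n, k)) : mxcvg (whp P) A 0 -> mxbounded V ->
  mxcvg (whp P) (fun x => A x *m V x) 0.
Proof.
move=> A0 bV i j; under eq_cvg do rewrite mxE; rewrite mxE.
have : \sum_l A x i l * V x l j @[x --> whp P] --> \sum_(l < n) (0 : R).
  apply: cvg_sumr => l; under eq_cvg do rewrite mulrC.
  by apply: whp_bounded_cvg0; [exact: bV|have := A0 i l; rewrite mxE].
by rewrite big1.
Qed.

Lemma measurable_mx_norm (m n : nat) (Y : T -> 'M[R]_(m, n)) : mxmeas Y ->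
  measurable_fun setT (fun w => `|Y w|).
Proof.
move=> mY; have H (s : seq ('I_m * 'I_n)) : measurable_fun setT
    (fun w => \big[Num.max/0]_(ij <- s) `|Y w ij.1 ij.2|).
  elim: s => [|ij s IHs]; first by under eq_fun do rewrite big_nil; exact: measurable_cst.
  under eq_fun do rewrite big_cons; apply: measurable_maxr => //.
  by apply: measurableT_comp => //; exact: mY.
by rewrite (_ : (fun w => _) = fun w => \big[Num.max/0]_ij `|Y w ij.1 ij.2|)//;
  apply/funext => w; exact: mx_normrE.
Qed.

(** Measurability of Y makes the event where the norm deviation is at least r a legitimate
    exceptional event for the filter. *)
Lemma cvg_in_probability_whp (m n : nat) (Y : nat -> T -> 'M[R]_(m, n)) (L : 'M[R]_(m, n)) :
  (forall k, mxmeas (Y k)) -> cvg_in_probability P Y L ->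
  mxcvg (whp P) (fun x => Y x.1 x.2) L.
Proof.
move=> mY YL i j; apply/cvgrPdist_le => r r0 e e0.
have /fine_cvgP[Pfin /cvgrPdist_le/(_ e e0)] := YL _ r0.
move: Pfin; apply: filterS2 => k Pfin.
rewrite sub0r normrN => Pe; exists [set w | (r <= `|Y k w - L|)%R]; split.
- rewrite -[X in measurable X]setTI; apply: (measurable_fun_le (f := cst r)) => //.
  by apply: measurable_mx_norm; apply: mxmeasB => //; exact: mxmeas_cst.
- by rewrite -(fineK Pfin) lee_fin (le_trans (ler_norm _)).
- move=> w /negP; rewrite -ltNge => /ltW; apply: le_trans.
  by rewrite distrC; have := mx_entry_norm_le (Y k w - L) i j; rewrite !mxE.
Qed.

Lemma observable_mxmeas (m n m1 n1 m2 n2 : nat) (Z : T -> 'M[R]_(m1, n1))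
    (X : T -> 'M[R]_(m2, n2)) (S : T -> 'M[R]_(m, n)) :
  mxmeas Z -> mxmeas X -> observable Z X S -> mxmeas S.
Proof.
move=> mZ mX obs i j _ A mA.
have : events_of (entry S (i, j)) (setT `&` (fun w => S w i j) @^-1` A) by exists A.
move=> /obs; apply: smallest_sub; first exact: sigma_algebra_measurable.
move=> _ [[[a b]|[a b]] _ [C mC <-]]; first exact: (mZ a b measurableT).
exact: (mX a b measurableT).
Qed.

End MatrixLimitsInProbability.

Section Slutsky.
Context {R : realType} {d d' : measure_display}.
Context {T : measurableType d} {T' : measurableType d'}.
Variables (P : probability T R) (P' : probability T' R).

Lemma vec_mx_continuous (m n : nat) : continuous (@vec_mx R m n).
Proof.
move=> x; apply: (@mxcvg_cvg _ _ (nbhs x) _ _ _ (@vec_mx R m n)) => i j; under eq_cvg do rewrite mxE; rewrite mxE.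
exact: coord_continuous.
Qed.

(** Slutsky's theorem combined with a linear image. The cosine in direction t of the image under L
    is that of U in direction t L, which produces L Om L'; a remainder vanishing in probability
    changes no limit of cosines, and boundedness of U gives tightness of Y. *)
Lemma cvg_in_distribution_linear (a b m n : nat) (Om : 'M[R]_(a * b))
    (L : 'M[R]_(m * n, a * b)) (U : nat -> T -> 'M[R]_(a, b))
    (Y : nat -> T -> 'M[R]_(m, n)) (W : T' -> 'M[R]_(m, n)) :
  (forall k, mxmeas (U k)) -> (forall k, mxmeas (Y k)) ->
  mxbounded P (fun x => U x.1 x.2) ->
  (forall t c, mean P (fun w => cos (dot t (mxvec (U k w)) + c)) @[k --> \oo] -->
     expR (- ((t *m Om *m t^T) 0 0) / 2) * cos c) ->
  mxcvg (whp P) (fun x => Y x.1 x.2 - vec_mx (mxvec (U x.1 x.2) *m L^T)) 0 ->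
  (forall i, sqint P' (fun w => mxvec (W w) 0 i)) ->
  (forall t c, mean P' (fun w => cos (dot t (mxvec (W w)) + c)) =
     expR (- ((t *m (L *m Om *m L^T) *m t^T) 0 0 / 2)) * cos c) ->
  cvg_in_distribution P P' Y W.
Proof.
move=> mU mY bU Ucos YU sW Wcos f cf [C fC].
pose y k w := mxvec (Y k w); pose v w := mxvec (W w).
have my k i : measurable_fun setT (fun w => y k w 0 i).
  by case/mxvec_indexP: i => i j; under eq_fun do rewrite mxvecE; exact: mY.
have mv i : measurable_fun setT (fun w => v w 0 i) by case: (sW i).
have mu k i : measurable_fun setT (fun w => mxvec (U k w) 0 i).
  by case/mxvec_indexP: i => i j; under eq_fun do rewrite mxvecE; exact: mU.
have bu i : bounded_whp P (fun x => mxvec (U x.1 x.2) 0 i).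
  case/mxvec_indexP: i => i j; under [X in bounded_whp P X]eq_fun do rewrite mxvecE.
  exact: bU.
have yu i : y x.1 x.2 0 i - (mxvec (U x.1 x.2) *m L^T) 0 i @[x --> whp P] --> 0.
  case/mxvec_indexP: i => i j; have := YU i j; rewrite mxE; apply: cvg_trans.
  by apply: near_eq_cvg; apply: nearW => x; rewrite /y mxvecE !mxE.
have by_ i : bounded_whp P (fun x => y x.1 x.2 0 i).
  rewrite (_ : (fun x => _) = fun x => (y x.1 x.2 0 i - (mxvec (U x.1 x.2) *m L^T) 0 i) +
      \sum_k L i k * mxvec (U x.1 x.2) 0 k).
    apply: bounded_whpD; first exact: cvg0_bounded_whp.
    by apply: bounded_whp_sum => k; apply: bounded_whpZ; exact: bu.
  apply/funext => x; rewrite [X in _ - X]mxE.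
  by under [X in _ - X]eq_bigr do rewrite mxE mulrC; rewrite subrK.
have ty : tight_seq P y.
  (* Each coordinate gets the share e / N of the exceptional probability; the added 1 avoids a
     division by 0 when the matrix is empty. *)
  move=> e e0; pose N : R := (m * n)%:R + 1.
  have N0 : 0 < N by rewrite ltr_wpDl.
  have eN : 0 < e / N by exact: divr_gt0.
  have [Lb HLb] := choice (fun i => let: ex_intro2 l l0 Hl := by_ i _ eN in
    ex_intro (fun l => 0 < l /\ _) l (conj l0 Hl)).
  exists (\sum_i Lb i + 1).
    by rewrite ltr_wpDl// sumr_ge0// => i _; case: (HLb i) => /ltW.
  have : \forall k \near \oo, forall i, exists A, [/\ measurable A, (P A <= (e / N)%:E)%E &
      forall w, ~ A w -> `|y k w 0 i| <= Lb i].
    by apply: filter_forall => i; case: (HLb i).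
  apply: filterS => k /choice[A HA]; exists (\big[setU/set0]_i A i); split.
  - by apply: bigsetU_measurable => i _; case: (HA i).
  - rewrite (le_trans (probability_bigsetU_le P _ _))//; first by move=> i; case: (HA i).
    apply: (@le_trans _ _ (\sum_(i < m * n) (e / N)%:E)%E).
      by apply: lee_sum => i _; case: (HA i).
    rewrite sumEFin lee_fin sumr_const card_ord -mulr_natl mulrCA ger_pMr//.
    by rewrite ler_pdivrMr// mul1r lerDl.
  - move=> w wA i; have [_ _ H] := HA i.
    have wAi : ~ A i w by move=> Aiw; apply: wA; rewrite -bigcup_seq; exists i => //=; rewrite mem_index_enum.
    rewrite in_itv/= -ler_norml (le_trans (H _ wAi))// (bigD1 i)//= -addrA lerDl.
    by rewrite addr_ge0// sumr_ge0// => j _; case: (HLb j) => /ltW.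
have ycos t c : mean P (fun w => cos (dot t (y k w) + c)) @[k --> \oo] -->
    mean P' (fun w => cos (dot t (v w) + c)).
  rewrite Wcos; have dotL x : dot (t *m L) x = dot t (x *m L^T).
    rewrite /dot; under eq_bigr do rewrite mxE mulr_suml.
    rewrite exchange_big; apply: eq_bigr => i _; rewrite mxE mulr_sumr.
    by apply: eq_bigr => k _; rewrite mxE mulrA mulrAC.
  have mdot k s : measurable_fun setT (fun w => dot t (y k w) + c).
    by apply: measurable_funD => //; exact: measurable_dot.
  apply: (@mean_cos_close _ _ _ P _ (fun k w => dot (t *m L) (mxvec (U k w)) + c)).
  - by move=> k; apply: measurable_funD => //; exact: measurable_dot.
  - by move=> k; apply: measurable_funD => //; exact: measurable_dot.
  - have : \sum_i t 0 i * (y x.1 x.2 0 i - (mxvec (U x.1 x.2) *m L^T) 0 i)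
        @[x --> whp P] --> \sum_i t 0 i * 0.
      by apply: cvg_sumr => i; apply: cvgM; [exact: cvg_cst|exact: yu].
    rewrite [X in _ --> X -> _]big1 => [|i _]; last by rewrite mulr0.
    apply: cvg_trans; apply: near_eq_cvg; apply: nearW => x.
    rewrite dotL opprD addrACA subrr addr0 /dot -sumrB.
    by apply: eq_bigr => i _; rewrite mulrBr.
  have := Ucos (t *m L) c; rewrite trmx_mul !mulmxA mulNr.
  exact.
have fvC x : `|(f \o @vec_mx R m n) x| <= C by exact: fC.
have cfv : continuous (f \o @vec_mx R m n).
  by move=> x; apply: continuous_comp; [exact: vec_mx_continuous|exact: cf].
have tv : tight_seq P' (fun=> v) by exact: tight_sqint.
have H := weak_cvg_of_cos my mv ty tv ycos cfv fvC.
have EY k : 'E_P[f \o Y k]%E = (mean P ((f \o @vec_mx R m n) \o y k))%:E.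
  rewrite -expectation_mean; last first.
    apply: (@integ_bounded _ _ _ _ _ C) => [|w]; last exact: fvC.
    exact: (measurable_continuous (my k) cfv fvC).
  by congr 'E_P[_]%E; apply/funext => w; rewrite /= mxvecK.
have EW : 'E_P'[f \o W]%E = (mean P' ((f \o @vec_mx R m n) \o v))%:E.
  rewrite -expectation_mean; last first.
    apply: (@integ_bounded _ _ _ _ _ C) => [|w]; last exact: fvC.
    exact: (measurable_continuous mv cfv fvC).
  by congr 'E_P'[_]%E; apply/funext => w; rewrite /= mxvecK.
rewrite EW; under eq_cvg do rewrite EY.
by apply: cvg_EFin => //; exact: nearW.
Qed.

End Slutsky.

(** * Exact formulas for the estimation errors *)

Section RestrictedLeastSquares.
Context {R : realType}.

Lemma invmxZ_neq0 (n : nat) (c : R) (A : 'M[R]_n) : c != 0 -> A \in unitmx ->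
  invmx (c *: A) = c^-1 *: invmx A.
Proof.
move=> c0 uA; have H : (c *: A) *m (c^-1 *: invmx A) = 1%:M.
  by rewrite -scalemxAl -scalemxAr scalerA mulfV// scale1r mulmxV.
have [uAc _] := mulmx1_unit H.
by rewrite -[RHS](mulKmx uAc) H mulmx1.
Qed.

Lemma invmxM (n : nat) (A C : 'M[R]_n) : A \in unitmx -> C \in unitmx ->
  invmx (A *m C) = invmx C *m invmx A.
Proof.
move=> uA uC; have uAC : A *m C \in unitmx by rewrite unitmx_mul uA.
have H : A *m C *m (invmx C *m invmx A) = 1%:M by rewrite mulmxA mulmxK// mulmxV.
by rewrite -[RHS](mulKmx uAC) H mulmx1.
Qed.

Lemma posdefmx_unit (n : nat) (A : 'M[R]_n) : posdefmx A -> A \in unitmx.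
Proof.
move=> [_ pA]; rewrite -row_free_unit; apply: inj_row_free => v vA0.
apply/eqP; apply: contraT => v0.
have := pA v^T; rewrite -trmx0 (inj_eq trmx_inj) => /(_ v0).
by rewrite trmxK vA0 mul0mx mxE ltxx.
Qed.

(** If v annihilates the compressed matrix, z = v R1 A^-1 satisfies z A z' = 0, so z = 0 and v R1 =
    0; full row rank of R1 then gives v = 0. *)
Lemma posdefmx_compress (r n : nat) (A : 'M[R]_n) (R1 : 'M[R]_(r, n)) :
  posdefmx A -> \rank R1 = r -> R1 *m invmx A *m R1^T \in unitmx.
Proof.
move=> pA rR1; have uA := posdefmx_unit pA; have [sA _] := pA.
rewrite -row_free_unit; apply: inj_row_free => v vA0.
pose z := v *m R1 *m invmx A.
have zAz : z *m A *m z^T = 0.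
  rewrite /z mulmxKV// trmx_mul trmx_mul trmx_inv sA !mulmxA.
  by move: vA0; rewrite !mulmxA => ->; rewrite mul0mx.
have z0 : z = 0.
  apply/eqP; apply: contraT => z0; have [_ /(_ z^T)] := pA.
  rewrite -trmx0 (inj_eq trmx_inj) => /(_ z0).
  by rewrite trmxK zAz mxE ltxx.
have vR1 : v *m R1 = 0 by rewrite -[v *m R1](mulmxKV uA) -/z z0 mul0mx.
have fR1 : row_free R1 by rewrite /row_free rR1.
by apply: (row_free_inj fR1); rewrite mul0mx.
Qed.

(** When the inverses exist, the oblique projector onto the column space of S^-1 R1' along the
    kernel of R1. *)
Definition restriction (p r1 : nat) (R1 : 'M[R]_(r1, p)) (S : 'M[R]_p) : 'M[R]_p :=
  invmx S *m R1^T *m invmx (R1 *m invmx S *m R1^T) *m R1.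

Lemma restrictionZ (p r1 : nat) (R1 : 'M[R]_(r1, p)) (c : R) (S : 'M[R]_p) :
  c != 0 -> S \in unitmx -> R1 *m invmx S *m R1^T \in unitmx ->
  restriction R1 (c *: S) = restriction R1 S.
Proof.
move=> c0 uS uRS; rewrite /restriction invmxZ_neq0// -scalemxAr -!scalemxAl.
rewrite invmxZ_neq0 ?invr_eq0// invrK -scalemxAr -scalemxAl scalerA.
by rewrite mulVf// scale1r.
Qed.

(** For invertible R2'R2, the orthogonal projector onto the column space of R2. *)
Definition hat_mx (q r2 : nat) (R2 : 'M[R]_(q, r2)) : 'M[R]_q :=
  R2 *m invmx (R2^T *m R2) *m R2^T.

Lemma hat_mx_sym (q r2 : nat) (R2 : 'M[R]_(q, r2)) : (hat_mx R2)^T = hat_mx R2.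
Proof. by rewrite /hat_mx !trmx_mul trmx_inv trmx_mul !trmxK mulmxA. Qed.

Lemma KbarXE (p : nat) (spsi sdelta : R) (n : nat) (M : 'M[R]_(n, p)) :
  KbarX spsi sdelta M = (sdelta ^+ 2) *: invmx (SigmaX spsi sdelta M).
Proof.
rewrite /KbarX -mul_scalar_mx; congr (_ *m _).
by rewrite /SigmaX /SigmaD [LHS]addrC addKr.
Qed.

Lemma SigmaX_sym (p : nat) (spsi sdelta : R) (n : nat) (M : 'M[R]_(n, p)) :
  (SigmaX spsi sdelta M)^T = SigmaX spsi sdelta M.
Proof. by rewrite /SigmaX !linearD/= linearZ/= trmx_mul trmxK !tr_scalar_mx. Qed.

Variables (p q : nat) (spsi sdelta : R) (n : nat).
Variables (M X Delta : 'M[R]_(n, p)) (E : 'M[R]_(n, q)) (B : 'M[R]_(p, q)).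
Let s : R := Num.sqrt n%:R.
Hypothesis n0 : (0 < n)%N.
Hypothesis SXu : SigmaX spsi sdelta M \in unitmx.

(** SigmaX Kbar_X is sdelta^2 times the identity, so the centring of H, once multiplied by Kbar_X B,
    cancels the term sdelta^2 B of h. *)
Lemma score_E : ((hmx sdelta X Delta E B)^T +
    B^T *m KbarX spsi sdelta M *m Hmx spsi sdelta M X)^T =
  s^-1 *: (X^T *m (E - Delta *m B) + X^T *m X *m KbarX spsi sdelta M *m B).
Proof.
have sH : (Hmx spsi sdelta M X)^T = Hmx spsi sdelta M X.
  by rewrite /Hmx linearB/= !linearZ/= trmx_mul trmxK SigmaX_sym.
have sK : (KbarX spsi sdelta M)^T = KbarX spsi sdelta M.
  by rewrite KbarXE linearZ/= trmx_inv SigmaX_sym.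
have SK : SigmaX spsi sdelta M *m KbarX spsi sdelta M = (sdelta ^+ 2)%:M.
  by rewrite KbarXE -scalemxAr mulmxV// scalemx1.
move: (KbarX spsi sdelta M) sK SK => Kb sK SK.
rewrite linearD/= trmxK trmx_mul sH [(B^T *m _)^T]trmx_mul trmxK sK /Hmx mulmxBl -!scalemxAl !mulmxA.
rewrite SK mul_scalar_mx scalerA /hmx -/s.
by rewrite addrACA subrr addr0 scalerDr.
Qed.

(** Since X'Z = X'X B + X'(E - Delta B), it remains to write B itself as K_X^-1 (X'X)^-1 X'X K_X B
    and to put K_X = I - Kbar_X: the terms X'X B cancel and X'X Kbar_X B is left. *)
Lemma Bhat1_error : KX spsi sdelta M \in unitmx -> X^T *m X \in unitmx ->
  s *: (Bhat1 spsi sdelta M X ((X - Delta) *m B + E) - B) =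
  invmx (KX spsi sdelta M) *m invmx (n%:R^-1 *: (X^T *m X)) *m
  ((hmx sdelta X Delta E B)^T +
    B^T *m KbarX spsi sdelta M *m Hmx spsi sdelta M X)^T.
Proof.
move=> uK; rewrite score_E /Bhat1; set G := X^T *m X => uG.
set K := KX _ _ _ in uK *; set Kb := KbarX _ _ _.
have s0 : s != 0 by rewrite sqrtr_eq0 -ltNge ltr0n.
have nE : n%:R = s ^+ 2 by rewrite sqr_sqrtr.
rewrite invmxZ_neq0 ?invr_eq0 ?pnatr_eq0 -?lt0n// invrK nE -!scalemxAr -!scalemxAl scalerA.
rewrite (_ : s^-1 * s ^+ 2 = s); last by field.
congr (_ *: _).
have KE : K = 1%:M - Kb.
  rewrite /Kb KbarXE /K /KX -[SigmaD _ _](addrK ((sdelta ^+ 2)%:M)) -/(SigmaX spsi sdelta M).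
  by rewrite mulmxBr mulVmx// mul_mx_scalar.
have BE : B = invmx K *m invmx G *m (G *m (K *m B)) by rewrite -mulmxA (mulKmx uG) (mulKmx uK).
have -> : (X - Delta) *m B + E = X *m B + (E - Delta *m B).
  by rewrite mulmxBl addrAC addrA.
rewrite [X in _ - X]BE -(mulmxA _ X^T) -mulmxBr; congr (_ *m _).
rewrite mulmxDr (mulmxA X^T X) -/G KE mulmxBl mul1mx (mulmxBr G) (mulmxA G) opprB.
by rewrite [LHS]addrC addrA subrK addrC.
Qed.

Lemma Btilde_error (r1 r2 : nat) (R1 : 'M[R]_(r1, p)) (R2 : 'M[R]_(q, r2))
    (Z : 'M[R]_(n, q)) (S : 'M[R]_p) :
  s *: (Btilde spsi sdelta R1 R2 (R1 *m B *m R2) M X Z S - B) =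
  s *: (Bhat1 spsi sdelta M X Z - B) -
  restriction R1 S *m (s *: (Bhat1 spsi sdelta M X Z - B)) *m hat_mx R2.
Proof.
rewrite /Btilde addrAC scalerBr; congr (_ - _).
rewrite -mulmxBl -mulmxBr /restriction /hat_mx -scalemxAr -!scalemxAl.
by congr (_ *: _); rewrite !mulmxA.
Qed.

End RestrictedLeastSquares.

Section StackedVec.
Context {R : realType}.

Lemma vecB (m n : nat) (A C : 'M[R]_(m, n)) : vec (A - C) = vec A - vec C.
Proof. by rewrite /vec !linearB. Qed.

(** In the row-by-row order entry (i, j) has rank i q + j, so stacking matrices stacks their vecs;
    the cast only identifies (p1 + p2) q with p1 q + p2 q. *)
Lemma vec_col_mx (p1 p2 q : nat) (U : 'M[R]_(p1, q)) (V : 'M[R]_(p2, q)) :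
  vec (col_mx U V) = castmx (esym (mulnDl p1 p2 q), erefl) (col_mx (vec U) (vec V)).
Proof.
have mE m (k : 'I_m) (j : 'I_q) : mxvec_index k j = (k * q + j)%N :> nat.
  by rewrite mxvec_index_mxtens.
apply/colP => a; rewrite castmxE/= /vec [LHS]mxE; case/mxvec_indexP: a => i j.
rewrite mxvecE cast_ord_id; case: (split_ordP i) => k ->.
- rewrite col_mxEu (_ : cast_ord _ _ = lshift _ (mxvec_index k j)).
    by rewrite col_mxEu mxE mxvecE.
  apply: val_inj; rewrite -[LHS]/(nat_of_ord (mxvec_index (lshift p2 k) j)).
  by rewrite -[RHS]/(nat_of_ord (mxvec_index k j)) !mE.
- rewrite col_mxEd (_ : cast_ord _ _ = rshift _ (mxvec_index k j)).
    by rewrite col_mxEd mxE mxvecE.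
  apply: val_inj; rewrite -[LHS]/(nat_of_ord (mxvec_index (rshift p1 k) j)).
  by rewrite -[RHS]/(p1 * q + mxvec_index k j)%N !mE /= mulnDl addnA.
Qed.

Lemma castmx_mulmx (m m' n k : nat) (e : m = m') (A : 'M[R]_(m, n)) (v : 'M[R]_(n, k)) :
  castmx (e, erefl n) A *m v = castmx (e, erefl k) (A *m v).
Proof. by case: _ / e; rewrite !castmx_id. Qed.

Lemma cov_castmx (m m' n : nat) (e : m = m') (A : 'M[R]_(m, n)) (Om : 'M[R]_n) :
  castmx (e, erefl n) A *m Om *m (castmx (e, erefl n) A)^T = castmx (e, e) (A *m Om *m A^T).
Proof. by case: _ / e; rewrite !castmx_id. Qed.

(** The four blocks are those of L Om L' for L the stacked A1 and A2, so one linear image yields the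
    joint law. *)
Lemma joint_covE (p q : nat) (A1 A2 Om : 'M[R]_(p * q)) : Om^T = Om ->
  joint_cov (A1 *m Om *m A1^T) (A1 *m Om *m A2^T) (A1 *m Om *m A2^T)^T (A2 *m Om *m A2^T) =
  castmx (esym (mulnDl p p q), erefl) (col_mx A1 A2) *m Om *m
  (castmx (esym (mulnDl p p q), erefl) (col_mx A1 A2))^T.
Proof.
move=> sO; rewrite cov_castmx /joint_cov; congr castmx.
rewrite mul_col_mx tr_col_mx mul_col_row; congr block_mx.
by rewrite !trmx_mul trmxK sO mulmxA.
Qed.

End StackedVec.

(** * Joint limit law of the unrestricted and restricted estimators *)

Theorem theorem3p1 (R : realType) (d : measure_display) (T : measurableType d)
    (P : probability T R) (p q r1 r2 : nat)
    (seps g1eps g2eps sdelta g1delta g2delta spsi g1psi g2psi : R)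
    (eps : nat -> 'I_q -> {RV P >-> R})
    (delta psi : nat -> 'I_p -> {RV P >-> R})
    (M : nat -> 'cV[R]_p) (sM : 'cV[R]_p) (B : 'M[R]_(p, q))
    (R1 : 'M[R]_(r1, p)) (R2 : 'M[R]_(q, r2)) (theta : 'M[R]_(r1, r2))
    (Sigmahat : nat -> T -> 'M[R]_p) (Q0 : 'M[R]_p) :
  let Mn n : 'M[R]_(n, p) := \matrix_(i < n, j < p) M i j 0 in
  let E := first_rows eps in
  let Delta := first_rows delta in
  let Psi := first_rows psi in
  let D n w := Mn n + Psi n w in
  let X n w := D n w + Delta n w in
  let Z n w := D n w *m B + E n w in
  let eps_ (ij : nat * 'I_q) : T -> R := eps ij.1 ij.2 in
  let delta_ (ij : nat * 'I_p) : T -> R := delta ij.1 ij.2 in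
  let psi_ (ij : nat * 'I_p) : T -> R := psi ij.1 ij.2 in
  let u n w := uvec spsi sdelta (Mn n) (X n w) (Delta n w) (E n w) B in
  let Lambda : 'M[R]_(p * q) := lim (second_moment P (u n) @[n --> \oo]) in
  let A1 : 'M[R]_(p * q) := A1mx q spsi sdelta sM in
  let A2 : 'M[R]_(p * q) := A2mx spsi sdelta R1 R2 sM Q0 in
  let Sigma11 := A1 *m Lambda *m A1^T in
  let Sigma12 := A1 *m Lambda *m A2^T in
  let Sigma22 := A2 *m Lambda *m A2^T in
  let hatB1 n w := Bhat1 spsi sdelta (Mn n) (X n w) (Z n w) in
  let tildeB n w :=
    Btilde spsi sdelta R1 R2 theta (Mn n) (X n w) (Z n w) (Sigmahat n w) in
  0 <= seps -> 0 <= sdelta -> 0 <= spsi ->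
  (* (i) *)
  independent_RVs P eps_ ->
  (forall i j, moments4 P (eps i j) seps g1eps g2eps) ->
  (* (ii) *)
  independent_RVs P delta_ ->
  (forall i j k l, same_law (delta i j) (delta k l)) ->
  (forall i j, moments4 P (delta i j) sdelta g1delta g2delta) ->
  (* (iii) *)
  independent_RVs P psi_ ->
  (forall i j k l, same_law (psi i j) (psi k l)) ->
  (forall i j, moments4 P (psi i j) spsi g1psi g2psi) ->
  (* (iv) *)
  mutually_independent P (fun k : 'I_3 =>
    nth set0 [:: sigma_of delta_; sigma_of psi_; sigma_of eps_] k) ->
  (* (v) *)
  M n @[n --> \oo] --> sM ->
  (* (vi) *)
  (\forall n \near \oo, {ae P, forall w, \rank (X n w) = p}) ->
  \rank R1 = r1 -> \rank R2 = r2 ->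
  (* existence of the inverses *)
  (\forall n \near \oo, SigmaX spsi sdelta (Mn n) \in unitmx) ->
  (\forall n \near \oo, KX spsi sdelta (Mn n) \in unitmx) ->
  Sigma_lim spsi sdelta sM \in unitmx ->
  Sigma_lim spsi sdelta sM *m K_lim spsi sdelta sM \in unitmx ->
  (* the weight matrix *)
  (forall n, observable (Z n) (X n) (Sigmahat n)) ->
  (\forall n \near \oo, {ae P, forall w, posdefmx (Sigmahat n w)}) ->
  cvg_in_probability P (fun n w => n%:R^-1 *: Sigmahat n w) Q0 ->
  posdefmx Q0 ->
  R1 *m B *m R2 = theta ->
  exists (d' : measure_display) (T' : measurableType d')
      (P' : probability T' R) (eta1 zeta : T' -> 'M[R]_(p, q)),
    normal_mx P' (fun w => col_mx (eta1 w) (zeta w)) (col_mx 0 0)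
      (joint_cov Sigma11 Sigma12 Sigma12^T Sigma22) /\
    cvg_in_distribution P P'
      (fun n w => col_mx (Num.sqrt n%:R *: (hatB1 n w - B))
                         (Num.sqrt n%:R *: (tildeB n w - B)))
      (fun w => col_mx (eta1 w) (zeta w)).
Proof.
move=> Mn E Delta Psi D X Z eps_ delta_ psi_ u Lambda A1 A2 S11 S12 S22 hatB1 tildeB.
move=> _ _ _ indE momE indD lawD momD indP lawP momP ind3 cM _ rR1 _ _ _ SigU SKU.
move=> obs _ Scvg pQ RBR.
have indX := noise_independent indE indD indP ind3.
have LE := lim_second_moment B indX momE momD momP cM SigU.
have clt := @xi_sum_clt _ _ _ _ _ _ _ _ _ _ _ _ _ _ _ _ _ _ sM B indX momE lawD momD lawP momP.
have Upsd := xi_cov_psd sM B indX momE momD momP.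
have Usq := xi_sum_sqint sM B indX momE momD momP.
have Ubd := xi_sum_bounded B indX momE momD momP cM SigU.
have Unull := score_null B indX momE momD momP cM SigU.
have gram := gram_cvg indX momE momD momP cM.
set Om := xi_cov _ _ _ _ _ _ _ _ _ _ _ _ _ _ in LE clt Upsd.
set U := xi_sum _ _ _ _ _ _ _ _ _ _ _ _ _ _ in clt Usq Ubd Unull.
have {}LE : Lambda = Om by exact: LE.
set Sig := Sigma_lim spsi sdelta sM in SigU SKU gram.
set K := K_lim spsi sdelta sM in SKU.
pose W := invmx (Sig *m K); pose C := restriction R1 Q0; pose Gm := hat_mx R2.
pose V n w := score sdelta spsi eps delta psi M B n w.
pose L : 'M[R]_((p + p) * q, p * q) := castmx (esym (mulnDl p p q), erefl) (col_mx A1 A2).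
(* Through vec(A Y C) = (A tensor C') vec Y, with [Gm] symmetric, multiplication by A1 and A2 is the
   limiting form of the two error formulas applied to a matrix v. *)
have LvE v : vec_mx (mxvec v *m L^T) = col_mx (W *m v) (W *m v - C *m (W *m v) *m Gm).
  apply: (can_inj (@mxvecK _ _ _)); apply: trmx_inj; rewrite vec_mxK -/(vec _) vec_col_mx.
  rewrite trmx_mul trmxK castmx_mulmx; congr castmx; rewrite mul_col_mx.
  have A1E : A1 *m (mxvec v)^T = vec (W *m v).
    by rewrite -[W *m v]mulmx1 vec_mulmx trmx1.
  rewrite A1E; congr (col_mx _ _); rewrite /A2 /A2mx mulmxBl A1E.
  rewrite vecB; congr (_ - _).
  rewrite [RHS](_ : _ = vec (C *m W *m v *m Gm)); last by rewrite !mulmxA.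
  by rewrite vec_mulmx hat_mx_sym.
have Ku : K \in unitmx by move: SKU; rewrite unitmx_mul => /andP[].
have SX : mxcvg (whp P) (fun x => SigmaX spsi sdelta (Mn x.1)) Sig.
  move=> i j; apply: (@whp_cvg_det _ _ _ _ (fun n => SigmaX spsi sdelta (Mn n) i j)).
  exact: SigmaX_cvg.
have KXc : mxcvg (whp P) (fun x => KX spsi sdelta (Mn x.1)) K.
  apply: mxcvgM; first exact: mxcvgV.
  rewrite [X in mxcvg _ _ X](_ : _ = sM *m sM^T + (spsi ^+ 2)%:M); last exact: addrK.
  move=> i j; apply: (@whp_cvg_det _ _ _ _ (fun n => SigmaD spsi (Mn n) i j)).
  exact: SigmaD_cvg.
pose g x := x.1%:R^-1 *: ((X x.1 x.2)^T *m X x.1 x.2).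
have gc : mxcvg (whp P) g Sig by exact: gram.
pose A x := invmx (KX spsi sdelta (Mn x.1)) *m invmx (g x).
have Ac : mxcvg (whp P) A W.
  by rewrite /W invmxM//; apply: mxcvgM; exact: mxcvgV.
have mrows k (a : nat -> 'I_k -> {RV P >-> R}) n : mxmeas (first_rows a n).
  move=> i j; rewrite (_ : (fun w => _) = a i j) //.
  by apply/funext => w; rewrite mxE.
have mD n : mxmeas (D n) by apply: mxmeasD; [exact: mxmeas_cst|exact: mrows].
have mX n : mxmeas (X n) by apply: mxmeasD; [exact: mD|exact: mrows].
have mZ n : mxmeas (Z n).
  by apply: mxmeasD; [apply: mxmeasM; [exact: mD|exact: mxmeas_cst]|exact: mrows].
have mS n : mxmeas (Sigmahat n) := observable_mxmeas (mZ n) (mX n) (obs n).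
pose S x := x.1%:R^-1 *: Sigmahat x.1 x.2.
have Sc : mxcvg (whp P) S Q0.
  by apply: (cvg_in_probability_whp (Y := fun n w => n%:R^-1 *: Sigmahat n w)) => // n; exact: mxmeasZ.
have Q0u := posdefmx_unit pQ; have RQu := posdefmx_compress pQ rR1.
have RSc : mxcvg (whp P) (fun x => R1 *m invmx (S x) *m R1^T) (R1 *m invmx Q0 *m R1^T).
  apply: mxcvgM; last exact: mxcvg_cst.
  by apply: mxcvgM; [exact: mxcvg_cst|exact: mxcvgV].
have Cc : mxcvg (whp P) (fun x => restriction R1 (S x)) C.
  apply: mxcvgM; last exact: mxcvg_cst.
  apply: mxcvgM; last exact: mxcvgV.
  by apply: mxcvgM; [exact: mxcvgV|exact: mxcvg_cst].
have mhatB n : mxmeas (hatB1 n).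
  apply: mxmeasM => //; apply: mxmeasM; last exact: mxmeasT.
  apply: mxmeasM; first exact: mxmeas_cst.
  by apply: mxmeasV; apply: mxmeasM => //; exact: mxmeasT.
have mtilB n : mxmeas (tildeB n).
  apply: mxmeasB; [exact: mhatB|apply: mxmeasM; last exact: mxmeas_cst].
  apply: mxmeasM; last exact: mxmeas_cst.
  have mRS : mxmeas (fun w => invmx (Sigmahat n w) *m R1^T).
    by apply: mxmeasM; [exact: mxmeasV|exact: mxmeas_cst].
  apply: mxmeasM.
    apply: mxmeasM => //; apply: mxmeasV; apply: mxmeasM; last exact: mxmeas_cst.
    by apply: mxmeasM; [exact: mxmeas_cst|exact: mxmeasV].
  apply: mxmeasB; last exact: mxmeas_cst.
  by apply: mxmeasM; [apply: mxmeasM; [exact: mxmeas_cst|exact: mhatB]|exact: mxmeas_cst].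
pose Y n w := col_mx (Num.sqrt n%:R *: (hatB1 n w - B)) (Num.sqrt n%:R *: (tildeB n w - B)).
have mY n : mxmeas (Y n).
  move=> i j; case: (split_ordP i) => k ->.
    under eq_fun do rewrite col_mxEu.
    by apply: mxmeasZ; apply: mxmeasB; [exact: mhatB|exact: mxmeas_cst].
  under eq_fun do rewrite col_mxEd.
  by apply: mxmeasZ; apply: mxmeasB; [exact: mtilB|exact: mxmeas_cst].
have VU : mxcvg (whp P) (fun x => V x.1 x.2 - U x.1 x.2) 0.
  move=> j k; rewrite mxE; have [s0 c0] := Unull j k.
  have := L2_cvg0_whp s0 c0; apply: cvg_trans; apply: near_eq_cvg.
  by apply: nearW => x; rewrite /V [RHS]mxE [X in _ = _ + X]mxE.
(* Split as (A - W) U + A (V - U): null times bounded in probability, then convergent times null.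
   The product with the restriction is treated in the same way below. *)
have AVWU : mxcvg (whp P) (fun x => A x *m V x.1 x.2 - W *m U x.1 x.2) 0.
  have -> : (fun x => A x *m V x.1 x.2 - W *m U x.1 x.2) = fun x =>
      (A x - W) *m U x.1 x.2 + A x *m (V x.1 x.2 - U x.1 x.2).
    by apply/funext => x; rewrite mulmxBl mulmxBr [RHS]addrC addrA subrK.
  rewrite -[0]addr0; apply: mxcvgD.
    by apply: mxbounded_cvg0 => //; rewrite -(subrr W); apply: mxcvgB => //; exact: mxcvg_cst.
  by rewrite -(mulmx0 _ W); exact: mxcvgM.
have CAV : mxcvg (whp P) (fun x => restriction R1 (S x) *m (A x *m V x.1 x.2)
    - C *m (W *m U x.1 x.2)) 0.
  have -> : (fun x => restriction R1 (S x) *m (A x *m V x.1 x.2) - C *m (W *m U x.1 x.2)) =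
      fun x => (restriction R1 (S x) - C) *m (W *m U x.1 x.2) +
        restriction R1 (S x) *m (A x *m V x.1 x.2 - W *m U x.1 x.2).
    by apply/funext => x; rewrite mulmxBl mulmxBr [RHS]addrC addrA subrK.
  rewrite -[0]addr0; apply: mxcvgD.
    apply: mxbounded_cvg0; last exact: mxboundedMl.
    by rewrite -(subrr C); apply: mxcvgB => //; exact: mxcvg_cst.
  by rewrite -(mulmx0 _ C); exact: mxcvgM.
have YU : mxcvg (whp P) (fun x => Y x.1 x.2 - vec_mx (mxvec (U x.1 x.2) *m L^T)) 0.
  pose Y' x := col_mx (A x *m V x.1 x.2 - W *m U x.1 x.2)
    ((A x *m V x.1 x.2 - W *m U x.1 x.2) -
     (restriction R1 (S x) *m (A x *m V x.1 x.2) - C *m (W *m U x.1 x.2)) *m Gm).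
  have Y'c : mxcvg (whp P) Y' 0.
    move=> i j; rewrite mxE; case: (split_ordP i) => k ->.
      under eq_cvg do rewrite col_mxEu.
      by have := AVWU k j; rewrite mxE.
    under eq_cvg do rewrite col_mxEd.
    have cG : mxcvg (whp P) (fun=> Gm) Gm by exact: mxcvg_cst.
    have H : mxcvg (whp P) (fun x => (A x *m V x.1 x.2 - W *m U x.1 x.2) -
        (restriction R1 (S x) *m (A x *m V x.1 x.2) - C *m (W *m U x.1 x.2)) *m Gm)
        (0 - 0 *m Gm) by apply: mxcvgB => //; exact: mxcvgM.
    by move: (H k j); rewrite mul0mx subr0 mxE.
  (* [Y'] is what remains of the error once the exact formulas are inserted. They hold wherever the
     matrices concerned are invertible, which is eventual along the filter because their limits
     are. *)
  apply: near_mxcvg Y'c.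
  have n0 : \forall x \near whp P, (0 < x.1)%N by apply: (whp_near _ (nbhs_infty_gt 0)).
  have uSX := mxcvg_near_unit SX SigU; have uK := mxcvg_near_unit KXc Ku.
  have ug := mxcvg_near_unit gc SigU; have uS := mxcvg_near_unit Sc Q0u.
  have uRS := mxcvg_near_unit RSc RQu.
  near=> x; have xn : (0 < x.1)%N by near: x.
  have xSX : SigmaX spsi sdelta (Mn x.1) \in unitmx by near: x; exact: uSX.
  have xK : KX spsi sdelta (Mn x.1) \in unitmx by near: x; exact: uK.
  have xg : g x \in unitmx by near: x; exact: ug.
  have xS : S x \in unitmx by near: x; exact: uS.
  have xRS : R1 *m invmx (S x) *m R1^T \in unitmx by near: x; exact: uRS.
  have nz : x.1%:R != 0 :> R by rewrite pnatr_eq0 -lt0n.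
  have ZE : Z x.1 x.2 = (X x.1 x.2 - Delta x.1 x.2) *m B + E x.1 x.2 by rewrite /Z /X addrK.
  have hatE : Num.sqrt x.1%:R *: (hatB1 x.1 x.2 - B) = A x *m V x.1 x.2.
    rewrite /hatB1 ZE Bhat1_error//.
    by move: xg; rewrite /g unitmxZ// unitfE invr_eq0.
  have tilE : Num.sqrt x.1%:R *: (tildeB x.1 x.2 - B) =
      A x *m V x.1 x.2 - restriction R1 (S x) *m (A x *m V x.1 x.2) *m Gm.
    have RE : restriction R1 (Sigmahat x.1 x.2) = restriction R1 (S x).
      (* Invariance under scaling replaces Sigmahat, whose limit is not assumed, by Sigmahat / n. *)
      by rewrite -(restrictionZ nz xS xRS) /S scalerA mulfV// scale1r.
    by rewrite /tildeB -RBR Btilde_error -/(hatB1 x.1 x.2) hatE RE.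
  rewrite LvE /Y hatE tilE opp_col_mx add_col_mx; congr col_mx.
  by rewrite mulmxBl !opprD opprK addrACA.
have Lpsd : psdmx (L *m Om *m L^T).
  have [sO pO] := Upsd; split; first by rewrite !trmx_mul trmxK sO mulmxA.
  by move=> x; have := pO (x *m L); rewrite trmx_mul !mulmxA.
(* The pair of limits is cut out of a single normal matrix with p + p rows, which makes the two
   parts jointly normal. *)
have [d' [T' [P' [H [nH sH Hcos]]]]] := normal_mx_exists Lpsd.
exists d', T', P', (fun w => usubmx (H w)), (fun w => dsubmx (H w)).
have -> : (fun w => col_mx (usubmx (H w)) (dsubmx (H w))) = H.
  by apply/funext => w; rewrite vsubmxK.
split.
  by rewrite col_mx0 /S11 /S12 /S22 LE joint_covE//; case: Upsd.
apply: (@cvg_in_distribution_linear _ _ _ _ _ P P' _ _ _ _ Om L U) => //.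
by move=> n j k; case: (Usq n j k).
Unshelve. all: by end_near.
Qed.
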